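(* For any non-empty choice of bases $\mathscr{B}'\subseteq\{2,3,\ldots\}$, there are two collections of probability measures $\mathscr{M}(\mathscr{B}')\subseteq\mathscr{M}^{\ast}(\mathscr{B}')$ on $[0,1)$ with the following properties. (a) For any $\mu\in\mathscr{M}^{\ast}(\mathscr{B}')$, $\mu$-almost every point is non-normal in every base of $\mathscr{B}'$. (b) For every $\mu\in\mathscr{M}(\mathscr{B}')$, $\mu$-almost every point $x$ lies in $\mathscr N(\mathscr{B},\mathscr{B}')$, where $\mathscr{B}:=\{2,3,\ldots\}\setminus\overline{\mathscr{B}'}$ is the largest collection of bases for which $(\mathscr{B},\mathscr{B}')$ is a compatible pair. (c) For every $\eta\in(0,1)$, there exists a measure $\mu_{\eta}\in\mathscr{M}(\mathscr{B}')$ obeying $$\sup\left\{\frac{\mu_{\eta}([x-r,x+r])}{r^{1-\eta}}\;:\;x\in\mathbb R,\ r>0\right\}<\infty .$$ The measure $\mu_{\eta}$ can be chosen to be Rajchman.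
   Context: $\mathbb N=\{1,2,3,\dots\}$. Normality: for an integer $b\ge 2$ and $x\in[0,1)$ write $x=\sum_{j\ge1}x_jb^{-j}$ with digits $x_j\in\{0,\dots,b-1\}$. The number $x$ is $b$-normal (normal in base $b$) if for every $k\ge1$ and every $(d_1,\dots,d_k)\in\{0,\dots,b-1\}^k$, $\lim_{N\to\infty}\frac1N\#\{1\le n\le N:(x_n,\dots,x_{n+k-1})=(d_1,\dots,d_k)\}=b^{-k}$; otherwise it is non-normal in base $b$. A real number is $b$-normal if its fractional part is. For non-empty collections of bases $\mathscr B,\mathscr B'$, $\mathscr N(\mathscr B,\mathscr B')$ is the set of real $x$ that are $b$-normal for all $b\in\mathscr B$ and not $b'$-normal for any $b'\in\mathscr B'$. If $\mathscr B=\emptyset$, $\mathscr N(\emptyset,\mathscr B')$ denotes the set of real $x$ that are not $b$-normal for any $b\in\mathbb N\setminus\{1\}$. For $r,s\in\mathbb N\setminus\{1\}$ write $r\sim s$ if $r^m=s^n$ for some $m,n\in\mathbb N$, and $r\not\sim s$ otherwise. $\overline{\mathscr B'}:=\{b\in\mathbb N\setminus\{1\}: b\sim b_0\text{ for some }b_0\in\mathscr B'\}$. The pair $(\mathscr B,\mathscr B')$ is compatible if $b\not\sim b'$ for all $(b,b')\in\mathscr B\times\mathscr B'$ (vacuously true if exactly one of the two is empty). Measures are Borel; a measure on $[0,1)$ is regarded as a measure on $\mathbb R$. It is Rajchman if $\widehat\mu(n)=\int_0^1e^{-2\pi inx}\,d\mu(x)\to0$ as $|n|\to\infty$, $n\in\mathbb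 Z$. *)

(* Defs.v *)
From HB Require Import structures.
From mathcomp Require Import all_boot all_order all_algebra.
From mathcomp Require Import complex.
From mathcomp Require Import all_classical all_reals all_analysis.

Set Implicit Arguments.
Unset Strict Implicit.
Unset Printing Implicit Defensive.

Import Order.TTheory GRing.Theory Num.Theory.
Import numFieldNormedType.Exports.

Local Open Scope classical_set_scope.
Local Open Scope ring_scope.

Definition bases : set nat := [set b | (1 < b)%N].

Definition frac_part (R : realType) (x : R) : R := x - (Num.floor x)%:~R.

(* The j-th base-b digit (j >= 1) of the fractional part of x, i.e.
   floor (b^j {x}) mod b. When {x} has two base-b expansions, this picks the
   terminating one; {x} is then not b-normal for either of them. *)
Definition digit (R : realType) (b : nat) (x : R) (j : nat) : nat :=
  (Num.truncn (b%:R ^+ j * frac_part x) %% b)%N.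

(* Tuples are indexed from 0, so position n + i is compared with entry i. *)
Definition block_count (R : realType) (b k : nat) (x : R)
    (d : k.-tuple 'I_b) (N : nat) : nat :=
  count (fun n => [forall i : 'I_k, digit b x (n + i) == tnth d i]) (iota 1 N).

Definition normal (R : realType) (b : nat) (x : R) : Prop :=
  forall (k : nat) (d : k.-tuple 'I_b), (0 < k)%N ->
    (fun N : nat => (block_count x d N)%:R / N%:R : R) @ \oo
      --> (b%:R ^- k : R).

Definition normal_set (R : realType) (B B' : set nat) : set R :=
  [set x | if `[< B = set0 >] then forall b, bases b -> ~ normal b x
           else (forall b, B b -> normal b x) /\
                (forall b, B' b -> ~ normal b x)].

Definition mult_dep (r s : nat) : Prop :=
  exists m n : nat, [/\ (0 < m)%N, (0 < n)%N & (r ^ m = s ^ n)%N].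

Definition base_closure (B' : set nat) : set nat :=
  [set b | bases b /\ exists2 b0, B' b0 & mult_dep b b0].

Definition compatible (B B' : set nat) : Prop :=
  forall b b', B b -> B' b' -> ~ mult_dep b b'.

Definition largest_compatible (B B' : set nat) : Prop :=
  [/\ B `<=` bases, compatible B B' &
      forall C, C `<=` bases -> compatible C B' -> C `<=` B].

(* Measures on [0, 1) are Borel measures on the line carried by [0, 1). *)
Definition prob01 (R : realType) : set (probability (measurableTypeR R) R) :=
  [set mu : probability (measurableTypeR R) R | mu `[0, 1[%classic = 1%E].

(* Real and imaginary parts of the integral of exp (- 2 pi i n x). *)
Definition fourier_coef (R : realType) (mu : probability (measurableTypeR R) R)
    (n : int) : R[i] :=
  Complex (Rintegral mu `[0, 1[%classic (fun x : R => cos (2 * pi * n%:~R * x)))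
          (- Rintegral mu `[0, 1[%classic (fun x : R => sin (2 * pi * n%:~R * x))).

Definition Rajchman (R : realType) (mu : probability (measurableTypeR R) R) :
    Prop :=
  forall e : R, 0 < e -> exists n0 : nat, forall n : int, (n0 <= `|n|)%N ->
    Normc.normc (fourier_coef mu n) < e.

Definition ball_sup (R : realType) (mu : probability (measurableTypeR R) R)
    (s : R) : \bar R :=
  ereal_sup [set y | exists x r : R,
    0 < r /\ y = (mu `[(x - r)%R, (x + r)%R]%classic * ((r `^ s)^-1)%:E)%E].

(* Main.v *)
(* Enumerate the multiplicative closure of the given bases as q_0, q_1, ..., every base
   b occurring so often that the sum of 1 / (k + 1) over the k with q_k = b diverges.
   Start from Lebesgue measure on [0, 1). Stage k replaces the density by its product
   with a small perturbation: the base-q_k digits in positions n_k + 1, ..., 2 n_k are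
   made independent with weight 1 + eps for 0 and 1 - eps for q_k - 1, and this digit
   measure is mixed in with coefficient 1 / (k + 1), where n_k grows very fast.
   - In every cell, stage k makes the digit 0 too frequent in its window with conditional
     probability at least 1 / (2 (k + 1)), so almost surely this happens infinitely often
     for each base of the closure.
   - Stage k changes Fourier coefficients by at most 2 / (k + 1), and hardly changes the
     low ones, so they tend to 0.
   - If b is independent of q_k, the base-q_k mantissas of the frequencies u b^i
     equidistribute, so most of these frequencies meet a window digit where the factor of
     the digit product is bounded away from 1, and the coefficients at u b^i have a small
     sum. The second moments of the Weyl sums S_N are then small enough for
     sum |S_N|^2 / N^3 to have finite integral, and Weyl's criterion applies.
   - The density grows by at most (1 + eps)^n_k <= q_k^(eta n_k) while the scale drops by
     q_k^(2 n_k), which gives the ball condition. *)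
From HB Require Import structures.
Require Import Defs.
From mathcomp Require Import all_boot all_order all_algebra.
From mathcomp Require Import complex.
From mathcomp Require Import all_classical all_reals all_analysis.
From mathcomp Require Import measurable_realfun.
From mathcomp Require Import ring lra zify.
Import Order.TTheory GRing.Theory Num.Theory.
Import numFieldNormedType.Exports.
Local Open Scope classical_set_scope.
Local Open Scope ring_scope.
Set Implicit Arguments.
Unset Strict Implicit.
Unset Printing Implicit Defensive.
Import Normc.

(** * Exponential sums *)

Arguments normc : simpl never.

(** The coefficients 1 / (k + 1) balance two demands: Fourier decay requires them to tend to 0, and
    almost sure bias requires their sum to diverge along each base. The window starts at n_k + 1
    because the earlier stages may belong to other bases, whose grid cells no base-q_k interval need
    respect. Intervals of length q_k^(-n_k) are so short that nearly all of them lie inside one old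
    cell; on the rest the density is left alone. The window is as long as the stretch before it, so
    a bias in it moves the digit frequencies between n_k and 2 n_k by a fixed amount. The stages run
    over the whole closure because, when the closure contains every base, the points must be
    non-normal in all bases. All Fourier estimates are made on the step densities of the stages. At
    a frequency xi the stages with q_k^n_k far above xi change little, and their changes add up like
    a geometric series, so the bounds pass to the limit measure. *)

Lemma normc_ge0 (R : rcfType) (x : R[i]) : 0 <= normc x.
Proof. by case: x => a b; exact: sqrtr_ge0. Qed.

Lemma normc_real (R : rcfType) (a : R) : normc a%:C%C = `|a|.
Proof. by rewrite /normc /= expr0n /= addr0 sqrtr_sqr. Qed.

Lemma ler_normcD (R : rcfType) (x y : R[i]) : normc (x + y) <= normc x + normc y.
Proof. exact: (@le_normcD R). Qed.

Lemma normc_opp (R : rcfType) (x : R[i]) : normc (- x) = normc x.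
Proof. exact: (@normcN R). Qed.

Lemma ler_normcB (R : rcfType) (x y : R[i]) : normc (x - y) <= normc x + normc y.
Proof. by rewrite (le_trans (ler_normcD x (- y)))// normc_opp. Qed.

Lemma normc_sum (R : rcfType) (I : Type) (r : seq I) (P : pred I) (F : I -> R[i]) :
  normc (\sum_(i <- r | P i) F i) <= \sum_(i <- r | P i) normc (F i).
Proof.
elim/big_rec2: _ => [|i y x _ yx]; first by rewrite normc0.
by rewrite (le_trans (ler_normcD _ _))// lerD2l.
Qed.

Lemma normc_sqr (R : rcfType) (x : R[i]) : normc x ^+ 2 = complex.Re x ^+ 2 + complex.Im x ^+ 2.
Proof. by case: x => a b /=; rewrite sqr_sqrtr// addr_ge0// sqr_ge0. Qed.

Lemma Re_le_normc (R : rcfType) (x : R[i]) : complex.Re x <= normc x.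
Proof.
rewrite (le_trans (ler_norm _))// -ler_sqr ?nnegrE ?normc_ge0// normc_sqr.
by rewrite real_normK ?num_real// lerDl sqr_ge0.
Qed.

Lemma ReD (R : rcfType) (x y : R[i]) : complex.Re (x + y) = complex.Re x + complex.Re y.
Proof. by case: x y => [a b] [c d]. Qed.

Lemma ImD (R : rcfType) (x y : R[i]) : complex.Im (x + y) = complex.Im x + complex.Im y.
Proof. by case: x y => [a b] [c d]. Qed.

Lemma Re_sum (R : rcfType) (I : Type) (r : seq I) (P : pred I) (F : I -> R[i]) :
  complex.Re (\sum_(i <- r | P i) F i) = \sum_(i <- r | P i) complex.Re (F i).
Proof. by elim/big_rec2: _ => [//|i y x _ <-]; rewrite ReD. Qed.

Lemma Im_sum (R : rcfType) (I : Type) (r : seq I) (P : pred I) (F : I -> R[i]) :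
  complex.Im (\sum_(i <- r | P i) F i) = \sum_(i <- r | P i) complex.Im (F i).
Proof. by elim/big_rec2: _ => [//|i y x _ <-]; rewrite ImD. Qed.

Section cis.
Context {R : realType}.
Implicit Types x y t : R.

Definition cis t : R[i] := Complex (cos (2 * pi * t)) (sin (2 * pi * t)).
Arguments cis : simpl never.

Lemma pi_ge1 : 1 <= pi :> R.
Proof. by rewrite (le_trans _ (pi_ge2 R))// ler1n. Qed.

Lemma cisD x y : cis (x + y) = cis x * cis y.
Proof.
rewrite /cis mulrDr cosD sinD; apply/eqP; rewrite eq_complex /= eqxx /=.
by rewrite addrC.
Qed.

Lemma cis0 : cis 0 = 1.
Proof. by rewrite /cis mulr0 cos0 sin0. Qed.

Lemma cis_natM t n : cis (t * n%:R) = cis t ^+ n.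
Proof.
elim: n => [|n IHn]; first by rewrite mulr0 cis0 expr0.
by rewrite -natr1 mulrDr mulr1 cisD IHn exprSr.
Qed.

Lemma cis1 : cis 1 = 1.
Proof. by rewrite /cis mulr1 mulr_natl cos2pi sin2pi. Qed.

Lemma cis_nat n : cis n%:R = 1.
Proof. by rewrite -[n%:R]mul1r cis_natM cis1 expr1n. Qed.

Lemma cisDnat t n : cis (t + n%:R) = cis t.
Proof. by rewrite cisD cis_nat mulr1. Qed.

Lemma cisDint t (z : int) : cis (t + z%:~R) = cis t.
Proof.
case: z => n; first by rewrite cisDnat.
rewrite NegzE mulrNz -[LHS]mulr1 -[in LHS](cis_nat n.+1) -cisD.
by rewrite subrK.
Qed.

Lemma normc_cis t : normc (cis t) = 1.
Proof. by rewrite /normc /= cos2Dsin2 sqrtr1. Qed.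

Lemma abs_sin_le t : `|sin t| <= `|t|.
Proof.
wlog t0 : t / 0 <= t => [hw|].
  have [/hw//|/ltW t0] := leP 0 t.
  by rewrite -normrN -sinN -(normrN t) hw// oppr_ge0.
have [->|tn0] := eqVneq t 0; first by rewrite sin0.
have {}t0 : 0 < t by rewrite lt_neqAle eq_sym tn0.
have [|c _] := @MVT R (@sin R) (@cos R) 0 t t0 (fun x _ => is_derive_sin x).
- exact/continuous_subspaceT/continuous_sin.
- rewrite sin0 !subr0 => ->.
  by rewrite normrM ler_piMl// cos_max.
Qed.

Lemma normc_cisB1 t : normc (cis t - 1) = 2 * `|sin (pi * t)|.
Proof.
have h : cis t - 1 = Complex (cos (2 * pi * t) - 1) (sin (2 * pi * t)).
  by apply/eqP; rewrite eq_complex/= subr0 !eqxx.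
rewrite h /normc.
have -> : 2 * pi * t = (pi * t) *+ 2 by rewrite -mulrA mulr_natl.
rewrite cos_mulr2n sin_mulr2n cos2sin2.
rewrite (_ : _ + _ = (2 * sin (pi * t)) ^+ 2); last first.
  rewrite -[(_ * _) *+ 2]mulr_natl exprMn [(cos _ * _) ^+ 2]exprMn cos2sin2; ring.
by rewrite sqrtr_sqr normrM ger0_norm.
Qed.

Lemma cis_lip x y : normc (cis x - cis y) <= 2 * pi * `|x - y|.
Proof.
have -> : cis x - cis y = cis y * (cis (x - y) - 1).
  by rewrite mulrBr mulr1 -cisD [y + _]addrC subrK.
rewrite normcM normc_cis mul1r normc_cisB1 -mulrA ler_pM2l//.
by rewrite (le_trans (abs_sin_le _))// normrM (ger0_norm (pi_ge0 R)).
Qed.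

Lemma normc_cisB_le2 x y : normc (cis x - cis y) <= 2.
Proof. by rewrite (le_trans (ler_normcB _ _))// !normc_cis. Qed.

Lemma sum_cis_geo t n :
  (\sum_(0 <= i < n) cis (t * i%:R)) * (cis t - 1) = cis (t * n%:R) - 1.
Proof.
rewrite cis_natM subrX1 mulrC; congr (_ * _).
by rewrite big_mkord; apply: eq_bigr => i _; rewrite cis_natM.
Qed.

Lemma normc_sum_cis_geo t n : cis t != 1 ->
  normc (\sum_(0 <= i < n) cis (t * i%:R)) <= 2 / normc (cis t - 1).
Proof.
move=> t1; have h : 0 < normc (cis t - 1).
  rewrite lt_neqAle normc_ge0 andbT eq_sym; apply: contra t1 => /eqP.
  by move=> /eq0_normc/eqP; rewrite subr_eq0.
rewrite ler_pdivlMr// -normcM sum_cis_geo.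
by rewrite -cis0 normc_cisB_le2.
Qed.

Lemma normc_sum_cis_sqr (I : eqType) (r : seq I) (x : I -> R) :
  normc (\sum_(i <- r) cis (x i)) ^+ 2 =
  \sum_(i <- r) \sum_(j <- r) cos (2 * pi * (x i - x j)).
Proof.
rewrite normc_sqr Re_sum Im_sum /= !expr2 !big_distrl /= -big_split /=.
apply: eq_bigr => i _; rewrite !big_distrr /= -big_split /=.
by apply: eq_bigr => j _; rewrite mulrBr cosB.
Qed.

(** A chord is asymptotically as long as its arc. As [c] may be arbitrarily close to 1, [mhat_le]
    passes from step densities to the measure without losing a constant factor. *)
Lemma cisB1_asymp (c : R) : c < 1 ->
  exists2 d : R, 0 < d & forall t, 0 < t < d -> c * (2 * pi * t) <= normc (cis t - 1).
Proof.
move=> c1.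
have : \forall x \near (0 : R), c < cos x.
  by apply: (cvgr_gt _ (@continuous_cos R 0)); rewrite cos0.
move=> /nbhs_ballP[d /= d0 hd].
exists (d / pi); first by rewrite divr_gt0// pi_gt0.
move=> t /andP[t0]; rewrite ltr_pdivlMr ?pi_gt0// => td.
rewrite normc_cisB1.
have pt0 : 0 < pi * t by rewrite mulr_gt0// pi_gt0.
have [|y yt] := @MVT R (@sin R) (@cos R) 0 _ pt0 (fun x _ => is_derive_sin x).
- exact/continuous_subspaceT/continuous_sin.
- rewrite sin0 !subr0 => ->.
  rewrite normrM (gtr0_norm pt0).
  have -> : c * (2 * pi * t) = 2 * (c * (pi * t)) by ring.
  rewrite ler_pM2l// ler_pM2r//.
  rewrite (le_trans _ (ler_norm _))// ltW//; apply: hd.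
  move: yt; rewrite in_itv/= => /andP[y0 yt].
  by rewrite /ball /= sub0r normrN gtr0_norm// (lt_trans yt)// mulrC.
Qed.

End cis.
Arguments cis : simpl never.

(** * Fejer kernel and visits to arcs *)

Section fejer.
Context {R : realType}.
Implicit Types t x s : R.

Lemma sin_pi_ge (d t : R) : 0 < d < 1 / 2 -> d <= t <= 1 - d ->
  sin (pi * d) <= sin (pi * t).
Proof.
move=> /andP[d0 d2] /andP[dt t1].
have hp := pi_gt0 R.
have le_half u v : 0 <= u -> u <= v -> v <= 1 / 2 -> sin (pi * u) <= sin (pi * v) :> R.
  move=> u0; rewrite le_eqVlt => /predU1P[->//|uv v2]; apply/ltW.
  by rewrite ltr_sin ?ltr_pM2l// in_itv/=; apply/andP; split; nra.
have [t2|t2] := leP t (1 / 2); first by apply: le_half => //; lra.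
have -> : sin (pi * t) = sin (pi * (1 - t)).
  have -> : pi * (1 - t) = - (pi * t) + pi :> R by ring.
  by rewrite sinDpi sinN opprK.
by apply: le_half; lra.
Qed.

Definition dirichlet (K : nat) t : R[i] := \sum_(0 <= j < K) cis (t * j%:R).

Lemma dirichlet_sqr K t : normc (dirichlet K t) ^+ 2 =
  \sum_(0 <= j < K) \sum_(0 <= j' < K) cos (2 * pi * (t * j%:R - t * j'%:R)).
Proof. by rewrite /dirichlet normc_sum_cis_sqr. Qed.

Lemma dirichletDint K t (z : int) : dirichlet K (t + z%:~R) = dirichlet K t.
Proof.
apply: eq_bigr => j _.
have -> : (t + z%:~R) * j%:R = t * j%:R + (z * j%:Z)%:~R by rewrite mulrDl intrM.
by rewrite cisDint.
Qed.

Lemma cis_neq1 t : 0 < t < 1 -> cis t != 1.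
Proof.
move=> /andP[t0 t1]; apply/eqP => c1.
have := normc_cisB1 t; rewrite c1 subrr normc0 => /esym/eqP.
rewrite mulf_eq0 pnatr_eq0/= normr_eq0 => /eqP s0.
have := @sin_gt0_pi R (pi * t); rewrite s0 ltxx; suff: 0 < pi * t < pi by move=> + h => /h.
by rewrite mulr_gt0 ?pi_gt0//= gtr_pMr// pi_gt0.
Qed.

(** Away from the integers the bound does not depend on [K], whereas the kernel has total [K ^ 2]
    over the [K]-th roots of unity: far sampling points become negligible for large [K]. *)
Lemma dirichlet_le K (d t : R) : 0 < d < 1 / 2 -> d <= t <= 1 - d ->
  normc (dirichlet K t) ^+ 2 <= (sin (pi * d)) ^- 2.
Proof.
move=> d2 dt.
have sd : 0 < sin (pi * d).
  apply: sin_gt0_pi; case/andP: d2 => d0 d2.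
  by rewrite mulr_gt0 ?pi_gt0//= gtr_pMr ?pi_gt0//; lra.
have st := sin_pi_ge d2 dt.
have t1 : cis t != 1.
  by apply: cis_neq1; case/andP: d2 => d0 d2; case/andP: dt => *; lra.
have := normc_sum_cis_geo K t1.
rewrite normc_cisB1 ger0_norm ?(le_trans (ltW sd))// => h.
rewrite -exprVn lerXn2r ?nnegrE ?normc_ge0 ?invr_ge0 ?(ltW sd)//.
rewrite (le_trans h)// invfM mulrA divff// mul1r lef_pV2// posrE//.
exact: lt_le_trans st.
Qed.

(* Sampling at the K-th roots of unity integrates trigonometric polynomials of
   degree less than K exactly. *)
Lemma sum_dirichlet_sqr K t : (0 < K)%N ->
  \sum_(0 <= g < K) normc (dirichlet K (t - g%:R / K%:R)) ^+ 2 = K%:R ^+ 2.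
Proof.
move=> K0; under eq_bigr do rewrite dirichlet_sqr.
rewrite exchange_big /=; under eq_bigr do rewrite exchange_big /=.
have h (j : nat) : (j < K)%N -> \sum_(0 <= j' < K) \sum_(0 <= g < K)
   cos (2 * pi * ((t - g%:R / K%:R) * j%:R - (t - g%:R / K%:R) * j'%:R)) = K%:R.
  move=> jK; rewrite big_mkord (bigD1 (Ordinal jK)) //= [X in _ + X]big1.
    rewrite addr0; under eq_bigr do rewrite subrr mulr0 cos0.
    by rewrite sumr_const_nat subn0.
  move=> j'; rewrite -val_eqE /= => jj'.
  have {}jj' : val j' != j by [].
  have -> : \sum_(0 <= g < K) cos (2 * pi *
      ((t - g%:R / K%:R) * j%:R - (t - g%:R / K%:R) * j'%:R)) =
    complex.Re (cis (t * (j%:R - j'%:R)) *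
      \sum_(0 <= g < K) cis ((j'%:R - j%:R) / K%:R * g%:R)).
    rewrite big_distrr /= Re_sum; apply: eq_bigr => g _.
    rewrite -cisD /cis /=; congr (cos (_ * _)); ring.
  suff -> : \sum_(0 <= g < K) cis (((j' : nat)%:R - j%:R) / K%:R * g%:R) = 0 :> R[i].
    by rewrite mulr0.
  have Kn0 : K%:R != 0 :> R by rewrite pnatr_eq0 -lt0n.
  have K0' : 0 < K%:R :> R by rewrite ltr0n.
  set u := _ / K%:R.
  have cu : cis u != 1 :> R[i].
    have [lt|lt|eq] := ltngtP (val j') j; last by rewrite eq eqxx in jj'.
    - have -> : u = 1 - (j%:R - j'%:R) / K%:R + (-1)%:~R.
        by rewrite mulrNz /u; field.
      rewrite cisDint; apply: cis_neq1.
      have jK' : j%:R < K%:R :> R by rewrite ltr_nat.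
      have lt' : j'%:R < j%:R :> R by rewrite ltr_nat.
      have j0 : 0 <= j'%:R :> R by [].
      rewrite subr_gt0 ltr_pdivrMr// gtrBl divr_gt0 ?andbT ?subr_gt0//; lra.
    - apply: cis_neq1.
      have jK' : j'%:R < K%:R :> R by rewrite ltr_nat.
      have lt' : j%:R < j'%:R :> R by rewrite ltr_nat.
      have j0 : 0 <= j%:R :> R by [].
      by rewrite /u divr_gt0 ?subr_gt0//= ltr_pdivrMr//; lra.
  apply: (mulIf (_ : cis u - 1 != 0)); first by rewrite subr_eq0.
  rewrite sum_cis_geo mul0r /u mulfVK//.
  apply/eqP; rewrite subr_eq0; apply/eqP.
  have -> : (j'%:R - j%:R) = 0 + (j'%:Z - j%:Z)%:~R :> R.
    by rewrite add0r intrB.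
  by rewrite cisDint cis0.
rewrite (eq_big_nat _ _ (F2 := fun=> K%:R)) => [|j /andP[_ /h//]].
by rewrite sumr_const_nat subn0 -[_ *+ _]mulr_natr expr2.
Qed.

(** In the double sum for the square, each of the [K] diagonal terms contributes [size r]; every
    other one is, up to a phase, the real part of an exponential sum whose frequency lies between 1
    and [K - 1]. *)
Lemma sum_dirichlet_le (I : eqType) (r : seq I) (x : I -> R) (s B : R) (K : nat) :
  (forall h, (0 < h < K)%N -> normc (\sum_(i <- r) cis (x i * h%:R)) <= B) ->
  0 <= B ->
  \sum_(i <- r) normc (dirichlet K (x i - s)) ^+ 2 <=
  K%:R * (size r)%:R + K%:R ^+ 2 * B.
Proof.
move=> hB B0; under eq_bigr do rewrite dirichlet_sqr.
rewrite exchange_big /=; under eq_bigr do rewrite exchange_big /=.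
have hj (j j' : nat) : (j < K)%N -> (j' < K)%N ->
    \sum_(i <- r) cos (2 * pi * ((x i - s) * j%:R - (x i - s) * j'%:R)) <=
    (j == j')%:R * (size r)%:R + B.
  have aux (a b : nat) : (a < b)%N -> (b < K)%N ->
      \sum_(i <- r) cos (2 * pi * ((x i - s) * b%:R - (x i - s) * a%:R)) <= B.
    move=> ab bK; have /hB : (0 < b - a < K)%N by lia.
    apply: le_trans.
    have -> : \sum_(i <- r) cos (2 * pi * ((x i - s) * b%:R - (x i - s) * a%:R)) =
        complex.Re (cis (- s * (b - a)%:R) * \sum_(i <- r) cis (x i * (b - a)%:R)).
      rewrite big_distrr /= Re_sum; apply: eq_bigr => i _.
      rewrite -cisD /cis /= natrB 1?ltnW//; congr (cos (_ * _)); ring.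
    set z := \sum_(_ <- _) _.
    by rewrite (le_trans (Re_le_normc _))// normcM normc_cis mul1r.
  move=> jK j'K; case: (ltngtP j j') => jj'.
  - rewrite mul0r add0r (le_trans _ (aux j j' jj' j'K))// le_eqVlt; apply/orP; left.
    by apply/eqP/eq_bigr => i _; rewrite -[LHS]cosN; congr cos; ring.
  - by rewrite mul0r add0r aux.
  - rewrite jj' mul1r; under eq_bigr do rewrite subrr mulr0 cos0.
    by rewrite big_const_seq count_predT iter_addr_0 lerDl.
apply: (@le_trans _ _ (\sum_(0 <= j < K) ((size r)%:R + K%:R * B))).
  rewrite [leLHS]big_nat_cond [leRHS]big_nat_cond; apply: ler_sum => j.
  rewrite andbT => /andP[_ jK].
  apply: (@le_trans _ _ (\sum_(0 <= j' < K) ((j == j')%:R * (size r)%:R + B))).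
    rewrite [leLHS]big_nat_cond [leRHS]big_nat_cond; apply: ler_sum => j'.
    by rewrite andbT => /andP[_ j'K]; exact: hj.
  rewrite big_split /= sumr_const_nat subn0 -[B *+ _]mulr_natl lerD2r.
  rewrite -big_distrl /= ler_piMl//.
  rewrite big_mkord (bigD1 (Ordinal jK))//= eqxx big1 ?addr0// => j'.
  by rewrite -val_eqE /= eq_sym => /negbTE ->.
by rewrite sumr_const_nat subn0 -[_ *+ _]mulr_natl mulrDr mulrA expr2.
Qed.

(* Up to [K B], a sequence visits an arc at most as often as its length predicts,
   [B] being a bound on the exponential sums of frequency less than [K]. *)
Lemma fejer_count (d : R) : 0 < d < 1 / 2 -> exists2 K : nat, (0 < K)%N &
  forall (I : eqType) (r : seq I) (P : pred I) (x : I -> R) (s l B : R),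
  0 <= l -> 0 <= B ->
  (forall i, i \in r -> P i -> exists z : int, 0 <= x i - s + z%:~R <= l) ->
  (forall h, (0 < h < K)%N -> normc (\sum_(i <- r) cis (x i * h%:R)) <= B) ->
  (1 - d) * (count P r)%:R <= (l + 3 * d) * ((size r)%:R + K%:R * B).
Proof.
move=> d2; have /andP[d0 d12] := d2.
have sd : 0 < sin (pi * d).
  apply: sin_gt0_pi.
  by rewrite mulr_gt0 ?pi_gt0//= gtr_pMr ?pi_gt0//; lra.
(* [K] is at least [1 / d], and so large that the kernel at each far sampling point is at most
   [d * K]; the far points then hold at most the share [d] of the total [K ^ 2]. *)
set K := (Num.truncn (Num.max d^-1 ((sin (pi * d)) ^- 2 / d))).+1.
have K0 : (0 < K)%N by [].
have K0' : 0 < K%:R :> R by rewrite ltr0n.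
have hK := truncnS_gt (Num.max d^-1 ((sin (pi * d)) ^- 2 / d)).
have K1 : K%:R^-1 <= d.
  rewrite -[leRHS]invrK lef_pV2 ?posrE ?invr_gt0//.
  by rewrite (le_trans _ (ltW hK))// le_max lexx.
have K2 : (sin (pi * d)) ^- 2 <= d * K%:R.
  by rewrite -ler_pdivrMl// mulrC (le_trans _ (ltW hK))// le_max lexx orbT.
exists K => // I r P x s l B l0 B0 hP hB.
(* The sampling points of the arc lengthened by [d] at both ends. Modulo 1, all other ones are at
   distance at least [d] from the original arc. *)
pose G g : bool := g%:R / K%:R <= l + 2 * d.
pose F t := normc (dirichlet K t) ^+ 2.
have F0 t : 0 <= F t by rewrite sqr_ge0.
have step1 i : i \in r -> P i -> (1 - d) * K%:R ^+ 2 <=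
    \sum_(0 <= g < K | G g) F (x i - (s - d) - g%:R / K%:R).
  move=> ir Pi; have [z /andP[z0 zl]] := hP i ir Pi.
  have := sum_dirichlet_sqr (x i - (s - d)) K0.
  rewrite (bigID G) /= => e.
  rewrite mulrBl mul1r lerBlDr -[in leLHS]e lerD2l.
  apply: (@le_trans _ _ (\sum_(0 <= g < K) (d * K%:R))); last first.
    by rewrite sumr_const_nat subn0 -[_ *+ _]mulr_natr -mulrA -expr2.
  rewrite big_mkcond /= [leLHS]big_nat_cond [leRHS]big_nat_cond.
  apply: ler_sum => g; rewrite andbT => /andP[_ gK].
  case: ifPn => [|_]; last by rewrite mulr_ge0// ltW.
  rewrite /G -ltNge => gl.
  apply: le_trans K2.
  (* The integer shift brings the argument into [[d, 1 - d]]: the upper bound holds as [g / K]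
     exceeds [l + 2 * d], the lower one as [g / K] is at most [1 - 1 / K]. *)
  have -> : x i - (s - d) - g%:R / K%:R =
      (x i - s + z%:~R + d - g%:R / K%:R + 1) + (- z - 1)%:~R.
    by rewrite intrB rmorphN /=; ring.
  rewrite dirichletDint; apply: dirichlet_le => //.
  have gK1 : g%:R / K%:R <= 1 - K%:R^-1 :> R.
    rewrite ler_pdivrMr// mulrBl mul1r mulVf ?gt_eqF//.
    by rewrite lerBrDr natr1 ler_nat.
  have Ki : 0 < K%:R^-1 :> R by rewrite invr_gt0.
  by apply/andP; split; lra.
have step2 : (1 - d) * K%:R ^+ 2 * (count P r)%:R <=
    \sum_(0 <= g < K | G g) \sum_(i <- r) F (x i - (s - d) - g%:R / K%:R).
  rewrite exchange_big /= mulr_natr -iter_addr_0 -big_const_seq.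
  rewrite [leLHS]big_mkcond /= big_seq [leRHS]big_seq; apply: ler_sum => i ir.
  by case: ifPn => [/step1-/(_ ir)//|_]; exact: sumr_ge0.
have step3 : \sum_(0 <= g < K | G g) \sum_(i <- r) F (x i - (s - d) - g%:R / K%:R) <=
    \sum_(0 <= g < K | G g) (K%:R * (size r)%:R + K%:R ^+ 2 * B).
  apply: ler_sum => g _.
  rewrite (le_trans _ (sum_dirichlet_le (s - d + g%:R / K%:R) hB B0))//.
  rewrite le_eqVlt; apply/orP; left; apply/eqP/eq_bigr => i _.
  rewrite /F; congr (normc (dirichlet _ _) ^+ 2); ring.
have step4 : (count G (iota 0 K))%:R <= K%:R * (l + 3 * d).
  have hl : 0 <= K%:R * (l + 2 * d).
    by rewrite mulr_ge0// ?ltW//; lra.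
  apply: (@le_trans _ _ (Num.truncn (K%:R * (l + 2 * d))).+1%:R).
    rewrite ler_nat -size_filter -(size_iota 0 (Num.truncn _).+1).
    apply: uniq_leq_size; first by rewrite filter_uniq// iota_uniq.
    move=> g; rewrite mem_filter !mem_iota /= !add0n => /andP[gG gK].
    rewrite ltnS truncn_ge_nat//.
    by move: gG; rewrite /G ler_pdivrMr// mulrC.
  have ht : (Num.truncn (K%:R * (l + 2 * d)))%:R <= K%:R * (l + 2 * d) by rewrite truncn_le.
  rewrite -natr1 (le_trans (lerD ht (lexx 1)))//.
  have : 1 <= K%:R * d by rewrite -ler_pdivrMl// mulr1.
  by move=> *; nra.
have := le_trans step2 step3.
rewrite -big_filter big_const_seq count_predT size_filter iter_addr_0.
rewrite -[X in _ <= X -> _]mulr_natr /index_iota subn0 => step5.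
rewrite -(@ler_pM2r _ (K%:R ^+ 2)) ?exprn_gt0//.
rewrite [leLHS]mulrAC (le_trans step5)//.
have -> : (l + 3 * d) * ((size r)%:R + K%:R * B) * K%:R ^+ 2 =
  (K%:R * (size r)%:R + K%:R ^+ 2 * B) * (K%:R * (l + 3 * d)) by ring.
by rewrite ler_wpM2l// addr_ge0//; apply: mulr_ge0.
Qed.

End fejer.

(** * Weighted digits *)

Lemma sum_nat_mulD (V : nmodType) (m q : nat) (F : nat -> V) :
  \sum_(0 <= c < m * q) F c = \sum_(0 <= a < m) \sum_(0 <= d < q) F (a * q + d)%N.
Proof.
rewrite big_nat_mul; apply: eq_bigr => a _.
rewrite -{1}[(a * q)%N]add0n big_addn mulSn addnK; apply: eq_bigr => d _.
by rewrite addnC.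
Qed.

Lemma ler_sum_nat_lt (R : numDomainType) (m : nat) (F G : nat -> R) :
  (forall i, (i < m)%N -> F i <= G i) ->
  \sum_(0 <= i < m) F i <= \sum_(0 <= i < m) G i.
Proof.
by move=> h; rewrite !big_mkord; apply: ler_sum => i _; exact: h.
Qed.

Lemma eq_sum_nat_lt (V : nmodType) (m : nat) (F G : nat -> V) :
  (forall i, (i < m)%N -> F i = G i) ->
  \sum_(0 <= i < m) F i = \sum_(0 <= i < m) G i.
Proof. by move=> h; rewrite !big_mkord; apply: eq_bigr => i _; exact: h. Qed.

Section digit_weights.
Context {R : realType} (q : nat) (eps : R).
Hypotheses (q1 : (1 < q)%N) (eps0 : 0 < eps) (eps1 : eps < 1).

Definition wt (d : nat) : R :=
  if d == 0%N then 1 + eps else if d == q.-1 then 1 - eps else 1.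

(* The weight depends on the n lowest base-q digits of c only. *)
Fixpoint dwt (n c : nat) : R :=
  if n is n'.+1 then wt (c %% q)%N * dwt n' (c %/ q)%N else 1.
Arguments dwt : simpl never.

Fixpoint zeros (n c : nat) : nat :=
  if n is n'.+1 then ((c %% q == 0) + zeros n' (c %/ q))%N else 0%N.
Arguments zeros : simpl never.

Definition phi (t : R) : R[i] := \sum_(0 <= d < q) (wt d)%:C%C * cis (t * d%:R).

Let q0 : (0 < q)%N. Proof. exact: ltnW. Qed.

Let qE : q = q.-2.+2. Proof. by case: q q1 => [|[]]. Qed.

Let dwt_rec n c : dwt n.+1 c = wt (c %% q)%N * dwt n (c %/ q)%N.
Proof. by []. Qed.

Let zeros_rec n c : zeros n.+1 c = ((c %% q == 0) + zeros n (c %/ q))%N.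
Proof. by []. Qed.

Lemma wt_ge0 d : 0 <= wt d.
Proof. by have e0 := eps0; have e1 := eps1; rewrite /wt; case: (d == 0%N) => /=; [lra|case: (d == q.-1) => /=; lra]. Qed.

Lemma wt_le d : wt d <= 1 + eps.
Proof. by have e0 := eps0; rewrite /wt; case: (d == 0%N) => /=; [lra|case: (d == q.-1) => /=; lra]. Qed.

Lemma sum_wtB (V : lmodType R) (f : nat -> V) :
  \sum_(0 <= d < q) wt d *: f d =
  \sum_(0 <= d < q) f d + eps *: (f 0%N - f q.-1).
Proof.
have split2 (g : nat -> V) : \sum_(0 <= d < q) g d =
    g 0%N + (\sum_(0 <= d < q.-2) g d.+1 + g q.-1).
  by rewrite {1}qE big_nat_recl// big_nat_recr//=; congr (_ + (_ + g _)); lia.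
rewrite !split2 /wt /=.
have -> : \sum_(0 <= i < q.-2) (if i.+1 == q.-1 then 1 - eps else 1) *: f i.+1 =
  \sum_(0 <= i < q.-2) f i.+1.
  apply: eq_sum_nat_lt => i iq; rewrite ifF ?scale1r//; apply/negbTE; lia.
rewrite eqxx ifF; last by apply/negbTE; lia.
rewrite scalerDl scalerBl !scale1r scalerBr.
by rewrite -!addrA; congr (_ + _); rewrite [LHS]addrCA; congr (_ + _); rewrite [LHS]addrCA.
Qed.

Lemma sum_wt : \sum_(0 <= d < q) wt d = q%:R.
Proof.
have := @sum_wtB (R^o) (fun=> 1); rewrite subrr scaler0 addr0 sumr_const_nat subn0.
by under eq_bigr do rewrite [_ *: _]mulr1.
Qed.

Lemma sum_wt0 (p : R) : \sum_(0 <= d < q) wt d * ((d == 0%N)%:R - p) =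
  1 + eps - p * q%:R.
Proof.
under eq_bigr do rewrite mulrBr [X in _ - X]mulrC.
rewrite sumrB -big_distrr /= sum_wt; congr (_ - _).
have -> : q = q.-1.+1 by lia.
by rewrite big_nat_recl//= mulr1 /wt/= big1 ?addr0// => i _; rewrite mulr0.
Qed.

Lemma sum_wt0_sqr (p : R) : \sum_(0 <= d < q) wt d * ((d == 0%N)%:R - p) ^+ 2 =
  (1 + eps) * (1 - 2 * p) + p ^+ 2 * q%:R.
Proof.
have h d : wt d * ((d == 0%N)%:R - p) ^+ 2 =
   (1 - 2 * p) * (wt d * ((d == 0%N)%:R - 0)) + p ^+ 2 * wt d.
  by case: (d == 0%N) => /=; ring.
under eq_bigr do rewrite h.
by rewrite big_split/= -!big_distrr/= sum_wt sum_wt0 mul0r subr0 mulrC.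
Qed.

Lemma dwtS n a d : (d < q)%N -> dwt n.+1 (a * q + d) = wt d * dwt n a.
Proof.
by move=> dq; rewrite dwt_rec modnMDl modn_small// divnMDl// divn_small// addn0.
Qed.

Lemma zerosS n a d : (d < q)%N -> zeros n.+1 (a * q + d) = ((d == 0) + zeros n a)%N.
Proof.
by move=> dq; rewrite zeros_rec modnMDl modn_small// divnMDl// divn_small// addn0.
Qed.

Lemma dwt_ge0 n c : 0 <= dwt n c.
Proof. by elim: n c => [//|n IHn] c; rewrite dwt_rec mulr_ge0// wt_ge0. Qed.

Lemma dwt_le n c : dwt n c <= (1 + eps) ^+ n.
Proof.
elim: n c => [//|n IHn] c; rewrite dwt_rec exprS ler_pM ?wt_ge0 ?dwt_ge0 ?wt_le//.
Qed.

Lemma sum_dwt_rec n (F : nat -> R) :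
  \sum_(0 <= c < q ^ n.+1) dwt n.+1 c * F c =
  \sum_(0 <= a < q ^ n) dwt n a * \sum_(0 <= d < q) wt d * F (a * q + d)%N.
Proof.
rewrite expnSr sum_nat_mulD; apply: eq_bigr => a _.
rewrite big_distrr /=; apply: eq_sum_nat_lt => d dq; rewrite dwtS//.
by rewrite mulrA [wt d * _]mulrC.
Qed.

(** The weight of each digit has mean 1, so the [m] low digits average out and the weight of the
    digits above them remains. *)
Lemma sum_dwt_block l m c :
  \sum_(0 <= c' < q ^ m) dwt (l + m) (c * q ^ m + c') = (q ^ m)%:R * dwt l c.
Proof.
elim: m c => [|m IHm] c.
  by rewrite expn0 muln1 big_nat1 addn0 addn0 mul1r.
rewrite expnSr sum_nat_mulD addnS.
under eq_bigr => a _.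
  rewrite (@eq_sum_nat_lt _ _ _ (fun d => wt d * dwt (l + m) (c * q ^ m + a))); last first.
    by move=> d dq; rewrite mulnA addnA -mulnDl dwtS.
  rewrite -big_distrl /= sum_wt.
  over.
by rewrite -big_distrr /= IHm natrM mulrCA mulrA.
Qed.

Lemma sum_dwt n : \sum_(0 <= c < q ^ n) dwt n c = (q ^ n)%:R.
Proof.
have := sum_dwt_block 0 n 0.
by rewrite mulr1 mul0n; under eq_bigr do rewrite !add0n.
Qed.

Lemma dwtD n j c : (c < q ^ n)%N -> dwt n (j * q ^ n + c) = dwt n c.
Proof.
elim: n j c => [//|n IHn] j c cq; rewrite dwt_rec [RHS]dwt_rec.
have -> : (j * q ^ n.+1 + c = (j * q ^ n) * q + c)%N by rewrite expnSr mulnA.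
rewrite modnMDl divnMDl// IHn//.
by rewrite ltn_divLR// -expnSr.
Qed.

Lemma zerosD n j c : (c < q ^ n)%N -> zeros n (j * q ^ n + c) = zeros n c.
Proof.
elim: n j c => [//|n IHn] j c cq; rewrite zeros_rec [RHS]zeros_rec.
have -> : (j * q ^ n.+1 + c = (j * q ^ n) * q + c)%N by rewrite expnSr mulnA.
rewrite modnMDl divnMDl// IHn//.
by rewrite ltn_divLR// -expnSr.
Qed.

Lemma zerosE n c : zeros n c = (\sum_(0 <= i < n) ((c %/ q ^ i) %% q == 0))%N.
Proof.
elim: n c => [|n IHn] c; first by rewrite big_nil.
rewrite big_nat_recl//= expn0 divn1 zeros_rec IHn; congr (_ + _)%N.
by apply: eq_bigr => i _; rewrite -divnMA expnS.
Qed.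

Let p : R := (1 + eps) / q%:R.

Let qR0 : 0 < q%:R :> R. Proof. by rewrite ltr0n. Qed.

Let pq : p * q%:R = 1 + eps. Proof. by rewrite /p mulfVK// gt_eqF. Qed.

(** Under the probabilities [dwt n c / q ^ n] the digits are independent and vanish with probability
    [p], so this is a binomial variance. In the induction the cross term drops out because the new
    digit is centred. *)
Lemma sum_dwt_zeros_sqr n :
  \sum_(0 <= c < q ^ n) dwt n c * ((zeros n c)%:R - n%:R * p) ^+ 2 =
  (q ^ n)%:R * n%:R * (p * (1 - p)).
Proof.
elim: n => [|n IHn].
  by rewrite big_nat1 mul1r mul0r subrr expr0n/= mulr0 mul0r.
rewrite sum_dwt_rec.
under eq_bigr => a _.
  rewrite (@eq_sum_nat_lt _ _ _ (fun d => wt d * ((d == 0%N)%:R - p) ^+ 2 +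
     (2 * ((zeros n a)%:R - n%:R * p) * (wt d * ((d == 0%N)%:R - p)) +
     wt d * ((zeros n a)%:R - n%:R * p) ^+ 2))); last first.
    move=> d dq; rewrite zerosS// natrD -natr1; ring.
  rewrite !big_split /= -big_distrr /= sum_wt0 -big_distrl /= sum_wt pq.
  rewrite subrr mulr0 add0r sum_wt0_sqr mulrDr.
  over.
rewrite big_split /= -big_distrl /= sum_dwt.
under [X in _ + X]eq_bigr do rewrite mulrCA.
rewrite -big_distrr /= IHn expnS natrM -natr1 -!pq; ring.
Qed.

(** Chebyshev's inequality: the mean of [zeros n c] is [(1 + eps) * n / q], and [V] is its distance
    from the threshold. *)
Lemma zeros_concentration n : 16 * q%:R ^+ 2 <= eps ^+ 2 * n%:R ->
  \sum_(0 <= c < q ^ n | (1 + eps / 2) * n%:R <= q%:R * (zeros n c)%:R) dwt n c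
    >= (q ^ n)%:R * (3 / 4).
Proof.
move=> hn.
have := sum_dwt n; rewrite (bigID (fun c => (1 + eps / 2) * n%:R <= q%:R * (zeros n c)%:R)) /=.
set G := \sum_(_ <= _ < _ | _) _; set B := \sum_(_ <= _ < _ | _) _ => e.
suff hB : B <= (q ^ n)%:R / 4 by lra.
have e0 := eps0; have e1 := eps1.
have eps20 : 0 < eps ^+ 2 by rewrite exprn_gt0.
have n0 : 0 < n%:R :> R.
  rewrite -(pmulr_rgt0 _ eps20); apply: lt_le_trans hn.
  by rewrite mulr_gt0// exprn_gt0.
set V := eps * n%:R / (2 * q%:R).
have V0 : 0 < V by rewrite divr_gt0// mulr_gt0.
rewrite -(@ler_pM2r _ (V ^+ 2)) ?exprn_gt0//.
apply: (@le_trans _ _ ((q ^ n)%:R * n%:R * (p * (1 - p)))).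
  rewrite -sum_dwt_zeros_sqr /B big_distrl /= [leLHS]big_mkcond /=.
  apply: ler_sum => c _; case: ifPn => [|_]; last first.
    by rewrite mulr_ge0 ?dwt_ge0 ?sqr_ge0.
  rewrite -ltNge => h; rewrite ler_wpM2l ?dwt_ge0//.
  rewrite -[leRHS]sqrrN lerXn2r ?nnegrE ?(ltW V0)//.
    rewrite oppr_ge0 subr_le0 /p -(ler_pM2l qR0) (le_trans (ltW h))//.
    have -> : q%:R * (n%:R * ((1 + eps) / q%:R)) = n%:R * (1 + eps).
      by field; rewrite gt_eqF.
    nra.
  rewrite opprB lerBrDr /V /p -(ler_pM2l qR0).
  have -> : q%:R * (n%:R * ((1 + eps) / q%:R)) = n%:R * (1 + eps).
    by field; rewrite gt_eqF.
  have -> : q%:R * (eps * n%:R / (2 * q%:R) + (zeros n c)%:R) =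
    eps * n%:R / 2 + q%:R * (zeros n c)%:R by field; rewrite gt_eqF.
  nra.
have q2 : 2 <= q%:R :> R by rewrite ler_nat.
have p0 : 0 < p by rewrite divr_gt0//; lra.
have p1 : p <= 1 by rewrite ler_pdivrMr//; lra.
rewrite -[leLHS]mulrA -[leRHS]mulrA ler_wpM2l//.
apply: (@le_trans _ _ n%:R).
  by rewrite ler_piMr// ?(ltW n0)//; nra.
rewrite /V -[leLHS]mulr1.
have -> : 4^-1 * (eps * n%:R / (2 * q%:R)) ^+ 2 =
   n%:R * ((eps ^+ 2 * n%:R) / (16 * q%:R ^+ 2)).
  by field; rewrite gt_eqF.
rewrite ler_pM2l// ler_pdivlMr ?mul1r//.
by rewrite mulr_gt0// exprn_gt0.
Qed.

Lemma sum_dwt_cis n t :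
  \sum_(0 <= c < q ^ n) (dwt n c)%:C%C * cis (t * c%:R) =
  \prod_(0 <= i < n) phi (t * (q ^ i)%:R).
Proof.
elim: n t => [|n IHn] t; first by rewrite big_nat1 big_nil mulr0 cis0 mulr1.
rewrite big_nat_recl// expn0 mulr1.
under eq_bigr do rewrite expnS natrM mulrA.
rewrite -IHn expnSr sum_nat_mulD big_distrr /=; apply: eq_bigr => a _.
rewrite /phi big_distrl /=; apply: eq_sum_nat_lt => d dq.
have -> : t * (a * q + d)%:R = t * d%:R + t * q%:R * a%:R by rewrite natrD natrM; ring.
rewrite dwtS// cisD rmorphM /=; ring.
Qed.

Lemma normc_phi_le t : normc (phi t) <= q%:R.
Proof.
rewrite (le_trans (normc_sum _ _ _))// -sum_wt; apply: ler_sum => d _.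
by rewrite normcM normc_cis mulr1 normc_real ger0_norm// wt_ge0.
Qed.

(* Only the digits 0 and 1 are used for the cancellation. *)
Lemma normc_phi_lt : exists2 c : R, 0 < c < 1 & forall t (z : int),
  (q%:R ^+ 2)^-1 <= t + z%:~R <= 1 - (q%:R ^+ 2)^-1 -> normc (phi t) <= q%:R * c.
Proof.
have e0 := eps0; have e1 := eps1.
have q2 : 2 <= q%:R :> R by rewrite ler_nat.
set d : R := (q%:R ^+ 2)^-1.
have d0 : 0 < d by rewrite invr_gt0 exprn_gt0.
have d4 : d <= 4^-1 by rewrite lef_pV2 ?posrE ?exprn_gt0//; nra.
set k := cos (pi * d).
have hp := pi_gt0 R.
have k0 : 0 < k by apply: cos_gt0_pihalf; apply/andP; split; nra.
have k1 : k < 1.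
  by rewrite /k -cos0 ltr_cos ?in_itv/= ?lexx ?(ltW hp)//; [nra|apply/andP; split; nra].
exists (1 - 2 * (1 - eps) * (1 - k) / q%:R).
  have : 0 < 2 * (1 - eps) * (1 - k) / q%:R by rewrite divr_gt0//; nra.
  have : 2 * (1 - eps) * (1 - k) / q%:R < 1 by rewrite ltr_pdivrMr//; nra.
  by move=> *; apply/andP; split; lra.
move=> t z /andP[z1 z2].
(* The modulus of [1 + cis t] is [2 * |cos (pi * t)|], at most [2 * cos (pi * d)] at distance at
   least [d] from the integers. *)
have h1 : normc (1 + cis t) <= 2 * k.
  have -> : 1 + cis t = - (cis (t + z%:~R + 1 / 2) - 1).
    rewrite cisD cisDint opprB.
    have -> : cis (1 / 2 : R) = -1.
      rewrite /cis (_ : 2 * pi * (1 / 2) = pi); last by field.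
      by rewrite cospi sinpi; apply/eqP; rewrite eq_complex/= oppr0 !eqxx.
    by rewrite mulrN1 opprK.
  rewrite normc_opp normc_cisB1 ler_pM2l//.
  set u := t + _ in z1 z2 *.
  have -> : pi * (u + 1 / 2) = pi * u + pi / 2 by ring.
  have inI (v : R) : 0 <= v <= 1 -> pi * v \in `[0, pi] :> bool.
    move=> /andP[v0 v1]; rewrite in_itv/= mulr_ge0 ?(ltW hp)//=.
    by rewrite ler_piMr ?(ltW hp).
  rewrite sinDpihalf ler_norml; apply/andP; split.
    have -> : - k = cos (pi * (1 - d)).
      by rewrite mulrBr mulr1 addrC cosDpi cosN.
    have [->//|un] := eqVneq u (1 - d).
    by rewrite ltW// ltr_cos ?inI ?ltr_pM2l// ?lt_neqAle ?un//; apply/andP; split; lra.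
  have [->//|un] := eqVneq u d.
  by rewrite ltW// ltr_cos ?inI ?ltr_pM2l// ?lt_neqAle 1?eq_sym ?un//; apply/andP; split; lra.
(* The digits 0 and 1 both have weight at least [1 - eps]; this common part is split off and the
   rest is estimated trivially. *)
have -> : phi t = \sum_(0 <= e < q) (wt e - (e < 2)%:R * (1 - eps))%:C%C * cis (t * e%:R) +
    (1 - eps)%:C%C * (1 + cis t).
  have -> : (1 - eps)%:C%C * (1 + cis t) =
      \sum_(0 <= e < q) ((e < 2)%:R * (1 - eps))%:C%C * cis (t * e%:R).
    rewrite qE.
    rewrite !big_nat_recl//= big1 ?addr0 => [|i _]; last by rewrite mul0r mul0r.
    by rewrite mulr0 cis0 mulr1 mul1r mulr1 mulrDr mulr1.
  rewrite -big_split /=; apply: eq_bigr => e _.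
  by rewrite -mulrDl -rmorphD /= subrK.
rewrite (le_trans (ler_normcD _ _))//.
rewrite normcM normc_real ger0_norm; last by lra.
apply: (@le_trans _ _ (q%:R - 2 * (1 - eps) + (1 - eps) * (2 * k))); last first.
  by rewrite le_eqVlt; apply/orP; left; apply/eqP; field; rewrite gt_eqF.
rewrite lerD//; last by rewrite ler_pM2l//; lra.
rewrite (le_trans (normc_sum _ _ _))//.
have -> : q%:R - 2 * (1 - eps) = \sum_(0 <= e < q) (wt e - (e < 2)%:R * (1 - eps)).
  rewrite sumrB sum_wt; congr (_ - _); rewrite -big_distrl /=; congr (_ * _).
  rewrite qE.
  rewrite !big_nat_recl//= big1 ?addr0 => [|i _]; by [].
apply: ler_sum => e _; rewrite normcM normc_cis mulr1 normc_real ger0_norm//.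
rewrite /wt; case: e => [|[|e]] /=; last by rewrite mul0r subr0; case: ifP => _; lra.
  by lra.
by case: ifP => _; lra.
Qed.

End digit_weights.

(** * One stage: perturbing a step density *)

Section step_density.
Context {R : realType}.
Implicit Types (rho : nat -> R) (xi : R) (Q : nat).

Definition dcis Q (a : nat) xi : R[i] :=
  cis (xi * (a.+1%:R / Q%:R)) - cis (xi * (a%:R / Q%:R)).

(* Up to the factor 2 i pi xi, the Fourier transform of the density equal to
   [rho a] on [a / Q, (a + 1) / Q). *)
Definition four Q rho xi : R[i] := \sum_(0 <= a < Q) (rho a)%:C%C * dcis Q a xi.

Definition nfour Q rho xi : R := normc (four Q rho xi) / (2 * pi * xi).

Let hpi : 0 < pi :> R. Proof. exact: pi_gt0. Qed.

Lemma sum_dcis Q m a xi : (0 < Q)%N -> (0 < m)%N ->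
  \sum_(0 <= e < m) dcis (Q * m) (a * m + e) xi = dcis Q a xi.
Proof.
move=> Q0 m0; rewrite /dcis.
under eq_bigr do rewrite -addnS.
rewrite (telescope_sumr (fun e => cis (xi * ((a * m + e)%:R / (Q * m)%:R)))) //.
have m0' : m%:R != 0 :> R by rewrite pnatr_eq0 -lt0n.
have Q0' : Q%:R != 0 :> R by rewrite pnatr_eq0 -lt0n.
rewrite addn0 -mulSnr !natrM; congr (cis _ - cis _); field; exact/andP.
Qed.

Lemma normc_dcis_le Q a xi : 0 <= xi -> (0 < Q)%N ->
  normc (dcis Q a xi) <= 2 * pi * xi / Q%:R.
Proof.
move=> xi0 Q0; rewrite (le_trans (cis_lip _ _))// -mulrBr.
have Q0' : Q%:R != 0 :> R by rewrite pnatr_eq0 -lt0n.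
have -> : a.+1%:R / Q%:R - a%:R / Q%:R = Q%:R^-1 :> R.
  by rewrite -mulrBl -natr1 addrAC subrr add0r mul1r.
by rewrite ger0_norm ?mulr_ge0// mulrA.
Qed.

Lemma four_refine Q m rho xi : (0 < Q)%N -> (0 < m)%N ->
  four Q rho xi = four (Q * m) (fun a => rho (a %/ m)%N) xi.
Proof.
move=> Q0 m0; rewrite /four sum_nat_mulD; apply: eq_bigr => a _.
rewrite -(sum_dcis a xi Q0 m0) big_distrr /=; apply: eq_sum_nat_lt => e em.
by rewrite divnMDl// divn_small// addn0.
Qed.

Lemma nfour_le1 Q rho xi : (0 < Q)%N -> 0 < xi -> (forall a, 0 <= rho a) ->
  \sum_(0 <= a < Q) rho a = Q%:R -> nfour Q rho xi <= 1.
Proof.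
move=> Q0 xi0 rho0 rhoQ.
have Q0' : Q%:R != 0 :> R by rewrite pnatr_eq0 -lt0n.
rewrite /nfour ler_pdivrMr ?mul1r ?mulr_gt0//.
rewrite (le_trans (normc_sum _ _ _))//.
apply: (@le_trans _ _ (\sum_(0 <= a < Q) rho a * (2 * pi * xi / Q%:R))).
  apply: ler_sum => a _; rewrite normcM normc_real ger0_norm//.
  by rewrite ler_wpM2l// normc_dcis_le// ltW.
by rewrite -big_distrl /= rhoQ mulrC mulfVK.
Qed.

(** A step density has bounded variation, whence the decay [1 / xi]; a factor [1 / pi] is given
    away. *)
Lemma nfour_decay Q rho xi (D : R) : 0 < xi -> (forall a, 0 <= rho a <= D) ->
  nfour Q rho xi <= D * Q%:R / xi.
Proof.
move=> xi0 rhoD; rewrite /nfour ler_pdivrMr ?mulr_gt0//.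
rewrite (le_trans (normc_sum _ _ _))//.
apply: (@le_trans _ _ (\sum_(0 <= a < Q) D * 2)).
  apply: ler_sum => a _; have /andP[r0 rD] := rhoD a.
  by rewrite normcM normc_real ger0_norm// ler_pM ?normc_ge0// normc_cisB_le2.
rewrite sumr_const_nat subn0 -[_ *+ _]mulr_natr.
have -> : D * Q%:R / xi * (2 * pi * xi) = D * 2 * Q%:R * pi by field; rewrite gt_eqF.
have D0 : 0 <= D by have /andP[] := rhoD 0%N; exact: le_trans.
by rewrite ler_peMr ?mulr_ge0// pi_ge1.
Qed.

End step_density.

Lemma cell_bounds (j c e M Q : nat) : (c < M)%N -> (e < Q)%N ->
  (j * Q * M <= (j * M + c) * Q + e < j.+1 * Q * M)%N.
Proof. by move=> cM eQ; apply/andP; split; nia. Qed.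

(** In the unit [1 / (Q * M * M)] an old cell has length [M * M], and an interval of length [1 / M]
    has length [M * Q]. The intervals inside the cell [a] miss less than two interval lengths of it,
    each at most an eighth of the cell. *)
Lemma grid_window (a M Q : nat) : (0 < Q)%N -> (8 * Q <= M)%N ->
  exists j0 I : nat, [/\ (3 * M <= 4 * (I * Q))%N, (a * (M * M) <= j0 * (M * Q))%N,
    (j0 * (M * Q) + I * (M * Q) <= a * (M * M) + M * M)%N &
    forall i, (i < I)%N ->
      ((j0 + i) * Q %/ M = a)%N /\ (((j0 + i).+1 * Q).-1 %/ M = a)%N].
Proof.
move=> Q0 QM; have M0 : (0 < M)%N by lia.
exists (a * M %/ Q).+1, (M %/ Q).-1; set j0 := (a * M %/ Q).+1.
have d0 : (0 < M %/ Q)%N by rewrite divn_gt0//; lia.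
have [I dI] : exists I, (M %/ Q = I.+1)%N by exists (M %/ Q).-1; rewrite prednK.
rewrite dI /=.
have h1 := ltn_ceil M Q0; rewrite dI in h1.
have h2 : (I.+1 * Q <= M)%N by rewrite -dI leq_divM.
have h3 : (a * M <= j0 * Q)%N by rewrite ltnW// ltn_ceil.
have h4 : (j0 * Q <= a * M + Q)%N.
  by rewrite /j0 mulSn addnC leq_add2r leq_divM.
have h5 : (j0 * Q + I * Q <= a * M + M)%N by rewrite mulSn in h2; lia.
split.
- by rewrite !mulSn in h1; lia.
- by rewrite !(mulnCA _ M) leq_mul2l h3 orbT.
- by rewrite !(mulnCA _ M) -!mulnDr leq_mul2l h5 orbT.
- move=> i iI.
  have h6 : (i * Q + Q <= I * Q)%N by rewrite addnC -mulSn leq_mul2r iI orbT.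
  have h7 : ((j0 + i).+1 * Q <= a * M + M)%N by rewrite mulSn mulnDl; lia.
  have h8 : (a * M <= (j0 + i) * Q)%N by rewrite mulnDl; lia.
  have div_a x : (a * M <= x < a * M + M)%N -> (x %/ M = a)%N.
    move=> /andP[x1 x2]; rewrite -(subnKC x1) divnMDl// divn_small ?addn0//.
    by rewrite ltn_subLR.
  by rewrite mulSn in h7 *; split; apply: div_a; lia.
Qed.

Section stage.
Context {R : realType} (q n Q T : nat) (eps D : R) (rho : nat -> R).
Hypotheses (q1 : (1 < q)%N) (Q0 : (0 < Q)%N) (T0 : (0 < T)%N).
Hypotheses (eps0 : 0 < eps) (eps1 : eps < 1).
Hypotheses (rhoD : forall a, 0 <= rho a <= D)
  (rhoQ : \sum_(0 <= a < Q) rho a = Q%:R).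

Let M := (q ^ n)%N.
Let M0 : (0 < M)%N. Proof. by rewrite expn_gt0 ltnW. Qed.
Let MM0 : (0 < M * M)%N. Proof. by rewrite muln_gt0 M0. Qed.
Let MR0 : 0 < M%:R :> R. Proof. by rewrite ltr0n. Qed.
Let TR0 : 0 < T%:R :> R. Proof. by rewrite ltr0n. Qed.
Let TR1 : 1 <= T%:R :> R. Proof. by rewrite ler1n. Qed.
Let QR0 : 0 < Q%:R :> R. Proof. by rewrite ltr0n. Qed.
Let hpi : 0 < pi :> R. Proof. exact: pi_gt0. Qed.
Let rho0 a : 0 <= rho a. Proof. by have /andP[] := rhoD a. Qed.

(* The j-th interval of length 1 / M lies in a single interval of the grid 1 / Q. *)
Definition nice (j : nat) : bool := (j * Q %/ M == (j.+1 * Q).-1 %/ M)%N.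

(* The digit weights act with amplitude 1 / T, on the digits n + 1, ..., 2 n. *)
Definition weight (a : nat) : R :=
  if nice (a %/ Q %/ M) then 1 + (dwt q eps n (a %/ Q) - 1) / T%:R else 1.

(** The grids [1 / Q] and [1 / (M * M)] need not refine each other, so the new density lives on a
    common refinement: [a %/ (M * M)] is the old cell, and [a %/ Q] the integer formed by the first
    [2 * n] base-[q] digits. *)
Definition next (a : nat) : R := rho (a %/ (M * M)) * weight a.

Lemma weight_bounds a : 0 <= weight a <= (1 + eps) ^+ n.
Proof.
have e0 := eps0.
have h1 : 1 <= (1 + eps) ^+ n by rewrite exprn_ege1//; lra.
rewrite /weight; case: ifP => _; last by rewrite ler01.
have d0 := dwt_ge0 q eps0 eps1 n (a %/ Q); have d1 := dwt_le q eps0 eps1 n (a %/ Q).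
have t1 : T%:R^-1 <= 1 :> R by rewrite invf_le1.
have t0 : 0 < T%:R^-1 :> R by rewrite invr_gt0.
by apply/andP; split; nra.
Qed.

Lemma next_bounds a : 0 <= next a <= D * (1 + eps) ^+ n.
Proof.
have /andP[w0 w1] := weight_bounds a; have /andP[r0 r1] := rhoD (a %/ (M * M)).
by rewrite /next mulr_ge0//= ler_pM.
Qed.

Let cellE j c e : (c < M)%N -> (e < Q)%N ->
  (((j * M + c) * Q + e) %/ Q = j * M + c)%N /\ ((j * M + c) %/ M = j)%N.
Proof.
by move=> cM eQ; rewrite !divnMDl// (divn_small cM) (divn_small eQ) !addn0.
Qed.

Let nice_rho j c e : nice j -> (c < M)%N -> (e < Q)%N ->
  (((j * M + c) * Q + e) %/ (M * M) = j * Q %/ M)%N.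
Proof.
move=> /eqP nj cM eQ; rewrite divnMA; apply/eqP; rewrite eqn_leq; apply/andP; split.
  rewrite nj; apply: leq_div2r; rewrite -ltnS prednK ?muln_gt0// ltn_divLR//.
  by have /andP[] := cell_bounds j cM eQ.
by apply: leq_div2r; rewrite leq_divRL//; have /andP[] := cell_bounds j cM eQ.
Qed.

Let sum_cells (V : nmodType) (F : nat -> V) :
  \sum_(0 <= a < Q * (M * M)) F a = \sum_(0 <= j < M) \sum_(0 <= c < M)
    \sum_(0 <= e < Q) F ((j * M + c) * Q + e)%N.
Proof. by rewrite mulnC sum_nat_mulD sum_nat_mulD. Qed.

(** The perturbation vanishes outside the nice intervals. On each of them the old density is
    constant and the digit weights are the same, so the difference is a phase times a sum that does
    not depend on [j]. *)
Lemma four_nextB xi : four (Q * (M * M)) next xi - four Q rho xi =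
  \sum_(0 <= j < M | nice j) (rho (j * Q %/ M))%:C%C * (cis (xi * (j%:R / M%:R)) *
    ((cis (xi / (M * M)%:R) - 1) * \sum_(0 <= c < M)
       ((dwt q eps n c - 1) / T%:R)%:C%C * cis (xi / (M * M)%:R * c%:R))).
Proof.
rewrite (four_refine _ _ Q0 MM0) /four -sumrB sum_cells [RHS]big_mkcond /=.
apply: eq_bigr => j _; case: ifPn => nj; last first.
  apply: big1_seq => c /=; rewrite mem_index_iota => /andP[_ cM].
  apply: big1_seq => e /=; rewrite mem_index_iota => /andP[_ eQ].
  rewrite /next /weight; have [-> ->] := cellE j cM eQ.
  by rewrite (negbTE nj) mulr1 subrr.
rewrite mulrA big_distrr /= big_distrr /=; apply: eq_sum_nat_lt => c cM.
rewrite (@eq_sum_nat_lt _ _ _ (fun e => (rho (j * Q %/ M) *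
   ((dwt q eps n c - 1) / T%:R))%:C%C * dcis (M * M * Q) ((j * M + c) * Q + e) xi)).
  rewrite -big_distrr /= sum_dcis// rmorphM /= /dcis.
  have h (a : nat) : xi * (a%:R / (M * M)%:R) = xi / (M * M)%:R * a%:R by ring.
  have -> : xi * ((j * M + c).+1%:R / (M * M)%:R) =
      xi * (j%:R / M%:R) + xi / (M * M)%:R * c%:R + xi / (M * M)%:R.
    by rewrite -natr1 natrD !natrM; field; rewrite gt_eqF.
  have -> : xi * ((j * M + c)%:R / (M * M)%:R) =
      xi * (j%:R / M%:R) + xi / (M * M)%:R * c%:R.
    by rewrite natrD !natrM; field; rewrite gt_eqF.
  rewrite !cisD; ring.
move=> e eQ; rewrite /next /weight; have [-> ->] := cellE j cM eQ.
rewrite nj nice_rho// dwtD// [(Q * _)%N]mulnC -mulrBl -rmorphB /=.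
by congr (_%:C%C * _); ring.
Qed.

(** A nice interval lies in one old cell, so the sum is [M] times the mass that the old density
    gives to these intervals. *)
Lemma sum_nice_le : \sum_(0 <= j < M | nice j) rho (j * Q %/ M) <= M%:R.
Proof.
have := sum_cells (fun a => rho (a %/ (M * M))).
rewrite sum_nat_mulD.
under eq_bigr => a _.
  rewrite (@eq_sum_nat_lt _ _ _ (fun=> rho a)).
    rewrite sumr_const_nat subn0 -[_ *+ _]mulr_natr; over.
  by move=> e eM; rewrite divnMDl// divn_small// addn0.
rewrite -big_distrl /= rhoQ => e.
have h : 0 < (M * Q)%:R :> R by rewrite ltr0n muln_gt0 M0.
rewrite -(ler_pM2r h) [leRHS](_ : _ = Q%:R * (M * M)%:R); last by rewrite !natrM; ring.
rewrite e big_distrl /= big_mkcond /=; apply: ler_sum => j _.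
case: ifPn => nj; last by rewrite !sumr_ge0// => c _; rewrite sumr_ge0.
rewrite (@eq_sum_nat_lt _ _ _ (fun=> rho (j * Q %/ M) * Q%:R)).
  rewrite sumr_const_nat subn0 -[X in _ <= X]mulr_natr natrM le_eqVlt.
  by apply/orP; left; apply/eqP; ring.
move=> c cM; rewrite (@eq_sum_nat_lt _ _ _ (fun=> rho (j * Q %/ M))).
  by rewrite sumr_const_nat subn0 -[_ *+ _]mulr_natr.
by move=> e' eQ; rewrite nice_rho.
Qed.

(** All estimates of a stage reduce to a bound [B] on the common inner sum: the phases have modulus
    1 and the nice intervals have mass at most 1. *)
Let nfour_next xi (B : R) : 0 < xi -> 0 <= B ->
  normc ((cis (xi / (M * M)%:R) - 1) * \sum_(0 <= c < M)
       (dwt q eps n c - 1)%:C%C * cis (xi / (M * M)%:R * c%:R)) <= B ->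
  nfour (Q * (M * M)) next xi <= nfour Q rho xi + M%:R * B / T%:R / (2 * pi * xi).
Proof.
move=> xi0 B0 hB; rewrite /nfour -mulrDl ler_wpM2r//.
  by rewrite invr_ge0 !mulr_ge0// ltW.
rewrite -lerBlDl (le_trans _ (_ : normc (four (Q * (M * M)) next xi - four Q rho xi) <= _))//.
  rewrite lerBlDl (le_trans _ (ler_normcD _ _))// addrC subrK//.
rewrite four_nextB (le_trans (normc_sum _ _ _))//.
apply: (@le_trans _ _ (\sum_(0 <= j < M | nice j) rho (j * Q %/ M) * (B / T%:R))).
  apply: ler_sum => j _; rewrite normcM normc_real ger0_norm// ler_wpM2l//.
  rewrite normcM normc_cis mul1r.
  have -> : \sum_(0 <= c < M) ((dwt q eps n c - 1) / T%:R)%:C%C *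
       cis (xi / (M * M)%:R * c%:R) = (\sum_(0 <= c < M) (dwt q eps n c - 1)%:C%C *
       cis (xi / (M * M)%:R * c%:R)) * (T%:R^-1)%:C%C.
    by rewrite big_distrl /=; apply: eq_bigr => c _; rewrite rmorphM/=; ring.
  rewrite mulrA normcM normc_real ger0_norm ?invr_ge0//.
  by rewrite ler_wpM2r// invr_ge0.
rewrite -big_distrl /= -mulrA ler_wpM2r ?divr_ge0//.
exact: sum_nice_le.
Qed.

Let sum_dev (F : nat -> R[i]) (B : R) : (forall c, (c < M)%N -> normc (F c) <= B) -> 0 <= B ->
  normc (\sum_(0 <= c < M) (dwt q eps n c - 1)%:C%C * F c) <= 2 * M%:R * B.
Proof.
move=> FB B0; rewrite (le_trans (normc_sum _ _ _))//.
apply: (@le_trans _ _ (\sum_(0 <= c < M) (dwt q eps n c + 1) * B)).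
  apply: ler_sum_nat_lt => c cM; rewrite normcM normc_real ler_pM ?normc_ge0//; last exact: FB.
  by rewrite (le_trans (ler_normB _ _))// ger0_norm ?dwt_ge0// normr1.
rewrite -big_distrl /= big_split /= sum_dwt// sumr_const_nat subn0.
by rewrite -mulr2n mulr_natl.
Qed.

(** The trivial bound, uniform in the frequency. Stage [k] has [T = k + 1], and this is what makes
    the Fourier coefficients tend to 0. *)
Lemma nfour_next_T xi : 0 < xi ->
  nfour (Q * (M * M)) next xi <= nfour Q rho xi + 2 / T%:R.
Proof.
move=> xi0; set B : R := 2 * pi * (xi / (M * M)%:R) * (2 * M%:R).
have x0 : 0 < xi / (M * M)%:R by rewrite divr_gt0// ltr0n.
rewrite (le_trans (@nfour_next xi B xi0 _ _))//.
- by rewrite !mulr_ge0// ltW.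
- rewrite normcM ler_pM ?normc_ge0//.
    by rewrite -cis0 (le_trans (cis_lip _ _))// subr0 ger0_norm ?(ltW x0)// mulrA.
  by rewrite -[leRHS]mulr1 sum_dev// => c _; rewrite normc_cis.
rewrite lerD2l /B natrM le_eqVlt; apply/orP; left; apply/eqP.
move: hpi; generalize (@pi R) => p p0; field; by rewrite !gt_eqF.
Qed.

(** The weights have mean 1, so a constant may be subtracted from the exponentials, which gains the
    factor [xi / M]. *)
Lemma nfour_next_low xi : 0 < xi ->
  nfour (Q * (M * M)) next xi <= nfour Q rho xi + 4 * pi * xi / M%:R.
Proof.
move=> xi0; set B : R := 2 * pi * (xi / (M * M)%:R) * (2 * M%:R * (2 * pi * (xi / M%:R))).
have x0 : 0 < xi / (M * M)%:R by rewrite divr_gt0// ltr0n.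
have x1 : 0 < xi / M%:R by rewrite divr_gt0// ltr0n.
rewrite (le_trans (@nfour_next xi B xi0 _ _))//.
- by rewrite !mulr_ge0// ltW.
- rewrite normcM ler_pM ?normc_ge0//.
    by rewrite -cis0 (le_trans (cis_lip _ _))// subr0 ger0_norm ?(ltW x0)// mulrA.
  have -> : \sum_(0 <= c < M) (dwt q eps n c - 1)%:C%C * cis (xi / (M * M)%:R * c%:R) =
    \sum_(0 <= c < M) (dwt q eps n c - 1)%:C%C * (cis (xi / (M * M)%:R * c%:R) - cis 0).
    under [RHS]eq_bigr do rewrite mulrBr.
    rewrite sumrB cis0 -[LHS]subr0; congr (_ - _).
    under eq_bigr do rewrite mulr1.
    by rewrite -rmorph_sum /= sumrB sum_dwt// sumr_const_nat subn0 subrr.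
  apply: sum_dev; last by rewrite !mulr_ge0// ltW.
  move=> c cM; rewrite (le_trans (cis_lip _ _))// subr0 ger0_norm ?mulr_ge0 ?invr_ge0 ?(ltW xi0)//.
  rewrite ler_wpM2l ?mulr_ge0 ?(ltW hpi)// natrM.
  rewrite [leLHS](_ : _ = xi / M%:R * (c%:R / M%:R)); last by field; rewrite gt_eqF.
  rewrite ler_piMr ?(ltW x1)// ler_pdivrMr// mul1r ler_nat ltnW//.
rewrite lerD2l /B natrM.
rewrite [leLHS](_ : _ = 4 * pi * xi / M%:R / T%:R); last by move: hpi; generalize (@pi R) => p p0; field; rewrite !gt_eqF.
by rewrite ler_piMr ?invf_le1// !mulr_ge0 ?invr_ge0// ltW.
Qed.

Definition riesz (xi : R) : R :=
  \prod_(0 <= i < n) (normc (phi q eps (xi / (M * M)%:R * (q ^ i)%:R)) / q%:R).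

Let qR0 : 0 < q%:R :> R. Proof. by rewrite ltr0n ltnW. Qed.

Lemma riesz_bounds xi : 0 <= riesz xi <= 1.
Proof.
rewrite /riesz; apply/andP; split.
  by apply: prodr_ge0 => i _; rewrite divr_ge0 ?normc_ge0.
by apply: prodr_ile1 => i _; rewrite divr_ge0 ?normc_ge0//= ler_pdivrMr// mul1r normc_phi_le.
Qed.

Let normc_sum_dwt_cis xi :
  normc (\sum_(0 <= c < M) (dwt q eps n c)%:C%C * cis (xi / (M * M)%:R * c%:R)) =
  M%:R * riesz xi.
Proof.
rewrite sum_dwt_cis// /riesz /M; elim: n (xi / _) => [|m IHm] t.
  by rewrite !big_nil expn0 normc1 mulr1.
rewrite !big_nat_recl// normcM.
under eq_bigr do rewrite expnS natrM mulrA.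
rewrite IHm expnS natrM.
under [in RHS]eq_bigr do rewrite expnS natrM mulrA.
by field; rewrite gt_eqF.
Qed.

Let nfour_next_bound xi (B : R) : 0 < xi -> normc (cis (xi / (M * M)%:R) - 1) <= B ->
  nfour (Q * (M * M)) next xi <=
  nfour Q rho xi + (M * M)%:R * B * riesz xi / (2 * pi * xi) + M%:R / xi.
Proof.
move=> xi0 hB; have /andP[z0 z1] := riesz_bounds xi.
have B0 : 0 <= B by apply: le_trans hB; exact: normc_ge0.
have e : (cis (xi / (M * M)%:R) - 1) * (\sum_(0 <= c < M) cis (xi / (M * M)%:R * c%:R)) =
    cis (xi / M%:R) - cis 0.
  rewrite mulrC sum_cis_geo cis0; congr (cis _ - _).
  by rewrite natrM; field; rewrite gt_eqF.
rewrite (le_trans (@nfour_next xi (B * (M%:R * riesz xi) + 2) xi0 _ _))//.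
- by rewrite addr_ge0// !mulr_ge0.
- under eq_bigr do rewrite rmorphB /= mulrBl mul1r.
  rewrite sumrB mulrBr e (le_trans (ler_normcB _ _))// lerD ?normc_cisB_le2//.
  by rewrite normcM normc_sum_dwt_cis ler_wpM2r// mulr_ge0.
rewrite -addrA lerD2l.
have x0 : 0 < (2 * pi * xi)^-1 by rewrite invr_gt0 !mulr_gt0.
apply: (@le_trans _ _ (M%:R * (B * (M%:R * riesz xi) + 2) / (2 * pi * xi))).
  rewrite ler_wpM2r ?(ltW x0)// ler_piMr ?invf_le1//.
  by rewrite mulr_ge0// addr_ge0// !mulr_ge0.
rewrite mulrDr mulrDl natrM lerD//.
  by rewrite le_eqVlt; apply/orP; left; apply/eqP; ring.
rewrite [leLHS](_ : _ = M%:R / xi / pi); last by move: hpi; generalize (@pi R) => p p0; field; rewrite !gt_eqF.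
rewrite ler_piMr ?divr_ge0 ?(ltW xi0)// invf_le1//.
exact: pi_ge1.
Qed.

(** The digit product gives [riesz]; the constant 1 subtracted from it gives a geometric sum and the
    term [M / xi]. The amplitude [1 / T] is estimated by 1. *)
Lemma nfour_next_riesz xi : 0 < xi ->
  nfour (Q * (M * M)) next xi <= nfour Q rho xi + riesz xi + M%:R / xi.
Proof.
move=> xi0; set B : R := 2 * pi * (xi / (M * M)%:R).
have x0 : 0 < xi / (M * M)%:R by rewrite divr_gt0// ltr0n.
rewrite (le_trans (@nfour_next_bound xi B xi0 _))//.
  by rewrite -cis0 (le_trans (cis_lip _ _))// subr0 ger0_norm ?(ltW x0)// mulrA.
rewrite lerD2r lerD2l /B natrM le_eqVlt; apply/orP; left; apply/eqP.
move: hpi; generalize (@pi R) => p p0; field; by rewrite !gt_eqF.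
Qed.

(** Here the chord [cis (xi / (M * M)) - 1] is bounded by 2 instead of linearly, which gives decay
    beyond [M * M]. *)
Lemma nfour_next_high xi : 0 < xi ->
  nfour (Q * (M * M)) next xi <= nfour Q rho xi + (M * M)%:R / xi + M%:R / xi.
Proof.
move=> xi0; rewrite (le_trans (@nfour_next_bound xi 2 xi0 _))//.
  by rewrite -cis0 normc_cisB_le2.
have /andP[z0 z1] := riesz_bounds xi.
rewrite lerD2r lerD2l.
rewrite [leLHS](_ : _ = (M * M)%:R / xi * (riesz xi / pi)); last first.
  by move: hpi; generalize (@pi R) => p p0; field; rewrite !gt_eqF.
rewrite ler_piMr ?divr_ge0 ?(ltW xi0)// ler_pdivrMr// mul1r (le_trans z1)//.
exact: pi_ge1.
Qed.

(** A nice interval is wholly inside or wholly outside the old cell [a], and the weights average to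
    1 on it; on the other intervals they are 1. A stage thus preserves the mass of every old
    cell. *)
Lemma sum_weight a : (a < Q)%N ->
  \sum_(0 <= i < M * M) weight (a * (M * M) + i) = (M * M)%:R.
Proof.
move=> aQ.
have pick (F : nat -> R) : \sum_(0 <= x < Q * (M * M)) (if (x %/ (M * M) == a)%N then F x else 0) =
    \sum_(0 <= i < M * M) F (a * (M * M) + i)%N.
  rewrite sum_nat_mulD big_mkord (bigD1 (Ordinal aQ))//= [X in _ + X]big1 ?addr0.
    by apply: eq_sum_nat_lt => i iM; rewrite divnMDl// divn_small// addn0 eqxx.
  move=> b; rewrite -val_eqE /= => /negbTE ba; apply: big1_seq => i /=.
  by rewrite mem_index_iota => /andP[_ iM]; rewrite divnMDl// divn_small// addn0 ba.
suff : \sum_(0 <= i < M * M) (weight (a * (M * M) + i) - 1) = 0.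
  by rewrite sumrB sumr_const_nat subn0 => /eqP; rewrite subr_eq0 => /eqP.
rewrite -(pick (fun x => weight x - 1)) sum_cells big1// => j _.
case: (boolP (nice j)) => nj; last first.
  apply: big1_seq => c /=; rewrite mem_index_iota => /andP[_ cM].
  apply: big1_seq => e /=; rewrite mem_index_iota => /andP[_ eQ].
  by rewrite /weight; have [-> ->] := cellE j cM eQ; rewrite (negbTE nj) subrr if_same.
rewrite (@eq_sum_nat_lt _ _ _ (fun c => (if (j * Q %/ M == a)%N then Q%:R / T%:R else 0) *
   (dwt q eps n c - 1))).
  by rewrite -big_distrr /= sumrB sum_dwt// sumr_const_nat subn0 subrr mulr0.
move=> c cM; rewrite (@eq_sum_nat_lt _ _ _ (fun=> (if (j * Q %/ M == a)%N then
    (dwt q eps n c - 1) / T%:R else 0))).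
  rewrite sumr_const_nat subn0 -[_ *+ _]mulr_natr; case: ifP => _; last by rewrite !mul0r.
  by ring.
move=> e eQ; rewrite nice_rho// /weight; have [-> ->] := cellE j cM eQ.
by rewrite nj dwtD// addrAC subrr add0r.
Qed.

Lemma sum_next a : (a < Q)%N ->
  \sum_(0 <= i < M * M) next (a * (M * M) + i) = (M * M)%:R * rho a.
Proof.
move=> aQ; rewrite -(sum_weight aQ) big_distrl /=; apply: eq_sum_nat_lt => i iM.
by rewrite /next divnMDl// divn_small// addn0 mulrC.
Qed.

(** At the scale [q ^ (n + l)] inside the window only its first [l] digits are fixed; the other [m]
    average out, so the density has grown by [(1 + eps) ^ l] only. The ball condition requires this
    for each [l]. *)
Lemma sum_next_cell l m c : n = (l + m)%N ->
  \sum_(0 <= e < q ^ m * Q) next (c * (q ^ m * Q) + e) <=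
  D * (1 + eps) ^+ l * (q ^ m * Q)%:R.
Proof.
move=> nlm; have e0 := eps0.
have D0 : 0 <= D by have /andP[] := rhoD 0%N; exact: le_trans.
apply: (@le_trans _ _ (\sum_(0 <= e < q ^ m * Q) D * weight (c * (q ^ m * Q) + e))).
  apply: ler_sum => e _; rewrite ler_wpM2r//; last by have /andP[] := rhoD ((c * (q ^ m * Q) + e) %/ (M * M)).
  by have /andP[] := weight_bounds (c * (q ^ m * Q) + e).
rewrite -big_distrr /= -mulrA ler_wpM2l// sum_nat_mulD.
pose X c' : R := if nice (c %/ q ^ l) then 1 + (dwt q eps n (c * q ^ m + c') - 1) / T%:R else 1.
rewrite (@eq_sum_nat_lt _ _ _ (fun c' => X c' * Q%:R)); last first.
  move=> c' cm; rewrite (@eq_sum_nat_lt _ _ _ (fun=> X c')).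
    by rewrite sumr_const_nat subn0 -[_ *+ _]mulr_natr.
  move=> e eQ; have -> : (c * (q ^ m * Q) + (c' * Q + e) = (c * q ^ m + c') * Q + e)%N.
    by rewrite mulnDl !mulnA addnA.
  rewrite /weight divnMDl// (divn_small eQ) addn0.
  have -> : ((c * q ^ m + c') %/ M = c %/ q ^ l)%N.
    by rewrite /M nlm expnD [(q ^ l * _)%N]mulnC divnMA divnMDl ?expn_gt0 ?(ltnW q1)// (divn_small cm) addn0.
  by [].
rewrite -big_distrl /= natrM mulrA ler_wpM2r//.
have h1 : 1 <= (1 + eps) ^+ l by rewrite exprn_ege1//; lra.
rewrite /X; case: (nice _); last first.
  by rewrite sumr_const_nat subn0 -[_ *+ _]mulr_natr mul1r ler_peMl.
rewrite big_split /= -big_distrl /= sumrB !sumr_const_nat subn0 {1}nlm sum_dwt_block//.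
have d0 := dwt_ge0 q eps0 eps1 l c; have d1 := dwt_le q eps0 eps1 l c.
have t1 : T%:R^-1 <= 1 :> R by rewrite invf_le1.
have t0 : 0 < T%:R^-1 :> R by rewrite invr_gt0.
rewrite [leLHS](_ : _ = (q ^ m)%:R * (1 + (dwt q eps l c - 1) / T%:R)); last by ring.
by rewrite mulrC ler_wpM2r//; nra.
Qed.

(* The digits in the window of the stage are all among those of [a %/ Q]. *)
Definition hit (a : nat) : bool := (1 + eps / 2) * n%:R <= q%:R * (zeros q n (a %/ Q))%:R.

(** Nice intervals fill at least three quarters of the cell, and on each of them the hits carry
    three quarters of the digit product; 9 / 16 exceeds 1 / 2. The factor [1 / T] comes from
    [weight] being at least [dwt / T] there. *)
Lemma sum_next_hit a : (a < Q)%N -> (8 * Q <= M)%N -> 16 * q%:R ^+ 2 <= eps ^+ 2 * n%:R ->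
  rho a * (M * M)%:R / (2 * T%:R) <=
  \sum_(0 <= i < M * M | hit (a * (M * M) + i)) next (a * (M * M) + i).
Proof.
move=> aQ QM hn.
pose f x : R := if hit x then weight x else 0.
have f0 x : 0 <= f x.
  by rewrite /f; case: ifP => // _; have /andP[] := weight_bounds x.
have -> : \sum_(0 <= i < M * M | hit (a * (M * M) + i)) next (a * (M * M) + i) =
    rho a * \sum_(0 <= i < M * M) f (a * (M * M) + i)%N.
  rewrite big_mkcond /= big_distrr /=; apply: eq_sum_nat_lt => i iM.
  rewrite /f; case: ifP => _; last by rewrite mulr0.
  by rewrite /next divnMDl// divn_small// addn0.
rewrite -mulrA ler_wpM2l//.
have [j0 [I [IQ2 le1 le2 hI]]] := grid_window a Q0 QM.
have sub : \sum_(0 <= i < I) \sum_(0 <= y < M * Q) f ((j0 + i) * (M * Q) + y)%N <=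
    \sum_(0 <= i < M * M) f (a * (M * M) + i)%N.
  have sh b m : \sum_(0 <= i < m) f (b + i)%N = \sum_(b <= x < b + m) f x.
    rewrite -{2}[b]add0n big_addn addKn.
    by apply: eq_bigr => i _; rewrite addnC.
  have -> : \sum_(0 <= i < I) \sum_(0 <= y < M * Q) f ((j0 + i) * (M * Q) + y)%N =
     \sum_(0 <= x < I * (M * Q)) f (j0 * (M * Q) + x)%N.
    rewrite sum_nat_mulD; apply: eq_bigr => i _; apply: eq_bigr => y _.
    by rewrite mulnDl addnA.
  rewrite !sh.
  have le3 : (j0 * (M * Q) <= a * (M * M) + M * M)%N by rewrite (leq_trans _ le2)// leq_addr.
  rewrite [leRHS](@big_cat_nat _ _ _ (j0 * (M * Q)))//=.
  rewrite [X in _ <= _ + X](@big_cat_nat _ _ _ (j0 * (M * Q) + I * (M * Q))) ?leq_addr//=.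
  rewrite -[leLHS]add0r -[X in 0 + X]addr0.
  by rewrite !lerD// sumr_ge0.
apply: le_trans sub.
have each i : (i < I)%N -> Q%:R * (M%:R * (3 / 4)) / T%:R <=
    \sum_(0 <= y < M * Q) f ((j0 + i) * (M * Q) + y)%N.
  move=> iI; rewrite sum_nat_mulD.
  have nj : nice (j0 + i).
    by have [e1 e2] := hI i iI; rewrite /nice e1 e2.
  rewrite [leLHS](_ : _ = M%:R * (3 / 4) * (Q%:R / T%:R)); last by ring.
  have := zeros_concentration q1 eps0 eps1 hn; rewrite -/M => hz.
  apply: (@le_trans _ _ (\sum_(0 <= c < q ^ n) (if (1 + eps / 2) * n%:R <= q%:R * (zeros q n c)%:R
     then dwt q eps n c else 0) * (Q%:R / T%:R))).
    by rewrite -big_distrl /= -big_mkcond /= ler_wpM2r ?divr_ge0.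
  apply: ler_sum_nat_lt => c cM.
  rewrite (@eq_sum_nat_lt _ _ _ (fun=> if (1 + eps / 2) * n%:R <= q%:R * (zeros q n c)%:R
     then 1 + (dwt q eps n c - 1) / T%:R else 0)); last first.
    move=> e eQ; have -> : ((j0 + i) * (M * Q) + (c * Q + e) = ((j0 + i) * M + c) * Q + e)%N.
      by rewrite [in RHS]mulnDl !mulnA addnA.
    rewrite /f /hit /weight; have [-> ->] := cellE (j0 + i) cM eQ.
    by rewrite nj dwtD// zerosD.
  rewrite sumr_const_nat subn0 -[X in _ <= X]mulr_natr.
  case: ifP => _; last by rewrite !mul0r.
  rewrite mulrA mulrAC ler_wpM2r//.
  have t1 : T%:R^-1 <= 1 :> R by rewrite invf_le1.
  lra.
apply: (@le_trans _ _ (\sum_(0 <= i < I) Q%:R * (M%:R * (3 / 4)) / T%:R)); last first.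
  exact: ler_sum_nat_lt.
rewrite sumr_const_nat subn0 -[X in _ <= X]mulr_natr.
rewrite [leRHS](_ : _ = ((3 / 2) * (I%:R * Q%:R)) * (M%:R / (2 * T%:R))); last first.
  by field; rewrite gt_eqF.
rewrite natrM -mulrA ler_wpM2r ?divr_ge0 ?mulr_ge0//.
have : (3 * M)%:R <= (4 * (I * Q))%:R :> R by rewrite ler_nat.
rewrite !natrM => h; have := ltW MR0; lra.
Qed.

End stage.

(** * Fourier factors along geometric progressions *)

Lemma ler_sum_subset (R : numDomainType) (I : eqType) (r s : seq I) (f : I -> R) :
  uniq r -> uniq s -> {subset r <= s} -> (forall i, 0 <= f i) ->
  \sum_(i <- r) f i <= \sum_(i <- s) f i.
Proof.
move=> ur us rs f0; rewrite [leRHS](bigID [in r]) /= -[X in _ <= X + _]big_filter.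
rewrite [X in _ <= X + _](@perm_big _ _ _ _ _ r); first by rewrite lerDl sumr_ge0.
apply: uniq_perm; rewrite ?filter_uniq// => i; rewrite mem_filter.
by case: (boolP (i \in r)) => //= /rs ->.
Qed.

(** * Sums along sequences that at least double *)

Section geometric.
Context {R : realFieldType}.
Implicit Types (x : nat -> R) (X : R).

Lemma doubling_ge x : 0 < x 0%N -> (forall i, 2 * x i <= x i.+1) ->
  forall i j, 0 < x i /\ 2 ^+ j * x i <= x (i + j)%N.
Proof.
move=> x0 x2.
have xp i : 0 < x i.
  by elim: i => // i IHi; rewrite (lt_le_trans _ (x2 i))// mulr_gt0.
move=> i j; split => //; elim: j => [|j IHj]; first by rewrite addn0 mul1r.
by rewrite addnS (le_trans _ (x2 _))// exprS -mulrA ler_pM2l.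
Qed.

Lemma sum_geo_high x X N : 0 < x 0%N -> (forall i, 2 * x i <= x i.+1) -> 0 < X ->
  \sum_(0 <= i < N) (if X <= x i then X / x i else 0) <= 2.
Proof.
move=> x0 x2 X0.
(* For a sequence that starts above [X] the bound is sharpened to twice the first term, so that the
   induction closes. *)
suff : forall N x, 0 < x 0%N -> (forall i, 2 * x i <= x i.+1) ->
    \sum_(0 <= i < N) (if X <= x i then X / x i else 0) <=
    if X <= x 0%N then 2 * (X / x 0%N) else 2.
  move/(_ N x x0 x2) => h; rewrite (le_trans h)//; case: ifP => // Xx.
  by rewrite ler_piMr// ler_pdivrMr ?mul1r.
elim=> [|{}N IHN] {x2}x {}x0 x2.
  by rewrite big_nil; case: ifP => // _; rewrite mulr_ge0// divr_ge0 ?ltW.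
rewrite big_nat_recl//.
have x1 : 0 < x 1%N by rewrite (lt_le_trans _ (x2 0%N))// mulr_gt0.
have := IHN (fun i => x i.+1) x1 (fun i => x2 i.+1).
case: (leP X (x 0%N)) => Xx0 => h; last first.
  by rewrite add0r (le_trans h)//; case: ifP => // Xx; rewrite ler_piMr// ler_pdivrMr ?mul1r.
rewrite mulr_natl mulr2n lerD2l (le_trans h)//.
have -> : X <= x 1%N by rewrite (le_trans Xx0)// (le_trans _ (x2 0%N))// ler_peMl ?ltW// ltr1n.
rewrite mulrCA ler_pM2l//.
by rewrite ler_pdivrMr// mulrC ler_pdivlMr.
Qed.

Lemma sum_geo_low x X N : 0 < x 0%N -> (forall i, 2 * x i <= x i.+1) -> 0 < X ->
  \sum_(0 <= i < N) (if x i <= X then x i / X else 0) <= 2.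
Proof.
move=> x0 x2 X0; have xp i := (doubling_ge x0 x2 i 0).1.
(* The induction carries the second bound [x N / X]: below [X] a partial sum is dominated by the
   next term. *)
suff : \sum_(0 <= i < N) (if x i <= X then x i / X else 0) <= Num.min 2 (x N / X).
  by move=> /le_trans; apply; rewrite ge_min lexx.
elim: N => [|N IHN]; first by rewrite big_nil le_min ler0n divr_ge0// ltW.
rewrite big_nat_recr//=.
have h : 2 * (x N / X) <= x N.+1 / X by rewrite mulrA ler_pM2r ?invr_gt0// x2.
move: IHN; rewrite !le_min => /andP[i1 i2].
have xX : 0 <= x N / X by rewrite divr_ge0// ltW.
case: ifPn => xNX.
  have : x N / X <= 1 by rewrite ler_pdivrMr// mul1r.
  by move=> ?; apply/andP; split; lra.
by rewrite addr0 i1/= (le_trans i2)//; lra.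
Qed.

Lemma sum_geo_count x X (m N : nat) : 0 < x 0%N -> (forall i, 2 * x i <= x i.+1) -> 0 < X ->
  \sum_(0 <= i < N) (if X <= x i < X * 2 ^+ m then 1 else 0) <= m%:R :> R.
Proof.
move=> + + X0; elim: N x => [|N IHN] x x0 x2; first by rewrite big_nil.
have [Xx|xX] := leP X (x 0%N); last first.
  rewrite big_nat_recl// [X <= x 0%N]leNgt xX/= add0r IHN//.
  by rewrite (lt_le_trans _ (x2 0%N))// mulr_gt0.
apply: (@le_trans _ _ (\sum_(0 <= i < N.+1 | (i < m)%N) 1)).
  rewrite [leRHS]big_mkcond /=; apply: ler_sum => i _.
  case: ifPn => [/andP[_ xi]|_]; last by case: ifP.
  case: ltnP => // mi; move: xi; rewrite ltNge => /negP[].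
  have [_ h] := doubling_ge x0 x2 0 i.
  rewrite (le_trans _ h)// mulrC ler_pM ?(ltW X0) ?exprn_ge0//.
  by rewrite ler_weXn2l// ler1n.
rewrite -big_filter big_const_seq count_predT iter_addr_0 ler_nat.
rewrite -[leqRHS](size_iota 0); apply: uniq_leq_size.
  by rewrite filter_uniq// iota_uniq.
by move=> i; rewrite mem_filter !mem_iota => /andP[].
Qed.

End geometric.

(** * Irrational rotation by log_q b *)

Section rotation.
Context {R : realType}.

Lemma cis_eq1 (t : R) : cis t = 1 -> exists z : int, t = z%:~R.
Proof.
move=> t1; exists (Num.floor t); apply/eqP.
have : cis (t - (Num.floor t)%:~R) = 1 by rewrite -mulrNz cisDint.
have := floor_itv t => /andP[f1 f2].
have [->//|ne h] := eqVneq t (Num.floor t)%:~R.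
have : cis (t - (Num.floor t)%:~R) != 1.
  apply: cis_neq1; rewrite subr_gt0 lt_neqAle eq_sym ne f1/=.
  by rewrite ltrBlDr addrC -[1]/(1%:~R) -intrD.
by rewrite h eqxx.
Qed.

Lemma ln_nat_gt0 (b : nat) : (1 < b)%N -> 0 < ln (b%:R : R).
Proof. by move=> b1; rewrite ln_gt0// ltr1n. Qed.

Lemma ln2_ge : 1 / 2 <= ln (2 : R).
Proof.
have := @le_ln1Dx R (- (1 / 2)).
have -> : 1 + - (1 / 2) = 2^-1 :> R by field.
by rewrite lnV ?posrE//; lra.
Qed.

(* Multiplicative independence says that log_q b is irrational. *)
Lemma cis_log_neq1 (b q h : nat) : (1 < b)%N -> (1 < q)%N -> ~ mult_dep b q ->
  (0 < h)%N -> cis (ln b%:R / ln q%:R * h%:R : R) != 1.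
Proof.
move=> b1 q1 bq h0; apply/eqP => /cis_eq1[z hz]; apply: bq.
have lb := ln_nat_gt0 b1; have lq := ln_nat_gt0 q1.
have e : ln b%:R * h%:R = z%:~R * ln q%:R :> R.
  by rewrite -hz; field; rewrite gt_eqF.
have z0 : 0 < z.
  rewrite -(ltr0z R) -hz mulr_gt0 ?divr_gt0// ltr0n//.
case: z z0 e {hz} => // z z0 e; exists h, z; split => //.
apply/eqP; rewrite -(eqr_nat R); apply/eqP.
rewrite !natrX; apply: ln_inj; rewrite ?posrE ?exprn_gt0 ?ltr0n ?(ltnW b1) ?(ltnW q1)//.
rewrite !lnXn ?ltr0n ?(ltnW b1) ?(ltnW q1)//.
by rewrite -[LHS]mulr_natr e -[RHS]mulr_natr mulrC.
Qed.

(** Each of the finitely many frequencies below [K] gives a geometric sum of ratio different from 1.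
    The bound does not depend on [v], [i0] or [L], which makes the later estimates uniform in
    [u]. *)
Lemma sum_rotation_bound (b q K : nat) : (1 < b)%N -> (1 < q)%N -> ~ mult_dep b q ->
  exists2 B : R, 0 <= B & forall (v : R) (i0 L h : nat), (0 < h < K)%N ->
    normc (\sum_(i <- iota i0 L) cis ((v + i%:R * (ln b%:R / ln q%:R)) * h%:R)) <= B.
Proof.
move=> b1 q1 bq; set al := _ / _.
exists (\sum_(0 <= h < K) 2 / normc (cis (al * h%:R) - 1 : R[i])).
  by apply: sumr_ge0 => h _; rewrite divr_ge0// normc_ge0.
move=> v i0 L h /andP[h0 hK].
apply: (@le_trans _ _ (2 / normc (cis (al * h%:R) - 1 : R[i]))); last first.
  rewrite big_mkord (bigD1 (Ordinal hK))//= lerDl; apply: sumr_ge0 => j _.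
  by rewrite divr_ge0// normc_ge0.
have -> : \sum_(i <- iota i0 L) cis ((v + i%:R * al) * h%:R) =
    cis ((v + i0%:R * al) * h%:R) * \sum_(0 <= i < L) cis (al * h%:R * i%:R) :> R[i].
  rewrite big_distrr /= -[iota i0 L]/(iota i0 L) -(addn0 i0) iotaDl big_map /index_iota subn0.
  apply: eq_bigr => i _; rewrite -cisD natrD; congr cis.
  by rewrite addn0; ring.
rewrite normcM normc_cis mul1r; apply: normc_sum_cis_geo.
exact: cis_log_neq1.
Qed.

End rotation.

(** * The Riesz product along u b^i *)

Section window.
Context {R : realType} (q : nat) (eps : R).
Hypotheses (q1 : (1 < q)%N) (eps0 : 0 < eps) (eps1 : eps < 1).

Let qR0 : 0 < q%:R :> R. Proof. by rewrite ltr0n ltnW. Qed.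
Let q0 : (0 < q)%N. Proof. exact: ltnW. Qed.

Definition psi (t : R) : R := normc (phi q eps t) / q%:R.

Lemma psi_bounds t : 0 <= psi t <= 1.
Proof.
by rewrite /psi divr_ge0 ?normc_ge0//= ler_pdivrMr// mul1r normc_phi_le.
Qed.

(* Majorant of [psi], in terms of the two leading digits of the fractional part. *)
Definition gam (k : R) (c : nat) : R := if (c == 0%N) || (c == (q * q).-1) then 1 else k.

Fixpoint gprod (k : R) (H a : nat) : R :=
  if H is H'.+1 then gam k (a %% (q * q)) * gprod k H' (a %/ (q * q)) else 1.

Lemma sum_gprod k H m : \sum_(0 <= a < m * (q * q) ^ H) gprod k H a =
  m%:R * (2 + ((q * q)%:R - 2) * k) ^+ H.
Proof.
have qq : (q * q = (q * q).-2.+2)%N by rewrite prednK// ?prednK//; nia.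
have sg : \sum_(0 <= c < q * q) gam k c = 2 + ((q * q)%:R - 2) * k.
  rewrite {1}qq big_nat_recl// big_nat_recr//= {1}/gam eqxx/=.
  rewrite (@eq_sum_nat_lt _ _ _ (fun=> k)); last first.
    by move=> i iq; rewrite /gam ifF//; apply/negbTE; lia.
  rewrite sumr_const_nat subn0 (_ : gam k _ = 1); last first.
    by rewrite /gam ifT//; apply/orP; right; lia.
  by rewrite -[_ *+ _]mulr_natl -subn2 natrB; [ring|nia].
elim: H m => [|H IHH] m.
  by rewrite expn0 muln1 sumr_const_nat subn0 expr0 mulr1.
rewrite expnSr mulnA sum_nat_mulD.
under eq_bigr => a _.
  rewrite (@eq_sum_nat_lt _ _ _ (fun c => gprod k H a * gam k c)); last first.
    move=> c cq /=; rewrite modnMDl modn_small// divnMDl ?divn_small ?addn0 1?mulrC//.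
    by nia.
  rewrite -big_distrr /= sg.
  over.
by rewrite -big_distrl /= IHH exprSr mulrA.
Qed.

Lemma gprod_ge0 k H a : 0 <= k -> 0 <= gprod k H a.
Proof.
by move=> k0; elim: H a => //= H IHH a; rewrite mulr_ge0// /gam; case: ifP.
Qed.

(** With powers of [q ^ 2], successive factors read disjoint pairs of digits of the integer part of
    [t], so that [sum_gprod] can average the bound. *)
Lemma prod_psi_le : exists2 k : R, 0 < k < 1 & forall H (t : R), 0 <= t ->
  \prod_(0 <= h < H) psi (t / (q%:R ^+ 2) ^+ h.+1) <= gprod k H (Num.truncn t).
Proof.
have [k k01 hk] := normc_phi_lt q1 eps0 eps1.
have /andP[k0 k1] := k01.
exists k => //; elim=> [|H IHH] t t0; first by rewrite big_nil.
have q20 : 0 < q%:R ^+ 2 :> R by rewrite exprn_gt0.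
rewrite big_nat_recl// expr1 /=.
set a := Num.truncn t.
have /andP[a1 a2] := truncn_itv t0.
have qq0 : (0 < q * q)%N by rewrite muln_gt0 q0.
have eqq : q%:R ^+ 2 = (q * q)%:R :> R by rewrite natrM expr2.
have ea := divn_eq a (q * q).
set a' := (a %/ (q * q))%N in ea *; set c := (a %% (q * q))%N in ea *.
have cq : (c < q * q)%N by rewrite ltn_pmod.
have ha : a%:R = a'%:R * q%:R ^+ 2 + c%:R :> R by rewrite ea natrD natrM eqq.
have cq' : c%:R + 1 <= q%:R ^+ 2 :> R by rewrite natr1 eqq ler_nat.
have h1 : a'%:R <= t / q%:R ^+ 2.
  by rewrite ler_pdivlMr// (le_trans _ a1)// -/a ha lerDl.
have h2 : t / q%:R ^+ 2 < a'%:R + 1.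
  rewrite ltr_pdivrMr// (lt_le_trans a2)// -/a -natr1 ha mulrDl mul1r -addrA lerD2l//.
have -> : a' = Num.truncn (t / q%:R ^+ 2).
  by apply/esym/eqP; rewrite truncn_eq ?divr_ge0 ?(ltW q20)// h1 -natr1 h2.
have /andP[p0 p1] := psi_bounds (t / q%:R ^+ 2).
apply: ler_pM => //.
- by apply: prodr_ge0 => h _; have /andP[] := psi_bounds (t / (q%:R ^+ 2) ^+ h.+2).
- rewrite /gam; case: ifPn => // /norP[c0 cqq].
  rewrite /psi ler_pdivrMr// [leRHS]mulrC; apply: (hk _ (- (a'%:Z))).
  rewrite mulrNz -[_%:~R]/(a'%:R).
  have c1 : 1 <= c%:R :> R by rewrite ler1n lt0n.
  have c2 : c%:R + 2 <= q%:R ^+ 2 :> R.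
    by rewrite -natrD eqq ler_nat addn2 -(ltn_predK cq) ltnS
      ltn_neqAle cqq -ltnS (ltn_predK cq).
  rewrite -(ler_pM2r q20) -(@ler_pM2r _ _ q20 (_ - _)) mulVf ?gt_eqF// !mulrBl mul1r.
  rewrite mulfVK ?gt_eqF// mulVf ?gt_eqF//.
  rewrite -natr1 -/a in a2; rewrite -/a in a1.
  by apply/andP; split; lra.
- have := IHH (t / q%:R ^+ 2); rewrite divr_ge0 ?(ltW q20)// => /(_ isT).
  apply: le_trans; rewrite le_eqVlt; apply/orP; left; apply/eqP.
  by apply: eq_bigr => h _; rewrite [in LHS]exprS invfM mulrA.
Qed.

Lemma prod_sub_le (g : nat -> R) (l0 H n : nat) : (forall l, 0 <= g l <= 1) ->
  (l0 + H * 2 <= n)%N ->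
  \prod_(0 <= l < n) g l <= \prod_(0 <= h < H) g (l0 + h * 2)%N.
Proof.
move=> g01 l0n.
have ge0 a b (f : nat -> nat) : 0 <= \prod_(a <= l < b) g (f l).
  by apply: prodr_ge0 => l _; have /andP[] := g01 (f l).
have le1 a b : \prod_(a <= l < b) g l <= 1.
  by apply: prodr_ile1 => l _; exact: g01.
rewrite (@big_cat_nat _ _ _ l0)//=; last by rewrite (leq_trans _ l0n)// leq_addr.
rewrite [X in _ * X](@big_cat_nat _ _ _ (l0 + H * 2))//= ?leq_addr//.
apply: (@le_trans _ _ (\prod_(l0 <= l < l0 + H * 2) g l)).
  rewrite mulrCA ler_piMr// ?ge0// -[leRHS]mulr1.
  by rewrite ler_pM ?ge0// le1.
rewrite -{1}[l0]add0n big_addn addKn big_nat_mul.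
apply: ler_prod => h _; rewrite prodr_ge0/=; last first.
  by move=> l _; have /andP[] := g01 (l + l0)%N.
rewrite mulSn add2n big_ltn; last by lia.
rewrite big_nat1 addnC ler_piMr//; first by have /andP[] := g01 (l0 + h * 2)%N.
by have /andP[] := g01 ((h * 2).+1 + l0)%N.
Qed.

(* Expressed by the base-q exponent J and mantissa of xi / q^n. *)
Lemma riesz_le k n H J (t : R) :
  (forall H (t : R), 0 <= t ->
     \prod_(0 <= h < H) psi (t / (q%:R ^+ 2) ^+ h.+1) <= gprod k H (Num.truncn t)) ->
  0 <= t -> (2 * H <= J < n)%N ->
  riesz q n eps (t * (q ^ n)%:R) <= gprod k H (Num.truncn (t * q%:R ^+ (2 * H) / q%:R ^+ J)).
Proof.
move=> hk t0 /andP[HJ Jn].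
have qn0 m : q%:R ^+ m != 0 :> R by rewrite expf_neq0// gt_eqF.
apply: le_trans (hk _ _ _); last by rewrite divr_ge0 ?mulr_ge0 ?exprn_ge0.
rewrite /riesz big_nat_rev/= add0n.
apply: (@le_trans _ _ (\prod_(0 <= l < n) psi (t / q%:R ^+ l.+1))).
  rewrite le_eqVlt; apply/orP; left; apply/eqP; rewrite !big_mkord; apply: eq_bigr => l _.
  rewrite /psi; congr (normc (phi q eps _) / _).
  have e : q%:R ^+ n = q%:R ^+ (n - l.+1) * q%:R ^+ l.+1 :> R by rewrite -exprD subnK.
  by rewrite natrM !natrX e; field; rewrite !qn0.
apply: (le_trans (@prod_sub_le (fun l => psi (t / q%:R ^+ l.+1)) (J - 2 * H).+1 H n _ _)).
- by move=> l; exact: psi_bounds.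
- by lia.
rewrite le_eqVlt; apply/orP; left; apply/eqP; rewrite !big_mkord; apply: eq_bigr => h _.
congr psi; rewrite -exprM.
have -> : ((J - 2 * H).+1 + h * 2).+1 = (J - 2 * H + 2 * h.+1)%N by lia.
rewrite [in RHS](_ : J = (J - 2 * H) + 2 * H)%N; last by rewrite subnK.
by rewrite !exprD; field; rewrite !qn0.
Qed.

Lemma expr_lt_small (x e : R) : 0 <= x < 1 -> 0 < e -> exists H, x ^+ H < e.
Proof.
move=> /andP[x0 x1] e0.
have /cvgrPdist_lt/(_ e e0)[N _ /(_ N (leqnn N))] : x ^+ n @[n --> \oo] --> 0.
  by apply: cvg_expr; rewrite ger0_norm.
by rewrite /= sub0r normrN ger0_norm ?exprn_ge0// => h; exists N.
Qed.

Lemma log_mantissa (u n : nat) : (q ^ n <= u)%N -> exists J,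
  1 <= (u%:R / q%:R ^+ n / q%:R ^+ J : R) < q%:R.
Proof.
move=> qu; exists (trunc_log q (u %/ q ^ n)).
have qn : (0 < q ^ n)%N by rewrite expn_gt0 q0.
have d0 : (0 < u %/ q ^ n)%N by rewrite divn_gt0.
have /andP[t1 t2] := trunc_log_bounds q1 d0.
set J := trunc_log _ _ in t1 t2 *.
have p m : 0 < q%:R ^+ m :> R by rewrite exprn_gt0.
rewrite -mulrA -invfM -exprD ler_pdivlMr// ltr_pdivrMr// mul1r -exprS.
rewrite -!natrX ler_nat ltr_nat; move: t1 t2; rewrite leq_divRL// ltn_divLR//.
by rewrite -!expnD addSn (addnC J) => -> ->.
Qed.

(* Along u b^i the mantissas in base q equidistribute, uniformly in u, and the
   weights [gprod] are small on average. *)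
Lemma window_sum (b : nat) (e' : R) : (1 < b)%N -> ~ mult_dep b q -> 0 < e' ->
  exists (H : nat) (C : R), forall n u N, (0 < u)%N ->
  \sum_(0 <= i < N) (if (q ^ n * q ^ (2 * H + 2) <= u * b ^ i < q ^ n * q ^ n)%N
     then riesz q n eps (u * b ^ i)%:R else 0) <= e' * n%:R + C.
Proof.
move=> b1 bq e'0.
have [k /andP[k0 k1] hk] := prod_psi_le.
have qq4 : 4 <= (q * q)%:R :> R by rewrite ler_nat; nia.
pose g := (2 + ((q * q)%:R - 2) * k) / (q * q)%:R.
have g01 : 0 <= g < 1.
  have qq0 : 0 < (q * q)%:R :> R by rewrite (lt_le_trans _ qq4).
  by rewrite /g divr_ge0/= ?ltr_pdivrMr//; nra.
(* The window holds at most [q * n] frequencies and the counting below costs a factor [4 * q]; with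
   [g ^ H] below this quotient the total is at most [e' * n]. *)
have e40 : 0 < e' / (4 * q%:R ^+ 2) by rewrite divr_gt0// mulr_gt0// exprn_gt0.
have [H hH] := expr_lt_small g01 e40.
have p m : 0 < q%:R ^+ m :> R by rewrite exprn_gt0.
set Q2 : R := q%:R ^+ (2 * H).
have Q21 : 1 <= Q2 by rewrite exprn_ege1// ler1n.
(* For arcs of length [2 / Q2] this choice gives [(2 / Q2 + 3 * d) / (1 - d) <= 4 / Q2]. *)
pose d := (4 * Q2)^-1.
have d0 : 0 < d by rewrite invr_gt0 mulr_gt0// p.
have d4 : d <= 1 / 4.
  by rewrite /d mul1r lef_pV2 ?posrE ?mulr_gt0 ?p//; lra.
have [K K0 hK] : exists2 K : nat, (0 < K)%N & forall (I : eqType) (r : seq I) (P : pred I)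
    (x : I -> R) (s l B : R), 0 <= l -> 0 <= B ->
  (forall i, i \in r -> P i -> exists z : int, 0 <= x i - s + z%:~R <= l) ->
  (forall h, (0 < h < K)%N -> normc (\sum_(i <- r) cis (x i * h%:R)) <= B) ->
  (1 - d) * (count P r)%:R <= (l + 3 * d) * ((size r)%:R + K%:R * B).
  by apply: fejer_count; rewrite d0/=; lra.
have [B B0 hB] := @sum_rotation_bound R b q K b1 q1 bq.
exists H, (4 * q%:R * g ^+ H * (K%:R * B)) => n u N u0.
set X := (q ^ n * q ^ (2 * H + 2))%N.
have exX : exists i, (X <= u * b ^ i)%N.
  by exists X; rewrite (leq_trans (ltnW (ltn_expl X b1)))// leq_pmull.
have [i0 Xi0 i0min] := ex_minnP exX.
(* Between [q ^ n] and [q ^ (2 * n)] there are at most [q * n] terms, since the progression at least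
   doubles and [q <= 2 ^ q]. *)
set L := (q * n)%N.
have qn0 m : (0 < q ^ m)%N by rewrite expn_gt0 q0.
have q2e m : (q ^ m <= (2 ^ q) ^ m)%N.
  by case: m => // m; rewrite leq_exp2r// ltnW// ltn_expl.
have win i : (X <= u * b ^ i < q ^ n * q ^ n)%N -> (i0 <= i < i0 + L)%N.
  move=> /andP[x1 x2]; rewrite i0min//=.
  have i0i := i0min _ x1.
  have : (2 ^ (i - i0) * q ^ n < 2 ^ L * q ^ n)%N.
    apply: leq_ltn_trans (leq_trans x2 _); last first.
      rewrite leq_mul2r /L expnM; apply/orP; right.
      exact: q2e.
    have -> : (u * b ^ i = b ^ (i - i0) * (u * b ^ i0))%N.
      by rewrite mulnCA -expnD subnK.
    apply: leq_mul; first by case: (i - i0)%N => // m; rewrite leq_exp2r.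
    by rewrite (leq_trans _ Xi0)// /X leq_pmulr.
  by rewrite ltn_pmul2r// ltn_exp2l// ltn_subLR.
pose t i : R := (u * b ^ i)%:R / q%:R ^+ n.
have inr i : (i0 <= i)%N -> (q ^ n <= u * b ^ i)%N.
  move=> i0i; rewrite (leq_trans (_ : _ <= X)%N)// ?leq_pmulr// (leq_trans Xi0)//.
  by rewrite leq_mul2l leq_exp2l// i0i orbT.
pose J i : nat := xget 0%N [set J | 1 <= t i / q%:R ^+ J < q%:R].
have hJ i : (i0 <= i)%N -> 1 <= t i / q%:R ^+ J i < q%:R.
  move=> /inr/log_mantissa[j hj]; rewrite /J.
  by case: xgetP => [y _ //|/(_ j)/(_ hj)].
(* [y i] is the mantissa times [q ^ (2 * H)], so its integer part [a i] consists of the [2 * H + 1]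
   leading base-[q] digits of [t i]. *)
pose y i := t i * Q2 / q%:R ^+ J i.
pose a i := Num.truncn (y i).
have yE i : y i = t i / q%:R ^+ J i * Q2 by rewrite /y mulrAC.
have Q20 : 0 < Q2 by exact: p.
have hy i : (i0 <= i)%N -> Q2 <= y i < q%:R * Q2.
  by move=> /hJ/andP[j1 j2]; rewrite yE ltr_pM2r// j2 andbT ler_peMl// ltW.
have Q2n : Q2 = ((q * q) ^ H)%:R by rewrite /Q2 exprM expr2 -natrM -natrX.
have ha i : (i0 <= i)%N -> ((q * q) ^ H <= a i < q * (q * q) ^ H)%N.
  move=> /hy/andP[y1 y2]; have y0 : 0 <= y i by rewrite (le_trans _ y1)// ltW.
  rewrite /a truncn_ge_nat// -Q2n y1/= truncn_lt_nat// natrM -Q2n y2//.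
apply: (@le_trans _ _ (\sum_(i <- iota i0 L) gprod k H (a i))).
  apply: (@le_trans _ _ (\sum_(0 <= i < N | (i0 <= i < i0 + L)%N) gprod k H (a i))).
    rewrite [leRHS]big_mkcond /=; apply: ler_sum => i _.
    case: ifPn => [w|_]; last by case: ifP => // _; rewrite gprod_ge0// ltW.
    have := win i w; rewrite andbC => /andP[iL i0i]; rewrite iL i0i/=.
    have tq : (u * b ^ i)%:R = t i * (q ^ n)%:R by rewrite /t natrX mulfVK// gt_eqF// p.
    rewrite tq; apply: riesz_le => //; first by rewrite divr_ge0// ltW// p.
    have /andP[j1 j2] := hJ i i0i.
    move: w => /andP[w1 w2]; apply/andP; split.
      rewrite -ltnS -(ltr_eXn2l (_ : 1 < q%:R :> R)) ?ltr1n//.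
      apply: (@le_lt_trans _ _ (t i)); last by move: j2; rewrite ltr_pdivrMr ?p// -exprS.
      rewrite /t ler_pdivlMr ?p// -exprD -natrX ler_nat (leq_trans _ w1)//.
      by rewrite /X -expnD leq_exp2l// addnC leq_add2l leq_addr.
    rewrite -(ltr_eXn2l (_ : 1 < q%:R :> R)) ?ltr1n//.
    apply: (@le_lt_trans _ _ (t i)); first by move: j1; rewrite ler_pdivlMr ?p// mul1r.
    by rewrite /t ltr_pdivrMr ?p// -exprD -natrX ltr_nat expnD.
  rewrite -big_filter; apply: ler_sum_subset; rewrite ?filter_uniq ?iota_uniq//.
    by move=> i; rewrite mem_filter mem_iota => /andP[].
  by move=> i; rewrite gprod_ge0// ltW.
(* Modulo 1, [log_q (y i)] is a rotation in [i]. Leading digits equal to [c] put it into an arc that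
   starts at [log_q c] and has length at most [2 / Q2]. *)
have count_a c : (c < q * (q * q) ^ H)%N ->
    (count (fun i => a i == c) (iota i0 L))%:R <= 4 / Q2 * (L%:R + K%:R * B).
  move=> cH; have lq := @ln_nat_gt0 R q q1.
  have d1 : 0 < 1 - d by lra.
  rewrite -(ler_pM2l d1).
  have := @hK _ (iota i0 L) (fun i => a i == c)
    (fun i => ln (u%:R / q%:R ^+ n) / ln q%:R + i%:R * (ln b%:R / ln q%:R)) (ln c%:R / ln q%:R) (2 / Q2) B.
  rewrite size_iota => h; apply: (le_trans (h _ B0 _ (fun h => hB _ i0 L h))).
  - by rewrite divr_ge0// ltW.
  - move=> i; rewrite mem_iota => /andP[i0i _] /eqP ac.
    exists (2 * H%:Z - (J i)%:Z).
    have /andP[a1 _] := ha i i0i; rewrite ac in a1.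
    have /andP[y1 y2] := hy i i0i.
    have y0 : 0 < y i by exact: lt_le_trans y1.
    have /andP[] := truncn_itv (ltW y0); rewrite -/(a i) ac -natr1 => c1 c2.
    have c0 : 0 < c%:R :> R by rewrite (lt_le_trans Q20)// Q2n ler_nat.
    have cQ : Q2 <= c%:R by rewrite Q2n ler_nat.
    have lnq m : ln (q%:R ^+ m : R) = m%:R * ln q%:R.
      by rewrite lnXn// -[LHS]mulr_natl.
    have ly : ln (y i) = ln (u%:R / q%:R ^+ n) + i%:R * ln b%:R + (2 * H%:Z - (J i)%:Z)%:~R * ln q%:R.
      have u0' : 0 < u%:R / q%:R ^+ n :> R by rewrite divr_gt0 ?ltr0n.
      have b0 : 0 < b%:R :> R by rewrite ltr0n ltnW.
      have -> : y i = u%:R / q%:R ^+ n * b%:R ^+ i * q%:R ^+ (2 * H) / q%:R ^+ J i.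
        by rewrite /y /t /Q2 natrM natrX; congr (_ * _ / _); rewrite mulrAC.
      have p1 : 0 < b%:R ^+ i :> R by rewrite exprn_gt0.
      have p2 := mulr_gt0 u0' p1; have p3 := mulr_gt0 p2 (p (2 * H)%N).
      rewrite ln_div ?posrE ?p//= (lnM _ _) ?posrE ?p//= (lnM _ _) ?posrE//= !lnq lnXn// -[ln b%:R *+ i]mulr_natl.
      by rewrite intrB intrM natrM -!pmulrn; ring.
    have -> : ln (u%:R / q%:R ^+ n) / ln q%:R + i%:R * (ln b%:R / ln q%:R) - ln c%:R / ln q%:R +
       (2 * H%:Z - (J i)%:Z)%:~R = (ln (y i) - ln c%:R) / ln q%:R.
      by rewrite ly; field; rewrite gt_eqF.
    rewrite -ln_div ?posrE//; apply/andP; split.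
      by rewrite divr_ge0 ?(ltW lq)// ln_ge0// ler_pdivlMr// mul1r.
    rewrite ler_pdivrMr//.
    apply: (@le_trans _ _ (c%:R^-1)).
      have -> : y i / c%:R = 1 + (y i - c%:R) / c%:R by field; rewrite gt_eqF.
      have w0 : 0 <= (y i - c%:R) / c%:R by rewrite divr_ge0 ?subr_ge0// ltW.
      rewrite (le_trans (le_ln1Dx _))//; first by rewrite (lt_le_trans _ w0).
      by rewrite ler_pdivrMr// mulVf ?gt_eqF//; lra.
    have lq2 : 1 / 2 <= ln (q%:R : R).
      by rewrite (le_trans ln2_ge)// ler_ln ?posrE// ler_nat.
    apply: (@le_trans _ _ Q2^-1); first by rewrite lef_pV2.
    rewrite mulrAC ler_peMl ?invr_ge0 ?(ltW Q20)//; lra.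
  rewrite mulrA ler_wpM2r//.
    by rewrite addr_ge0// mulr_ge0.
  have -> : 3 * d = 3 / 4 / Q2 by rewrite /d; field; rewrite gt_eqF.
  have := d4; have : 0 < Q2^-1 by rewrite invr_gt0.
  move=> ? ?; nra.
apply: (@le_trans _ _ (\sum_(0 <= c < q * (q * q) ^ H) gprod k H c * (4 / Q2 * (L%:R + K%:R * B)))).
  apply: (@le_trans _ _ (\sum_(0 <= c < q * (q * q) ^ H) gprod k H c *
      (count (fun i => a i == c) (iota i0 L))%:R)); last first.
    by apply: ler_sum_nat_lt => c cH; rewrite ler_wpM2l ?count_a// gprod_ge0// ltW.
  under [leRHS]eq_bigr do rewrite -sum1_count natr_sum big_distrr /= big_mkcond /=.
  rewrite exchange_big /= big_seq [leRHS]big_seq; apply: ler_sum => i.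
  rewrite mem_iota => /andP[i0i _]; have /andP[_ aH] := ha i i0i.
  rewrite big_mkord (bigD1 (Ordinal aH))//= eqxx mulr1 lerDl.
  by apply: sumr_ge0 => c _; case: ifP => // _; rewrite mulr1 gprod_ge0// ltW.
rewrite -big_distrl /= sum_gprod.
have -> : q%:R * (2 + ((q * q)%:R - 2) * k) ^+ H * (4 / Q2 * (L%:R + K%:R * B)) =
    4 * q%:R * g ^+ H * (L%:R + K%:R * B).
  rewrite /g expr_div_n Q2n natrX; field.
  by rewrite expf_neq0// gt_eqF// (lt_le_trans _ qq4).
rewrite mulrDr lerD2r /L natrM.
rewrite [leLHS](_ : _ = g ^+ H * (4 * q%:R ^+ 2) * n%:R); last by ring.
by rewrite ler_wpM2r// -ler_pdivlMr ?mulr_gt0 ?exprn_gt0// ltW.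
Qed.

End window.

(** Frequencies below [2 ^ a], or within a fixed factor above [q ^ n], are boundedly many; from
    [2 ^ a] to [q ^ n] and beyond [q ^ (2 * n)] the bounds form geometric sums. Only the range of
    [window_sum] costs a multiple of [n], so [n0] can be chosen before the density, [u] and [N]. *)
Lemma stage_sum (R : realType) (q b a : nat) (eps e' : R) :
  (1 < q)%N -> 0 < eps -> eps < 1 -> (1 < b)%N -> ~ mult_dep b q -> 0 < e' ->
  exists n0 : nat, forall n, (n0 <= n)%N ->
  forall (Q T : nat) (D : R) (rho : nat -> R), (0 < Q)%N -> (0 < T)%N ->
  (forall c, 0 <= rho c <= D) -> \sum_(0 <= c < Q) rho c = Q%:R ->
  D * Q%:R <= 2 ^+ a ->
  forall u N, (0 < u)%N ->
  \sum_(0 <= i < N) nfour (Q * (q ^ n * q ^ n)) (next q n Q T eps rho) (u * b ^ i)%:R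
    <= e' * n%:R.
Proof.
move=> q1 eps0 eps1 b1 bq e'0.
have [H [C hC]] := window_sum q1 eps0 eps1 b1 bq (divr_gt0 e'0 (ltr0n _ 2)).
pose cst : R := a%:R + 2 + 32 + (q * (2 * H + 2))%:R + 2 + 2 + C.
exists (Num.truncn (2 * cst / e')).+1 => n n0 Q T D rho Q0 T0 rhoD rhoQ DQ u N u0.
have cn : cst <= e' / 2 * n%:R.
  have : 2 * cst / e' < n%:R.
    by rewrite (lt_le_trans (truncnS_gt _))// ler_nat.
  by rewrite ltr_pdivrMr// => h; lra.
have q0 : (0 < q)%N by exact: ltnW.
pose x i : R := (u * b ^ i)%:R.
have x0 : 0 < x 0%N by rewrite ltr0n muln_gt0 u0.
have x2 i : 2 * x i <= x i.+1.
  by rewrite /x -natrM ler_nat expnS [leqRHS]mulnCA leq_mul2r b1 orbT.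
have xp i : 0 < x i by have [] := doubling_ge x0 x2 i 0.
have x1 i : 1 <= x i by rewrite ler1n muln_gt0 u0 expn_gt0 ltnW.
set M : R := (q ^ n)%:R.
have M0 : 0 < M by rewrite ltr0n expn_gt0 q0.
set A : R := 2 ^+ a.
have A0 : 0 < A by rewrite exprn_gt0.
set Wl := (q ^ (2 * H + 2))%N.
pose f1 i : R := if 1 <= x i < 1 * 2 ^+ a then 1 else 0.
pose f2 i : R := if A <= x i then A / x i else 0.
pose f3 i : R := if x i <= M then x i / M else 0.
pose f4 i : R := if M <= x i < M * 2 ^+ (q * (2 * H + 2)) then 1 else 0.
pose f5 i : R := if M <= x i then M / x i else 0.
pose f6 i : R := if M * M <= x i then (M * M) / x i else 0.
pose f7 i : R := if (q ^ n * Wl <= u * b ^ i < q ^ n * q ^ n)%N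
  then riesz q n eps (u * b ^ i)%:R else 0.
pose F i : R := f1 i + f2 i + 4 * pi * f3 i + f4 i + f5 i + f6 i + f7 i.
have hpi := pi_gt0 R.
have MM0 : 0 < M * M by rewrite mulr_gt0.
have Wle : Wl%:R <= 2 ^+ (q * (2 * H + 2)) :> R.
  by rewrite exprM natrX lerXn2r ?nnegrE ?exprn_ge0// -natrX ler_nat ltnW// ltn_expl.
apply: (@le_trans _ _ (\sum_(0 <= i < N) F i)); last first.
  have p4 : pi <= 4 :> R by have := @pihalf_lt2 R; lra.
  rewrite /F !big_split /= -big_distrr /=.
  have s1 : \sum_(0 <= i < N) f1 i <= a%:R by apply: sum_geo_count.
  have s2 : \sum_(0 <= i < N) f2 i <= 2 by apply: sum_geo_high.
  have s3 : \sum_(0 <= i < N) f3 i <= 2 by apply: sum_geo_low.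
  have s4 : \sum_(0 <= i < N) f4 i <= (q * (2 * H + 2))%:R by apply: sum_geo_count.
  have s5 : \sum_(0 <= i < N) f5 i <= 2 by apply: sum_geo_high.
  have s6 : \sum_(0 <= i < N) f6 i <= 2 by apply: sum_geo_high.
  have s7 : \sum_(0 <= i < N) f7 i <= e' / 2 * n%:R + C by apply: hC.
  have s3' : 4 * pi * \sum_(0 <= i < N) f3 i <= 32.
    have s0 : 0 <= \sum_(0 <= i < N) f3 i.
      by apply: sumr_ge0 => i _; rewrite /f3; case: ifP => // _; rewrite divr_ge0// ltW.
    nra.
  move: cn; rewrite /cst; lra.
apply: ler_sum => i _.
have nx := nfour_next_riesz n q1 Q0 T0 eps0 eps1 rhoD rhoQ (xp i).
have nh := nfour_next_high n q1 Q0 T0 eps0 eps1 rhoD rhoQ (xp i).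
have nl := nfour_next_low n q1 Q0 T0 eps0 eps1 rhoD rhoQ (xp i).
have nd : nfour Q rho (x i) <= A / x i.
  by rewrite (le_trans (nfour_decay _ (xp i) rhoD))// ler_wpM2r// invr_ge0 ltW.
have n1 : nfour (Q * (q ^ n * q ^ n)) (next q n Q T eps rho) (x i) <= 1.
  apply: nfour_le1 => //; first by rewrite !muln_gt0 Q0 expn_gt0 q0.
    by move=> c; have /andP[] := next_bounds q n Q T0 eps0 eps1 rhoD c.
  rewrite sum_nat_mulD (@eq_sum_nat_lt _ _ _ (fun c => (q ^ n * q ^ n)%:R * rho c)).
    by rewrite -big_distrr /= rhoQ -natrM mulnC.
  by move=> c cQ; exact: sum_next.
rewrite -/(x i) in nx nh nl nd n1 *.
have t1 : 0 <= f1 i by rewrite /f1; case: ifP.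
have t2 : 0 <= f2 i by rewrite /f2; case: ifP => // _; rewrite divr_ge0// ltW.
have t3 : 0 <= 4 * pi * f3 i.
  by rewrite /f3 mulr_ge0 ?mulr_ge0 ?(ltW hpi)//; case: ifP => // _; rewrite divr_ge0// ltW.
have t4 : 0 <= f4 i by rewrite /f4; case: ifP.
have t5 : 0 <= f5 i by rewrite /f5; case: ifP => // _; rewrite divr_ge0// ltW.
have t6 : 0 <= f6 i by rewrite /f6; case: ifP => // _; rewrite divr_ge0// ltW.
have t7 : 0 <= f7 i.
  by rewrite /f7; case: ifP => // _; have /andP[] := riesz_bounds n q1 eps0 eps1 (x i).
rewrite /F.
have [xA|Ax] := ltP (x i) A.
  have e1 : f1 i = 1 by rewrite /f1 x1 mul1r xA.
  lra.
have e2 : f2 i = A / x i by rewrite /f2 Ax.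
have [xM|Mx] := leP (x i) M.
  have e3 : f3 i = x i / M by rewrite /f3 xM.
  have e : 4 * pi * x i / M = 4 * pi * f3 i by rewrite e3 mulrA.
  rewrite -/M e in nl; lra.
have [xW|Wx] := ltnP (u * b ^ i) (q ^ n * Wl).
  have e4 : f4 i = 1.
    rewrite /f4 ifT// (ltW Mx)/= (lt_le_trans (_ : _ < M * Wl%:R))//.
      by rewrite -natrM ltr_nat.
    by rewrite ler_pM2l.
  lra.
have e5 : f5 i = M / x i by rewrite /f5 (ltW Mx).
have [xMM|MMx] := ltnP (u * b ^ i) (q ^ n * q ^ n).
  have e7 : f7 i = riesz q n eps (x i) by rewrite /f7 Wx xMM.
  rewrite -/M in nx; lra.
have e6 : f6 i = M * M / x i.
  by rewrite /f6 ifT// /M /x -natrM ler_nat.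
rewrite natrM -/M in nh; lra.
Qed.

(** * The limit measure and its Fourier transform *)

Section grid_measure.
Context {R : realType} (Q m : nat -> nat) (rho : nat -> nat -> R).
Hypotheses (Q0 : forall k, (0 < Q k)%N) (QS : forall k, Q k.+1 = (Q k * m k)%N).
Hypotheses (rho0 : forall k a, 0 <= rho k a)
  (rho1 : \sum_(0 <= a < Q 0) rho 0%N a = (Q 0)%:R).
Hypothesis rhoS : forall k a, (a < Q k)%N ->
  \sum_(0 <= i < m k) rho k.+1 (a * m k + i)%N = (m k)%:R * rho k a.
Hypothesis rho_small : forall e : R, 0 < e ->
  exists k, forall a, (a < Q k)%N -> rho k a / (Q k)%:R <= e.

Let QR0 k : 0 < (Q k)%:R :> R. Proof. by rewrite ltr0n. Qed.
Let m0 k : (0 < m k)%N. Proof. by have := Q0 k.+1; rewrite QS muln_gt0 => /andP[]. Qed.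

(** Distribution function at the grid points. The cap at [Q k] keeps it equal to 1 to the right of
    1. *)
Definition cum (k a : nat) : R := \sum_(0 <= i < minn a (Q k)) rho k i / (Q k)%:R.

Let cum_mono k a b : (a <= b)%N -> cum k a <= cum k b.
Proof.
move=> ab; rewrite /cum [leRHS](@big_cat_nat _ _ _ (minn a (Q k)))//=.
  by rewrite lerDl sumr_ge0// => i _; rewrite divr_ge0.
by rewrite leq_min geq_minr andbT (leq_trans (geq_minl _ _)).
Qed.

Let cumS k a : (a <= Q k)%N -> cum k.+1 (a * m k) = cum k a.
Proof.
move=> aQ; rewrite /cum QS -minnMl (minn_idPl aQ) sum_nat_mulD.
apply: eq_sum_nat_lt => i ia; rewrite -big_distrl /= rhoS; last exact: leq_trans ia aQ.
rewrite natrM; field; rewrite !gt_eqF//= ltr0n//.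
Qed.

Let cum0 k : cum k 0 = 0.
Proof. by rewrite /cum min0n big_nil. Qed.

Let cum_full k : cum k (Q k) = 1.
Proof.
elim: k => [|k IHk]; last by rewrite QS cumS.
by rewrite /cum minnn -big_distrl /= rho1 divff// gt_eqF.
Qed.

Let cum_le1 k a : cum k a <= 1.
Proof.
rewrite -(cum_full k) (_ : cum k a = cum k (minn a (Q k))); last by rewrite /cum -minnA minnn.
by apply: cum_mono; rewrite geq_minr.
Qed.

Let cum_ge0 k a : 0 <= cum k a.
Proof. by rewrite -(cum0 k) cum_mono. Qed.

Let G k (x : R) := cum k (Num.truncn (x * (Q k)%:R)).

Let ratio k j : (k <= j)%N -> exists2 r, (0 < r)%N & Q j = (Q k * r)%N /\
  forall a, (a <= Q k)%N -> cum j (a * r) = cum k a.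
Proof.
move=> /subnKC <-; elim: (j - k)%N => [|d [r r0 [Qr hr]]].
  by exists 1%N => //; rewrite addn0 muln1; split => // a _; rewrite muln1.
exists (r * m (k + d))%N; first by rewrite muln_gt0 r0 m0.
rewrite addnS QS Qr mulnA; split => // a aQ; rewrite mulnA cumS ?hr//.
by rewrite Qr leq_mul2r aQ orbT.
Qed.

Let cum_min k a : cum k a = cum k (minn a (Q k)).
Proof. by rewrite /cum -minnA minnn. Qed.

Let G_mono j k x : (j <= k)%N -> G j x <= G k x.
Proof.
move=> /ratio[r r0 [Qr hr]].
rewrite /G; set a := Num.truncn _.
have [->|a0] := posnP a; first by rewrite cum0.
rewrite (cum_min j) -hr ?geq_minr//.
apply: (@le_trans _ _ (cum k (a * r))).
  by apply: cum_mono; rewrite leq_mul2r geq_minl orbT.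
apply: cum_mono.
have x0 : 0 <= x * (Q j)%:R.
  rewrite leNgt; apply/negP => xn; move: a0; rewrite /a lt0n => /eqP; apply.
  by apply/truncn0Pn; rewrite -ltNge (lt_trans xn).
have := truncn_itv x0; rewrite -/a => /andP[ax _].
by rewrite Qr natrM mulrA truncn_ge_nat ?(mulr_ge0 x0)// natrM ler_wpM2r.
Qed.

Let G_le k j x : G j x <= cum k (Num.truncn (x * (Q k)%:R)).+1.
Proof.
have up k' : (k <= k')%N -> G k' x <= cum k (Num.truncn (x * (Q k)%:R)).+1.
  move=> /ratio[r r0 [Qr hr]].
  rewrite (cum_min k) -hr ?geq_minr// minnMl -Qr -cum_min.
  apply: cum_mono; rewrite truncn_le_nat Qr natrM mulrA.
  rewrite -natr1 (lt_le_trans (_ : _ < ((Num.truncn (x * (Q k)%:R)).+1 * r)%:R))//.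
    by rewrite natrM ltr_pM2r ?ltr0n// truncnS_gt.
  by rewrite lerDl.
have [/up//|jk] := leqP k j.
by rewrite (le_trans (G_mono x (ltnW jk)))// up.
Qed.

(** For [x >= 0], [G k x] is the distribution function at the last grid point of level [k] up to
    [x]. It is nondecreasing in [k], so the supremum is the limit. *)
Definition cdf (x : R) : R := sup [set G k x | k in setT].

Let G_le1 k x : G k x <= 1. Proof. exact: cum_le1. Qed.

Let le_cdf k x : G k x <= cdf x.
Proof.
apply: ub_le_sup; last by exists k.
by exists 1 => _ [j _ <-]; exact: G_le1.
Qed.

Let cdf_le x (c : R) : (forall k, G k x <= c) -> cdf x <= c.
Proof.
move=> h; apply: ge_sup; first by exists (G 0 x), 0%N.
by move=> _ [k _ <-].
Qed.

Let cdf_grid k a : (a <= Q k)%N -> cdf (a%:R / (Q k)%:R) = cum k a.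
Proof.
move=> aQ; have e : G k (a%:R / (Q k)%:R) = cum k a.
  by rewrite /G mulfVK ?gt_eqF// natrK.
apply/eqP; rewrite eq_le; apply/andP; split; last by rewrite -e le_cdf.
apply: cdf_le => j.
have [/ratio[r r0 [Qr hr]]|jk] := leqP k j; last by rewrite -e G_mono// ltnW.
rewrite /G Qr natrM mulrA mulfVK ?gt_eqF// -natrM natrK hr//.
Qed.

Let cdf_nd : nondecreasing cdf.
Proof.
move=> x y xy; apply: cdf_le => k; apply: le_trans (le_cdf k y).
by apply: cum_mono; apply: le_truncn; rewrite ler_wpM2r.
Qed.

Let cum_succ k a (e : R) : 0 <= e -> (forall a, (a < Q k)%N -> rho k a / (Q k)%:R <= e) ->
  cum k a.+1 <= cum k a + e.
Proof.
move=> e0 h; have [aQ|Qa] := ltnP a (Q k); last first.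
  by rewrite (cum_min k a.+1) (cum_min k a) !(minn_idPr _) ?lerDl// ltnW.
rewrite /cum (minn_idPl aQ) (minn_idPl (ltnW aQ)) big_nat_recr//= lerD2l.
exact: h.
Qed.

(** Going from [x] to [y] crosses at most two cells of level [k], each of mass at most [e]. *)
Let cdf_modulus k (e x y : R) : 0 <= e -> (forall a, (a < Q k)%N -> rho k a / (Q k)%:R <= e) ->
  y <= x + (Q k)%:R^-1 -> cdf y <= cdf x + 2 * e.
Proof.
move=> e0 h yx.
apply: (@le_trans _ _ (cum k (Num.truncn (x * (Q k)%:R)).+2)).
  apply: cdf_le => j; apply: (le_trans (G_le k j y)); apply: cum_mono.
  rewrite ltnS truncn_le_nat.
  apply: (@le_lt_trans _ _ (x * (Q k)%:R + 1)).
    by rewrite (le_trans (ler_wpM2r (ltW (QR0 k)) yx))// mulrDl mulVf ?gt_eqF.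
  by rewrite -natr1 ltrD2r truncnS_gt.
rewrite (le_trans (cum_succ _ e0 h))// mulr_natl mulr2n addrA lerD2r.
by rewrite (le_trans (cum_succ _ e0 h))// lerD2r le_cdf.
Qed.

Let cdf_cont : continuous cdf.
Proof.
move=> x; apply/cvgrPdist_le => /= e e0.
have e20 : 0 < e / 2 by rewrite divr_gt0.
have [k hk] := rho_small e20.
have Qi : 0 < (Q k)%:R^-1 :> R by rewrite invr_gt0.
exists (Q k)%:R^-1 => //= y; rewrite /ball /= => xy.
have h1 := @cdf_modulus k (e / 2) x y (ltW e20) hk.
have h2 := @cdf_modulus k (e / 2) y x (ltW e20) hk.
move: xy; rewrite ltr_distl => /andP[y1 y2].
have {}h1 : cdf y <= cdf x + 2 * (e / 2) by apply: h1; lra.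
have {}h2 : cdf x <= cdf y + 2 * (e / 2) by apply: h2; lra.
rewrite ler_distl; apply/andP; split; lra.
Qed.

Let cdf_neg x : x <= 0 -> cdf x = 0.
Proof.
move=> x0; apply/eqP; rewrite eq_le; apply/andP; split.
  apply: cdf_le => k; rewrite /G (_ : Num.truncn _ = 0%N) ?cum0//.
  by apply/truncn0Pn; rewrite -ltNge (le_lt_trans _ (@ltr01 R))// pmulr_lle0.
by apply: le_trans (le_cdf 0 x); exact: cum_ge0.
Qed.

Let cdf_big x : 1 <= x -> cdf x = 1.
Proof.
move=> x1; apply/eqP; rewrite eq_le; apply/andP; split.
  by apply: cdf_le => k; exact: G_le1.
apply: le_trans (le_cdf 0 x); rewrite -(cum_full 0); apply: cum_mono.
by rewrite truncn_ge_nat ?ler_peMl// mulr_ge0// (le_trans ler01).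
Qed.

(** The Lebesgue-Stieltjes measure of [cdf]. Its construction gives the mass of intervals open on
    the left; [rho_small] excludes atoms, so the end points may be exchanged. *)
Lemma grid_measure : exists mu : probability (measurableTypeR R) R,
  forall k a, (a < Q k)%N ->
  mu `[a%:R / (Q k)%:R, a.+1%:R / (Q k)%:R[%classic = (rho k a / (Q k)%:R)%:E.
Proof.
have cm := isCumulative.Build R _ R cdf cdf_nd (right_continuousW cdf_cont).
have c0 : cdf x @[x --> -oo] --> (0 : R).
  by apply: cvg_near_cst; exists 0; split => // x /ltW; exact: cdf_neg.
have c1 : cdf x @[x --> +oo] --> (1 : R).
  by apply: cvg_near_cst; exists 1; split => // x /ltW; exact: cdf_big.
have cb := isCumulativeBounded.Build R 0 1 cdf c0 c1.
pose F : cumulativeBounded (0:R) (1:R) := HB.pack cdf cm cb.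
pose mu : probability (measurableTypeR R) R := lebesgue_stieltjes_measure F.
have mu_oc (a b : R) : a <= b -> mu `]a, b]%classic = (cdf b - cdf a)%:E.
  move=> ab; rewrite /mu /= /lebesgue_stieltjes_measure /measure_extension.
  by rewrite measurable_mu_extE/=; [rewrite wlength_itv_bnd|exact: is_ocitv].
have mu1 (x : R) : mu [set x] = 0%E.
  apply/eqP; rewrite eq_le measure_ge0 andbT; apply/lee_addgt0Pr => e e0.
  have e20 : 0 < e / 2 by rewrite divr_gt0.
  have [k hk] := rho_small e20.
  have Qi : 0 < (Q k)%:R^-1 :> R by rewrite invr_gt0.
  have xx : x - (Q k)%:R^-1 <= x by lra.
  apply: (@le_trans _ _ (mu `](x - (Q k)%:R^-1), x]%classic)).
    apply: le_measure; rewrite ?inE//.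
    by move=> _ ->; rewrite /= in_itv/= lexx andbT ltrBlDr ltrDl.
  rewrite mu_oc// add0e lee_fin.
  have := @cdf_modulus k (e / 2) (x - (Q k)%:R^-1) x (ltW e20) hk.
  by rewrite subrK lexx => /(_ isT); lra.
exists mu => k a aQ; set x := _ / _; set y := _ / _.
have xy : x < y by rewrite ltr_pM2r ?invr_gt0// ltr_nat.
have e1 : mu `[x, y[%classic = mu `]x, y[%classic.
  rewrite -(@setU1itv _ _ _ x false) ?bnd_simp// measureU//; first by rewrite -[X in (X + _)%E]/(mu [set x]) mu1 add0e.
  by apply/seteqP; split => // z [/= ->]; rewrite in_itv/= ltxx.
have e2 : mu `]x, y]%classic = mu `]x, y[%classic.
  rewrite -(@setUitv1 _ _ _ y true) ?bnd_simp// measureU//; first by rewrite -[X in (_ + X)%E]/(mu [set y]) mu1 adde0.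
  by apply/seteqP; split => // z [/= + zy]; rewrite zy in_itv/= ltxx andbF.
rewrite e1 -e2 mu_oc ?ltW// /x /y !cdf_grid ?(ltnW aQ)//.
rewrite /cum (minn_idPl aQ) (minn_idPl (ltnW aQ)) big_nat_recr//=.
by rewrite addrAC subrr add0r.
Qed.

End grid_measure.

Section fourier_transform.
Context {R : realType} (mu : probability (measurableTypeR R) R).

Definition mhat (xi : R) : R[i] :=
  Complex (Rintegral mu `[0, 1[%classic (fun x => cos (2 * pi * xi * x)))
          (Rintegral mu `[0, 1[%classic (fun x => sin (2 * pi * xi * x))).

Lemma measurable_trig (g : R -> R) (xi : R) : continuous g ->
  measurable_fun setT (fun x : measurableTypeR R => g (2 * pi * xi * x)).
Proof.
move=> cg; apply: continuous_measurable_fun => x.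
apply: (@continuous_comp _ _ _ (fun x => 2 * pi * xi * x) g); last exact: cg.
by apply: mulrl_continuous.
Qed.

Lemma integrable_bounded (A : set (measurableTypeR R)) (f : measurableTypeR R -> R) (c : R) :
  measurable A -> measurable_fun setT f -> (forall x, `|f x| <= c) ->
  mu.-integrable A (EFin \o f).
Proof.
move=> mA mf fc; apply: measurable_bounded_integrable => //.
- by rewrite (le_lt_trans (probability_le1 _ mA))// ltry.
- exact: measurable_funTS.
- exists c; split; first exact: num_real.
  by move=> M cM x _ /=; rewrite (le_trans (fc x))// ltW.
Qed.

Lemma integrable_cos xi (A : set (measurableTypeR R)) : measurable A ->
  mu.-integrable A (EFin \o (fun x => cos (2 * pi * xi * x))).
Proof.
move=> mA; apply: (@integrable_bounded _ _ 1) => //.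
  by apply: measurable_trig; exact: continuous_cos.
by move=> x; exact: cos_max.
Qed.

Lemma integrable_sin xi (A : set (measurableTypeR R)) : measurable A ->
  mu.-integrable A (EFin \o (fun x => sin (2 * pi * xi * x))).
Proof.
move=> mA; apply: (@integrable_bounded _ _ 1) => //.
  by apply: measurable_trig; exact: continuous_sin.
by move=> x; exact: sin_max.
Qed.

Lemma normc_fourier_coef (n : int) : normc (fourier_coef mu n) = normc (mhat (`|n|%N)%:R).
Proof.
have -> : fourier_coef mu n = Complex (complex.Re (mhat n%:~R)) (- complex.Im (mhat n%:~R)).
  by [].
have nN (z : R[i]) : normc (Complex (complex.Re z) (- complex.Im z)) = normc z.
  by case: z => a b; rewrite /normc /= sqrrN.
rewrite nN; case: n => n //.
have -> : mhat (Negz n)%:~R = Complex (complex.Re (mhat n.+1%:R)) (- complex.Im (mhat n.+1%:R)).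
  rewrite NegzE /mhat /=; congr Complex.
    by apply: eq_Rintegral => x _; rewrite -[RHS]cosN; congr cos; rewrite mulrNz; ring.
  rewrite -[RHS]mulN1r -RintegralZl//; last exact: integrable_sin.
  apply: eq_Rintegral => x _; rewrite mulN1r -sinN; congr sin; rewrite mulrNz; ring.
by rewrite nN.
Qed.

End fourier_transform.

Section grid_probability.
Context {R : realType} (mu : probability (measurableTypeR R) R) (Q : nat) (rho : nat -> R).
Hypotheses (Q0 : (0 < Q)%N) (rhoQ : \sum_(0 <= a < Q) rho a = Q%:R).
Hypothesis muQ : forall a, (a < Q)%N ->
  mu `[a%:R / Q%:R, a.+1%:R / Q%:R[%classic = (rho a / Q%:R)%:E.

Let QR0 : 0 < Q%:R :> R. Proof. by rewrite ltr0n. Qed.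

Let in_cell (a : nat) (x : R) :
  (a%:R / Q%:R <= x < a.+1%:R / Q%:R) = ((0 <= x) && (Num.truncn (x * Q%:R) == a)).
Proof.
rewrite ler_pdivrMr// ltr_pdivlMr//; apply/idP/andP.
  move=> h; have x0 : 0 <= x * Q%:R by case/andP: h => h _; exact: le_trans h.
  by rewrite truncn_eq// h; rewrite pmulr_lge0 in x0.
by move=> [x0]; rewrite truncn_eq// mulr_ge0.
Qed.

Let cells (g : nat -> bool) (N : nat) : set (measurableTypeR R) :=
  [set x | (0 <= x) && (x < N%:R / Q%:R) && g (Num.truncn (x * Q%:R))].

Let cellsS g N : cells g N.+1 =
  cells g N `|` (if g N then `[N%:R / Q%:R, N.+1%:R / Q%:R[%classic else set0).
Proof.
apply/seteqP; split => x /=; rewrite /cells /=.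
  move=> /andP[/andP[x0 xN] gx]; have [xl|xl] := ltP x (N%:R / Q%:R).
    by left; rewrite x0.
  right; have := in_cell N x; rewrite xl xN x0/= => /esym/eqP e.
  by rewrite -{1}e gx /= in_itv/= xl xN.
move=> [/andP[/andP[-> xN] ->]|].
  by rewrite (lt_trans xN)// ltr_pM2r ?invr_gt0// ltr_nat.
case: ifP => //= gN; rewrite in_itv/= in_cell => /andP[x0 /eqP e].
by have := in_cell N x; rewrite x0 e eqxx => /andP[_ ->]; rewrite gN.
Qed.

Let measurable_cells g N : measurable (cells g N).
Proof.
elim: N => [|N IHN].
  rewrite (_ : cells g 0 = set0)//; apply/seteqP; split => x //=.
  by rewrite /cells /= mul0r => /andP[/andP[x0 +] _]; rewrite ltNge x0.
by rewrite cellsS; apply: measurableU => //; case: ifP.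
Qed.

Let mu_cells g N : (N <= Q)%N ->
  mu (cells g N) = (\sum_(0 <= a < N | g a) rho a / Q%:R)%:E.
Proof.
elim: N => [_|N IHN NQ].
  rewrite big_nil (_ : cells g 0 = set0) ?measure0//; apply/seteqP; split => x //=.
  by rewrite /cells /= mul0r => /andP[/andP[x0 +] _]; rewrite ltNge x0.
rewrite cellsS; set J := if _ then _ else _.
have mJ : measurable J by rewrite /J; case: ifP.
have -> : mu (cells g N `|` J) = (mu (cells g N) + mu J)%E.
  apply: measureU => //; apply/seteqP; split => x //=; rewrite /cells/J/=.
  by move=> [/andP[/andP[x0 xN] _]]; case: ifP => //= _; rewrite in_itv/= leNgt xN.
rewrite (IHN (ltnW NQ)) big_mkcond [in RHS]big_mkcond big_nat_recr//= EFinD; congr (_ + _)%E.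
rewrite /J.
by case: ifP => gN; [rewrite muQ|rewrite measure0].
Qed.

Lemma measurable_grid (g : nat -> bool) :
  measurable ([set x | (0 <= x < 1) && g (Num.truncn (x * Q%:R))] : set (measurableTypeR R)).
Proof.
have := measurable_cells g Q; rewrite /cells; congr measurable.
by apply/seteqP; split => x /=; rewrite divff ?gt_eqF.
Qed.

Lemma mu_grid (g : nat -> bool) :
  mu [set x | (0 <= x < 1) && g (Num.truncn (x * Q%:R))] =
  (\sum_(0 <= a < Q | g a) rho a / Q%:R)%:E.
Proof.
rewrite -mu_cells//; congr (mu _).
by apply/seteqP; split => x /=; rewrite /cells /= divff ?gt_eqF.
Qed.

Lemma mu_grid01 : mu `[0, 1[%classic = 1%E.
Proof.
have := mu_grid xpredT; rewrite -big_distrl /= rhoQ divff ?gt_eqF// => <-; congr (mu _).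
by apply/seteqP; split => x /=; rewrite in_itv/= andbT.
Qed.

Lemma mu_grid_itv (c d : nat) : (c <= d <= Q)%N ->
  mu `[c%:R / Q%:R, d%:R / Q%:R[%classic = (\sum_(c <= a < d) rho a / Q%:R)%:E.
Proof.
move=> /andP[cd dQ].
have -> : `[c%:R / Q%:R, d%:R / Q%:R[%classic = cells (fun a => c <= a)%N d.
  apply/seteqP; split => x /=; rewrite in_itv/= /cells/=.
    move=> /andP[cx xd]; have x0 : 0 <= x by rewrite (le_trans _ cx)// divr_ge0.
    by rewrite x0 xd/= truncn_ge_nat ?mulr_ge0// -ler_pdivrMr.
  move=> /andP[/andP[x0 ->]]; rewrite andbT truncn_ge_nat ?mulr_ge0//.
  by rewrite -ler_pdivrMr.
rewrite mu_cells//; congr EFin; by rewrite [RHS](@big_nat_widenl _ _ _ c 0).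
Qed.

Lemma Rintegral_grid (f : measurableTypeR R -> R) (c L : R) : measurable_fun setT f ->
  (forall x, `|f x| <= c) -> (forall x y, `|f x - f y| <= L * `|x - y|) -> 0 <= L ->
  `|Rintegral mu `[0, 1[%classic f - \sum_(0 <= a < Q) f (a%:R / Q%:R) * (rho a / Q%:R)|
  <= L / Q%:R.
Proof.
move=> mf fc fL L0.
suff : forall N, (N <= Q)%N -> `|Rintegral mu `[0, N%:R / Q%:R[%classic f -
    \sum_(0 <= a < N) f (a%:R / Q%:R) * (rho a / Q%:R)| <=
    L / Q%:R * \sum_(0 <= a < N) (rho a / Q%:R).
  move=> /(_ Q (leqnn Q)).
  have e : \sum_(0 <= a < Q) rho a / Q%:R = 1 by rewrite -big_distrl/= rhoQ divff ?gt_eqF.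
  by rewrite divff ?gt_eqF// e mulr1.
elim=> [_|N IHN NQ].
  rewrite !big_nil mul0r mulr0 subr0 set_itv_ge ?Rintegral_set0 ?normr0//.
  by rewrite bnd_simp ltxx.
have h1 : 0 <= N%:R / Q%:R :> R by rewrite divr_ge0.
have h2 : N%:R / Q%:R <= N.+1%:R / Q%:R :> R by rewrite ler_pM2r ?invr_gt0// ler_nat.
set J := `[N%:R / Q%:R, N.+1%:R / Q%:R[%classic : set (measurableTypeR R).
have mJ : measurable J by exact: measurable_itv.
have -> : `[0, N.+1%:R / Q%:R[%classic = (`[0, N%:R / Q%:R[%classic `|` J) :> set (measurableTypeR R).
  by rewrite /J -itv_bndbnd_setU// bnd_simp.
rewrite Rintegral_setU//; last 2 first.
- by apply: (@integrable_bounded _ mu _ _ c) => //; exact: measurableU.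
- apply/disj_setPS => x [/=]; rewrite /J /= !in_itv/= => /andP[_ xN].
  by rewrite leNgt xN.
rewrite !big_nat_recr//= mulrDr opprD addrACA (le_trans (ler_normD _ _))// lerD ?IHN ?(ltnW NQ)//.
have mR : fine (mu J) = rho N / Q%:R by rewrite muQ.
have e1 : f (N%:R / Q%:R) * (rho N / Q%:R) = Rintegral mu J (fun=> f (N%:R / Q%:R)).
  by rewrite Rintegral_cst// mR.
have ic (r : R) : mu.-integrable J (EFin \o (fun=> r)).
  by apply: (@integrable_bounded _ mu _ _ `|r|) => //; exact: measurable_cst.
have if1 : mu.-integrable J (EFin \o f) by exact: (@integrable_bounded _ mu _ _ c).
have mg : measurable_fun setT (fun x : measurableTypeR R => f x - f (N%:R / Q%:R)).
  by apply: measurable_funB => //; exact: measurable_cst.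
have gb (x : measurableTypeR R) : `|f x - f (N%:R / Q%:R)| <= c + c.
  by rewrite (le_trans (ler_normB _ _))// lerD.
have ig : mu.-integrable J (EFin \o (fun x : measurableTypeR R => f x - f (N%:R / Q%:R))).
  exact: (@integrable_bounded _ mu _ _ (c + c)).
rewrite e1 -RintegralB// (le_trans (le_normr_Rintegral _ _))//.
apply: (@le_trans _ _ (Rintegral mu J (fun=> L / Q%:R))); last by rewrite Rintegral_cst// mR.
apply: le_Rintegral => //.
  apply: (@integrable_bounded _ mu _ _ (c + c)) => //.
    by apply: measurableT_comp.
  by move=> x; rewrite normr_id.
move=> x; rewrite /J /= in_itv/= => /andP[x1 x2].
rewrite (le_trans (fL _ _))// ler_wpM2l// ger0_norm ?subr_ge0//.
have : N.+1%:R / Q%:R = N%:R / Q%:R + Q%:R^-1 :> R by rewrite -natr1 mulrDl mul1r.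
by move=> e; lra.
Qed.

Definition riemann (xi : R) : R[i] :=
  \sum_(0 <= a < Q) (rho a / Q%:R)%:C%C * cis (xi * (a%:R / Q%:R)).

(** The real and the imaginary part contribute an error [2 * pi * xi / Q] each. *)
Lemma mhat_riemann xi : 0 <= xi ->
  normc (mhat mu xi - riemann xi) <= 4 * pi * xi / Q%:R.
Proof.
move=> xi0; have hp := pi_ge0 R.
have lip (x y : R) : normc (cis (xi * x) - cis (xi * y)) <= 2 * pi * xi * `|x - y|.
  by rewrite (le_trans (cis_lip _ _))// -mulrBr normrM ger0_norm// mulrA.
have assoc x : 2 * pi * xi * x = 2 * pi * (xi * x) by ring.
have L0 : 0 <= 2 * pi * xi by rewrite !mulr_ge0.
have h1 := @Rintegral_grid (fun x => cos (2 * pi * xi * x)) 1 (2 * pi * xi)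
  (measurable_trig xi (@continuous_cos R)) (fun x => cos_max _) _ L0.
have h2 := @Rintegral_grid (fun x => sin (2 * pi * xi * x)) 1 (2 * pi * xi)
  (measurable_trig xi (@continuous_sin R)) (fun x => sin_max _) _ L0.
have -> : mhat mu xi - riemann xi = Complex
   (Rintegral mu `[0, 1[%classic (fun x => cos (2 * pi * xi * x)) -
     \sum_(0 <= a < Q) cos (2 * pi * xi * (a%:R / Q%:R)) * (rho a / Q%:R))
   (Rintegral mu `[0, 1[%classic (fun x => sin (2 * pi * xi * x)) -
     \sum_(0 <= a < Q) sin (2 * pi * xi * (a%:R / Q%:R)) * (rho a / Q%:R)).
  apply/eqP; rewrite eq_complex; apply/andP; split; apply/eqP.
    rewrite ReD /=; congr (_ + _); rewrite (_ : complex.Re (- riemann xi) = - complex.Re (riemann xi)).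
      congr (- _); rewrite Re_sum; apply: eq_bigr => a _; rewrite /= mul0r subr0 mulrC assoc//.
    by case: (riemann xi).
  rewrite ImD /=; congr (_ + _); rewrite (_ : complex.Im (- riemann xi) = - complex.Im (riemann xi)).
    by congr (- _); rewrite Im_sum; apply: eq_bigr => a _; rewrite /= mul0r addr0 mulrC assoc.
  by case: (riemann xi).
set u := _ - _ in h1 *; set v := _ - _ in h2 *.
have {}h1 : `|u| <= 2 * pi * xi / Q%:R.
  apply: h1 => x y; rewrite (assoc x) (assoc y); apply: le_trans (lip x y).
  have := Re_le_normc (cis (xi * x) - cis (xi * y)).
  have := Re_le_normc (- (cis (xi * x) - cis (xi * y))).
  by rewrite normc_opp /= => r1 r2; rewrite ler_norml; apply/andP; split; lra.
have {}h2 : `|v| <= 2 * pi * xi / Q%:R.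
  apply: h2 => x y; rewrite (assoc x) (assoc y); apply: le_trans (lip x y).
  set z := cis _ - cis _.
  have -> : sin (2 * pi * (xi * x)) - sin (2 * pi * (xi * y)) = complex.Im z by [].
  rewrite -ler_sqr ?nnegrE ?normc_ge0// normc_sqr real_normK ?num_real//.
  by rewrite lerDr sqr_ge0.
have -> : Complex u v = u%:C%C + 'i%C * v%:C%C.
  by apply/eqP; rewrite eq_complex /=; rewrite !(mul0r, mulr0, mul1r, addr0, add0r, subr0) !eqxx.
rewrite (le_trans (ler_normcD _ _))// normcM !normc_real.
have -> : normc 'i%C = 1 :> R by rewrite /normc /= expr0n/= add0r expr1n sqrtr1.
rewrite mul1r; lra.
Qed.

(** Integrating over the cells multiplies the Riemann sum by the ratio of the chord
    [cis (xi / Q) - 1] to its arc, which is at least [c]. *)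
Lemma nfour_riemann xi (c : R) : 0 < xi -> c * (2 * pi * (xi / Q%:R)) <= normc (cis (xi / Q%:R) - 1) ->
  c * normc (riemann xi) <= nfour Q rho xi.
Proof.
move=> xi0 hc; have hp := pi_gt0 R.
have e : four Q rho xi = (cis (xi / Q%:R) - 1) * (Q%:R%:C%C * riemann xi).
  rewrite /four /riemann !big_distrr /=; apply: eq_bigr => a _.
  rewrite /dcis; have -> : xi * (a.+1%:R / Q%:R) = xi / Q%:R + xi * (a%:R / Q%:R).
    by rewrite -natr1; field; rewrite gt_eqF.
  have -> : (rho a)%:C%C = Q%:R%:C%C * (rho a / Q%:R)%:C%C.
    by rewrite -rmorphM /= mulrC mulfVK// gt_eqF.
  by rewrite cisD; ring.
rewrite /nfour e !normcM normc_real ger0_norm// ler_pdivlMr ?mulr_gt0//.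
have -> : c * normc (riemann xi) * (2 * pi * xi) =
    c * (2 * pi * (xi / Q%:R)) * (Q%:R * normc (riemann xi)).
  by move: hp; generalize (@pi R) => p p0; field; rewrite gt_eqF.
by rewrite ler_wpM2r// mulr_ge0// normc_ge0.
Qed.

End grid_probability.

Lemma mhat_le (R : realType) (mu : probability (measurableTypeR R) R)
    (Q : nat -> nat) (rho : nat -> nat -> R) (k1 : nat) (xi B : R) :
  (forall k, (0 < Q k)%N) -> (forall k, \sum_(0 <= a < Q k) rho k a = (Q k)%:R) ->
  (forall k a, (a < Q k)%N ->
    mu `[a%:R / (Q k)%:R, a.+1%:R / (Q k)%:R[%classic = (rho k a / (Q k)%:R)%:E) ->
  (forall A : nat, exists2 k, (k1 <= k)%N & (A <= Q k)%N) ->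
  0 < xi -> 0 <= B ->
  (forall k, (k1 <= k)%N -> nfour (Q k) (rho k) xi <= B) ->
  normc (mhat mu xi) <= B.
Proof.
move=> Q0 rhoQ muQ Qoo xi0 B0 hB; have hp := pi_gt0 R.
apply/ler_addgt0Pr => e e0.
have e20 : 0 < e / 2 by rewrite divr_gt0.
(* Chosen so that [B / c <= B + e / 2], also when [B] is 0. *)
pose c := (B + 1) / (B + 1 + e / 2).
have c0 : 0 < c by rewrite divr_gt0//; lra.
have c1 : c < 1 by rewrite ltr_pdivrMr; lra.
have [d d0 hd] := @cisB1_asymp R c c1.
have [k kk1 Qk] := Qoo (Num.truncn (Num.max (xi / d) (4 * pi * xi / (e / 2)))).+1.
have Qbig : Num.max (xi / d) (4 * pi * xi / (e / 2)) < (Q k)%:R.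
  by rewrite (lt_le_trans (truncnS_gt _))// ler_nat.
move: Qbig; rewrite gt_max => /andP[q1 q2].
have Qk0 : 0 < (Q k)%:R :> R by rewrite ltr0n.
have h1 : xi / (Q k)%:R < d by rewrite ltr_pdivrMr// mulrC -ltr_pdivrMr.
have h2 : 4 * pi * xi / (Q k)%:R < e / 2.
  by rewrite ltr_pdivrMr// [ltRHS]mulrC -ltr_pdivrMr.
have h3 := hd (xi / (Q k)%:R); rewrite divr_gt0//= h1 in h3.
have h4 := le_trans (nfour_riemann (rho k) (Q0 k) xi0 (h3 isT)) (hB k kk1).
have h5 := mhat_riemann (Q0 k) (rhoQ k) (muQ k) (ltW xi0).
have h6 : normc (riemann (Q k) (rho k) xi) <= B + e / 2.
  rewrite -(ler_pM2l c0) (le_trans h4)// /c mulrAC ler_pdivlMr; nra.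
have -> : mhat mu xi = riemann (Q k) (rho k) xi + (mhat mu xi - riemann (Q k) (rho k) xi).
  by rewrite addrC subrK.
rewrite (le_trans (ler_normcD _ _))//; lra.
Qed.

(** * Digits and exponential sums *)

Lemma truncn_div (R : realType) (y : R) (m : nat) : (0 < m)%N -> 0 <= y ->
  Num.truncn (y / m%:R) = (Num.truncn y %/ m)%N.
Proof.
move=> m0 y0; have mR : 0 < m%:R :> R by rewrite ltr0n.
have /andP[t1 t2] := truncn_itv y0.
apply/eqP; rewrite (truncn_eq _ (divr_ge0 y0 (ltW mR))); apply/andP; split.
  by rewrite ler_pdivlMr// (le_trans _ t1)// -natrM ler_nat leq_divM.
by rewrite ltr_pdivrMr// (lt_le_trans t2)// -natrM ler_nat ltn_ceil.
Qed.

Lemma frac_part_id (R : realType) (x : R) : 0 <= x < 1 -> frac_part x = x.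
Proof.
by move=> x01; rewrite /frac_part (@floor_def _ _ 0) ?subr0// add0r.
Qed.

(** Reading a digit from a longer truncation lets all digits of a window be taken from one
    integer. *)
Lemma digitE (R : realType) (b : nat) (x : R) (j m : nat) : (0 < b)%N -> 0 <= x < 1 ->
  digit b x j = ((Num.truncn (b%:R ^+ (j + m) * x) %/ b ^ m) %% b)%N.
Proof.
move=> b0 x01; rewrite /digit frac_part_id//; congr (_ %% _)%N.
have bm : b%:R ^+ m != 0 :> R by rewrite expf_neq0// pnatr_eq0 -lt0n.
rewrite -truncn_div ?expn_gt0 ?b0//; last first.
  by rewrite mulr_ge0 ?exprn_ge0//; case/andP: x01.
congr Num.truncn; rewrite natrX exprD; field; exact: bm.
Qed.

Lemma eq_mod_digits (b k A A' : nat) : (0 < b)%N ->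
  (forall i, (i < k)%N -> (A %/ b ^ i) %% b = (A' %/ b ^ i) %% b)%N ->
  A = A' %[mod b ^ k].
Proof.
move=> b0; elim: k A A' => [|k IHk] A A' h; first by rewrite expn0 !modn1.
have h0 : A = A' %[mod b] by have := h 0%N isT; rewrite expn0 !divn1.
have hk : (A %/ b = A' %/ b %[mod b ^ k]).
  by apply: IHk => i ik; rewrite -!divnMA -expnS; exact: h.
have step C : (C %% b ^ k.+1 = (C %/ b %% b ^ k) * b + C %% b)%N.
  rewrite {1}(divn_eq C b) {1}(divn_eq (C %/ b) (b ^ k)) mulnDl -addnA -mulnA -expnSr.
  rewrite modnMDl modn_small// expnSr.
  have c1 : (C %/ b %% b ^ k < b ^ k)%N by rewrite ltn_pmod// expn_gt0 b0.
  have c2 : (C %% b < b)%N by rewrite ltn_pmod.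
  by rewrite -ltn_divLR// divnMDl// (divn_small c2) addn0.
by rewrite !step hk h0.
Qed.

(** * Weyl's criterion *)

Section weyl.
Context {R : realType} (b : nat) (x : R).
Hypotheses (b1 : (1 < b)%N) (x01 : 0 <= x < 1).

Let b0 : (0 < b)%N. Proof. exact: ltnW. Qed.
Let bR0 m : 0 < b%:R ^+ m :> R. Proof. by rewrite exprn_gt0// ltr0n. Qed.

Definition block_at (k : nat) (d : k.-tuple 'I_b) (n : nat) : bool :=
  [forall i : 'I_k, digit b x (n + i) == tnth d i].

Lemma block_countE k (d : k.-tuple 'I_b) N :
  block_count x d N = count (fun i => block_at d i.+1) (iota 0 N).
Proof.
by rewrite /block_count -[1%N]/(1 + 0)%N iotaDl count_map.
Qed.

(** The numbers whose expansion begins with a given block form an arc modulo 1. Its left end is read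
    off from one occurrence [i0]; if the block never occurs, any [s] will do. *)
Lemma block_arc k (d : k.-tuple 'I_b) : (0 < k)%N -> exists s : R, forall i,
  block_at d i.+1 -> exists z : int, 0 <= b%:R ^+ i * x - s + z%:~R <= b%:R ^- k.
Proof.
move=> k0.
have [[i0 hi0]|none] := pselect (exists i, block_at d i.+1); last first.
  by exists 0 => i hi; exfalso; apply: none; exists i.
pose A i := Num.truncn (b%:R ^+ (i + k) * x).
exists ((A i0 %% b ^ k)%N%:R / b%:R ^+ k) => i hi.
have eA : A i = A i0 %[mod b ^ k].
  apply: eq_mod_digits => // j jk.
  have jk' : (k - j.+1 < k)%N by rewrite ltn_subrL.
  have e (l : nat) : block_at d l.+1 ->
      ((A l %/ b ^ j) %% b)%N = tnth d (Ordinal jk').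
    move=> /forallP/(_ (Ordinal jk'))/eqP <-.
    rewrite (@digitE _ _ _ _ j)//=; congr ((Num.truncn (_ ^+ _ * _) %/ _) %% _)%N.
    by rewrite addSnnS -addnA subnSK// subnK// ltnW.
  by rewrite !e.
exists (- (A i %/ b ^ k)%N%:Z).
have y0 : 0 <= b%:R ^+ (i + k) * x by rewrite mulr_ge0 ?exprn_ge0//; case/andP: x01.
have /andP[a1 a2] := truncn_itv y0; rewrite -/(A i) -natr1 in a1 a2.
have := divn_eq (A i) (b ^ k); rewrite eA => /(congr1 (fun n => n%:R : R)).
rewrite natrD natrM natrX => eA2.
rewrite mulrNz -[_%:~R]/((A i %/ b ^ k)%:R).
have -> : b%:R ^+ i * x = b%:R ^+ (i + k) * x / b%:R ^+ k.
  by rewrite exprD; field; rewrite gt_eqF.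
rewrite -[X in _ - X](mulfK (lt0r_neq0 (bR0 k))) -!mulrBl.
rewrite -[X in _ && (_ <= X)]mul1r; apply/andP; split.
  by rewrite divr_ge0 ?exprn_ge0//; lra.
by rewrite ler_pM2r ?invr_gt0//; lra.
Qed.

Hypothesis weyl : forall h, (0 < h)%N -> forall e : R, 0 < e ->
  exists N0 : nat, forall N, (N0 <= N)%N ->
    normc (\sum_(0 <= i < N) cis (h%:R * (b%:R ^+ i * x))) <= e * N%:R.

Lemma block_count_le k (d : k.-tuple 'I_b) (e : R) : (0 < k)%N -> 0 < e ->
  exists N0 : nat, forall N, (N0 <= N)%N ->
    (block_count x d N)%:R <= (b%:R ^- k + e) * N%:R.
Proof.
move=> k0 e0; have [s hs] := block_arc d k0.
set l : R := b%:R ^- k.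
have l0 : 0 <= l by rewrite invr_ge0 ltW.
have l1 : l <= 1 by rewrite invf_le1// exprn_ege1// ler1n.
(* Small enough for [(l + 3 * dl) * (1 + dl) <= (1 - dl) * (l + e)], given [l <= 1]. *)
pose dl : R := Num.min (1 / 4) (e / 20).
have dl0 : 0 < dl by rewrite lt_min; apply/andP; split; lra.
have dl1 : dl <= 1 / 4 by rewrite ge_min lexx.
have dl2 : dl <= e / 20 by rewrite ge_min lexx orbT.
have dl3 : 0 < dl < 1 / 2 by apply/andP; split; lra.
have [K K0 hK] := fejer_count dl3.
have KR : 0 < K%:R :> R by rewrite ltr0n.
have ek : 0 < dl / K%:R by rewrite divr_gt0.
have : exists N0 : nat, forall N, (N0 <= N)%N -> forall h, (0 < h < K)%N ->
    normc (\sum_(0 <= i < N) cis (h%:R * (b%:R ^+ i * x))) <= dl / K%:R * N%:R.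
  move: (dl / K%:R) ek => e1 e10; elim: (K) => [|K' [N1 IH]].
    by exists 0%N => N _ h; rewrite ltn0 andbF.
  have [->|K'0] := posnP K'; first by exists 0%N => N _ [|[]].
  have [N2 h2] := weyl K'0 e10; exists (maxn N1 N2) => N; rewrite geq_max => /andP[n1 n2].
  move=> h /andP[h0]; rewrite ltnS leq_eqVlt => /predU1P[->|hK']; first exact: h2.
  by apply: IH => //; rewrite h0.
move=> [N0 hN0]; exists N0 => N NN0.
rewrite block_countE.
have hw h : (0 < h < K)%N ->
    normc (\sum_(i <- iota 0 N) cis (b%:R ^+ i * x * h%:R)) <= dl / K%:R * N%:R.
  move=> hh; apply: le_trans (hN0 N NN0 h hh); rewrite /index_iota subn0 le_eqVlt.
  by apply/orP; left; apply/eqP; congr normc; apply: eq_bigr => i _; rewrite [_ * h%:R]mulrC.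
have B0 : 0 <= dl / K%:R * N%:R by rewrite mulr_ge0// ltW.
have := hK _ (iota 0 N) (fun i => block_at d i.+1) (fun i => b%:R ^+ i * x) s l _
  l0 B0 (fun i _ => hs i) hw.
rewrite size_iota.
have -> : K%:R * (dl / K%:R * N%:R) = dl * N%:R by field; rewrite gt_eqF.
set c := (count _ _)%:R => hc.
have c0 : 0 <= c by [].
have N0' : 0 <= N%:R :> R by [].
have {}hc : (1 - dl) * c <= (l + 3 * dl) * (1 + dl) * N%:R by rewrite -mulrA [(1 + dl) * _]mulrDl mul1r.
have hh : (l + 3 * dl) * (1 + dl) <= (1 - dl) * (l + e) by nra.
rewrite -(@ler_pM2l _ (1 - dl)); last by lra.
rewrite (le_trans hc)// mulrA ler_wpM2r//.
Qed.

Lemma sum_block_count k N : (\sum_(d : k.-tuple 'I_b) block_count x d N)%N = N.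
Proof.
under eq_bigr do rewrite block_countE -sum1_count big_mkcond /=.
rewrite exchange_big /= -[RHS](size_iota 0) -sum1_size; apply: eq_bigr => n _.
pose d0 : k.-tuple 'I_b := [tuple Ordinal (ltn_pmod (Num.truncn (b%:R ^+ (n.+1 + i) * frac_part x)) b0) | i < k].
rewrite (bigD1 d0)//= big1 => [|d].
  rewrite (_ : block_at d0 n.+1); first by rewrite addn0.
  by apply/forallP => i; rewrite tnth_mktuple.
move=> dd0; case: ifP => // /forallP h; case/eqP: dd0.
apply: eq_from_tnth => i; apply/val_inj; rewrite tnth_mktuple /=.
by have /eqP := h i.
Qed.

(** Upper bounds suffice: the counts of all [b ^ k] blocks add up to [N], so bounds on the other
    blocks with error [e / b ^ k] yield the lower bound for [d]. *)
Lemma weyl_normal : normal b x.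
Proof.
move=> k d k0; apply/cvgrPdist_le => /= e e0.
have bk0 : 0 < (b ^ k)%:R :> R by rewrite ltr0n expn_gt0 b0.
have bk1 : 1 <= (b ^ k)%:R :> R by rewrite ler1n expn_gt0 b0.
have e'0 : 0 < e / (b ^ k)%:R by rewrite divr_gt0.
have : exists N0 : nat, forall N, (N0 <= N)%N -> forall d' : k.-tuple 'I_b,
    (block_count x d' N)%:R <= (b%:R ^- k + e / (b ^ k)%:R) * N%:R.
  have /choice[f hf] : forall d' : k.-tuple 'I_b, exists N0 : nat, forall N, (N0 <= N)%N ->
    (block_count x d' N)%:R <= (b%:R ^- k + e / (b ^ k)%:R) * N%:R.
    by move=> d'; exact: block_count_le.
  exists (\max_d' f d')%N => N fN d'; apply: hf; apply: leq_trans fN.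
  exact: leq_bigmax.
move=> [N0 hN0]; exists N0.+1 => // N /= NN0.
have N0' : 0 < N%:R :> R by rewrite ltr0n (leq_ltn_trans _ NN0).
have {}hN0 := hN0 N (ltnW NN0).
rewrite -natrX in hN0 *.
set bk := (b ^ k)%:R in bk0 bk1 e'0 hN0 *.
have hs : \sum_(d' : k.-tuple 'I_b) (block_count x d' N)%:R = N%:R :> R.
  by rewrite -natr_sum sum_block_count.
rewrite (bigD1 d)//= in hs.
have hothers : \sum_(d' : k.-tuple 'I_b | d' != d) (block_count x d' N)%:R <=
    (bk - 1) * ((bk^-1 + e / bk) * N%:R) :> R.
  apply: (@le_trans _ _ (\sum_(d' : k.-tuple 'I_b | d' != d) ((bk^-1 + e / bk) * N%:R))).
    by apply: ler_sum => d' _; exact: hN0.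
  rewrite sumr_const -[_ *+ _]mulr_natl.
  rewrite (_ : #|_| = (b ^ k).-1)%N.
    by rewrite -subn1 natrB// expn_gt0 b0.
  have := cardC1 d; rewrite card_tuple card_ord => <-.
  by apply: eq_card => d'; rewrite !inE.
have h1 := hN0 d.
set c := (block_count x d N)%:R in hs h1 *.
have h2 : (bk^-1 - e) * N%:R <= c.
  have -> : c = N%:R - \sum_(d' : k.-tuple 'I_b | d' != d) (block_count x d' N)%:R.
    by rewrite -hs addrK.
  rewrite lerBrDr -lerBrDl (le_trans hothers)//.
  have : (bk - 1) * (bk^-1 + e / bk) <= 1 - (bk^-1 - e).
    have -> : (bk - 1) * (bk^-1 + e / bk) = 1 - bk^-1 + e - e / bk by field; rewrite gt_eqF.
    by have := ltW e'0; lra.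
  by move=> h; nra.
have ebk : e / bk <= e by rewrite ler_pdivrMr// ler_peMr// ltW.
rewrite ler_distl; apply/andP; split.
  rewrite lerBlDr ler_pdivrMr// in h1 *.
  by rewrite (le_trans h1)// ler_wpM2r ?(ltW N0')// lerD2l.
by rewrite -lerBlDr ler_pdivlMr.
Qed.

End weyl.

(** If the frequency of zeros were close to [1 / b] at both [n] and [2 * n], the number of zeros in
    positions [n + 1] to [2 * n] would be close to [n / b]. *)
Lemma not_normal_zeros (R : realType) (b : nat) (x eps : R) : (1 < b)%N -> 0 <= x < 1 -> 0 < eps ->
  (forall N0 : nat, exists2 n, (N0 < n)%N &
    (1 + eps / 2) * n%:R <= b%:R * (zeros b n (Num.truncn (b%:R ^+ (n + n) * x)))%:R) ->
  ~ normal b x.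
Proof.
move=> b1 x01 eps0 hz nx; have b0 : (0 < b)%N by exact: ltnW.
have bR : 0 < b%:R :> R by rewrite ltr0n.
pose d : 1.-tuple 'I_b := [tuple Ordinal b0].
pose Z (j : nat) : nat := digit b x j == 0.
have cE N : block_count x d N = (\sum_(1 <= j < N.+1) Z j)%N.
  rewrite /block_count -sum1_count big_mkcond /= /index_iota subSS subn0.
  apply: eq_bigr => j _; rewrite /Z (_ : [forall i, _] = (digit b x j == 0)); first by case: ifP.
  apply/forallP/idP => [/(_ ord0)|/eqP h i]; first by rewrite addn0.
  by rewrite (ord1 i) addn0 h.
have zE n : zeros b n (Num.truncn (b%:R ^+ (n + n) * x)) = (\sum_(n.+1 <= j < (n + n).+1) Z j)%N.
  rewrite zerosE -{1}[n.+1]add0n big_addn subSS addnK big_nat_rev /= add0n.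
  rewrite big_mkord [RHS]big_mkord; apply: eq_bigr => i _.
  rewrite /Z (@digitE _ _ _ _ (n - i.+1)) //.
  by have -> : (i + n.+1 + (n - i.+1) = n + n)%N by rewrite addnS -addSn addnC addnA subnK.
(* The errors at [n] and [2 * n] add up to [3 * n] times this, that is [eps * n / (4 * b)], half of
   the excess [eps * n / (2 * b)]. *)
have eta0 : 0 < eps / (12 * b%:R) by rewrite divr_gt0// mulr_gt0.
have /cvgrPdist_le/(_ _ eta0)[N0 _ hN0] := nx 1%N d isT.
have [n Nn hn] := hz N0.
have n0 : 0 < n%:R :> R by rewrite ltr0n (leq_ltn_trans _ Nn).
have /= h1 := hN0 n (ltnW Nn).
have /= h2 := hN0 (n + n)%N (leq_trans (ltnW Nn) (leq_addr n n)).
rewrite expr1 in h1 h2.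
move: h1 h2; rewrite ler_distlC => /andP[h1 _]; rewrite ler_distlC => /andP[_ h2].
rewrite ler_pdivlMr// in h1; rewrite natrD ler_pdivrMr ?addr_gt0// in h2.
have : (block_count x d (n + n))%:R = (block_count x d n)%:R +
   (zeros b n (Num.truncn (b%:R ^+ (n + n) * x)))%:R :> R.
  by rewrite !cE zE -natrD -big_cat_nat//= ltnS leq_addr.
move: hn h1 h2; set z := (zeros _ _ _)%:R; set c1 := (block_count x d n)%:R.
set c2 := (block_count _ _ _)%:R => hn h1 h2 e.
have hz2 : z <= (b%:R^-1 + 3 * (eps / (12 * b%:R))) * n%:R by lra.
have : b%:R * z <= (1 + eps / 4) * n%:R.
  apply: (@le_trans _ _ (b%:R * ((b%:R^-1 + 3 * (eps / (12 * b%:R))) * n%:R))).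
    by rewrite ler_pM2l.
  by rewrite le_eqVlt; apply/orP; left; apply/eqP; field; rewrite gt_eqF.
by move=> h3; have := le_trans hn h3; rewrite ler_pM2r//; lra.
Qed.

(** * Almost sure normality *)

Lemma bounded_series_tail (R : realType) (f : nat -> R) (C e : R) : (forall n, 0 <= f n) ->
  (forall N, \sum_(0 <= n < N) f n <= C) -> 0 < e ->
  exists N0 : nat, forall A B, (N0 <= A <= B)%N -> \sum_(A <= n < B) f n <= e.
Proof.
move=> f0 fC e0; pose S := [set \sum_(0 <= n < N) f n | N in setT].
have hS : has_sup S.
  split; first by exists (\sum_(0 <= n < 0) f n); exists 0%N.
  by exists C => _ [N _ <-].
have [_ [N0 _ <-] hN0] := sup_adherent e0 hS.
exists N0 => A B /andP[NA AB].
have hB : \sum_(0 <= n < B) f n <= sup S by apply: ub_le_sup; [exact: (proj2 hS)|exists B].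
have hA : \sum_(0 <= n < N0) f n <= \sum_(0 <= n < A) f n.
  by rewrite [leRHS](big_cat_nat _ NA)//= lerDl sumr_ge0.
by move: hB; rewrite (big_cat_nat _ AB)//=; lra.
Qed.

Lemma sum_invsq_le (R : realFieldType) (X : R) (K : nat) : 0 <= X ->
  \sum_(0 <= N < K) (if X <= N.+1%:R then X / N.+1%:R ^+ 2 else 0) <= 2.
Proof.
move=> X0.
(* Telescoping, as [1 / y ^ 2 <= 2 / y - 2 / (y + 1)] for [y >= 1]; the maximum with 0 covers the
   indices before [X]. *)
suff h : \sum_(0 <= N < K) (if X <= N.+1%:R then X / N.+1%:R ^+ 2 else 0) <=
    Num.max 0 (2 - 2 * X / K.+1%:R).
  by rewrite (le_trans h)// ge_max ler0n/= gerBl divr_ge0// mulr_ge0.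
elim: K => [|K IHK]; first by rewrite big_nil le_max lexx.
rewrite big_nat_recr//=; set y : R := K.+1%:R in IHK *.
have y1 : 1 <= y by rewrite ler1n.
have y0 : 0 < y by rewrite ltr0n.
have -> : K.+2%:R = y + 1 :> R by rewrite natr1.
have [Xy|yX] := leP X y; last first.
  rewrite addr0 (le_trans IHK)// ge_max le_max lexx/= le_max lerD2l lerN2.
  by rewrite ler_wpM2l ?mulr_ge0 ?orbT// lef_pV2 ?posrE ?addr_gt0// lerDl ler01.
have {}IHK : \sum_(0 <= N < K) (if X <= N.+1%:R then X / N.+1%:R ^+ 2 else 0) <= 2 - 2 * X / y.
  rewrite (le_trans IHK)// ge_max lexx andbT subr_ge0 ler_pdivrMr// ler_pM2l//.
rewrite le_max; apply/orP; right; rewrite (le_trans (lerD IHK (lexx _)))//.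
rewrite -subr_ge0.
have -> : 2 - 2 * X / (y + 1) - (2 - 2 * X / y + X / y ^+ 2) = X * (y - 1) / (y ^+ 2 * (y + 1)).
  by field; rewrite !gt_eqF// addr_gt0.
by rewrite divr_ge0 ?mulr_ge0// ?subr_ge0 ?exprn_ge0// ?addr_ge0// ltW.
Qed.

(* If [s] has unit increments and [|s N|^2 / N^3] is summable then [s N = o(N)]:
   a large value of [s N] persists on an interval of length proportional to [N]. *)
Lemma small_of_summable (R : realType) (s : nat -> R) (C e : R) : (forall N, 0 <= s N) ->
  (forall N, s N <= s N.+1 + 1) ->
  (forall K, \sum_(0 <= N < K) s N.+1 ^+ 2 / N.+1%:R ^+ 3 <= C) -> 0 < e ->
  exists N0 : nat, forall N, (N0 <= N)%N -> s N <= e * N%:R.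
Proof.
move=> s0 s1 sC; wlog : e / e <= 1 => [hw e0|e1 e0].
  have [e1|e1] := leP e 1; first exact: hw.
  have [N0 hN0] := hw 1 (lexx _) ltr01; exists N0 => N /hN0 /le_trans; apply.
  by rewrite ler_wpM2r// ltW.
(* A large [s N] makes at least [e * N / 4] consecutive terms no smaller than
   [(e * N / 2) ^ 2 / (2 * N) ^ 3]; their sum is at least [e ^ 3 / 128], twice this tail. *)
have e'0 : 0 < e ^+ 3 / 256 by rewrite divr_gt0// exprn_gt0.
have f0 N : 0 <= s N.+1 ^+ 2 / N.+1%:R ^+ 3 by rewrite divr_ge0 ?exprn_ge0.
have [N0 hN0] := bounded_series_tail f0 sC e'0.
exists (maxn N0.+1 (Num.truncn (4 / e)).+1) => N; rewrite geq_max => /andP[N0N eN].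
have N0' : 0 < N%:R :> R by rewrite ltr0n (leq_ltn_trans _ N0N).
have {}eN : 4 <= e * N%:R.
  rewrite mulrC -ler_pdivrMr//; apply/ltW/(lt_le_trans (truncnS_gt _)).
  by rewrite ler_nat.
rewrite leNgt; apply/negP => hs.
pose L := Num.truncn (e * N%:R / 2).
have eN0 : 0 <= e * N%:R / 2 by lra.
have /andP[L1 L2] := truncn_itv eN0; rewrite -/L -[L.+1%:R]natr1 in L1 L2.
have hL : e * N%:R / 4 <= L%:R by lra.
have sj j : (j <= L)%N -> e * N%:R / 2 <= s (N + j)%N.
  move=> jL.
  have h : s N <= s (N + j)%N + j%:R.
    elim: j {jL} => [|j IHj]; first by rewrite addn0 addr0.
    by rewrite (le_trans IHj)// addnS -natr1 [j%:R + 1]addrC addrA lerD2r.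
  have : j%:R <= L%:R :> R by rewrite ler_nat.
  by lra.
have hsum := hN0 N.-1 (N.-1 + L)%N.
rewrite -ltnS prednK ?(leq_ltn_trans _ N0N)// in hsum.
have {}hsum := hsum (leq_addr _ _).
have : \sum_(N.-1 <= i < N.-1 + L) (e ^+ 2 / 32 / N%:R) <= e ^+ 3 / 256.
  apply: le_trans hsum; rewrite -{1 3}[N.-1]add0n !big_addn !addKn; apply: ler_sum_nat_lt => j jL.
  have -> : (j + N.-1).+1 = (N + j)%N by rewrite -addnS prednK ?(leq_ltn_trans _ N0N)// addnC.
  have Nj : 0 < (N + j)%:R :> R by rewrite ltr0n addn_gt0 (leq_ltn_trans _ N0N).
  have Nj2 : (N + j)%:R <= 2 * N%:R :> R.
    rewrite natrD mulr_natl mulr2n lerD2l.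
    have : j%:R <= L%:R :> R by rewrite ler_nat ltnW.
    have : e * N%:R <= N%:R by rewrite ler_piMl// ltW.
    by lra.
  apply: (@le_trans _ _ ((e * N%:R / 2) ^+ 2 / (2 * N%:R) ^+ 3)).
    by rewrite le_eqVlt; apply/orP; left; apply/eqP; field; rewrite gt_eqF.
  have h1 := sj j (ltnW jL).
  rewrite ler_pM ?exprn_ge0 ?invr_ge0 ?exprn_ge0 ?(ltW N0')// ?mulr_ge0//.
    by rewrite lerXn2r ?nnegrE//.
  by rewrite lef_pV2 ?posrE ?exprn_gt0 ?mulr_gt0// lerXn2r ?nnegrE// ?mulr_ge0// ltW.
rewrite sumr_const_nat addKn -[_ *+ _]mulr_natr leNgt => /negP; apply.
apply: (@lt_le_trans _ _ (e ^+ 2 / 32 / N%:R * (e * N%:R / 4))); last first.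
  by rewrite ler_pM2l// divr_gt0// divr_gt0// exprn_gt0.
have -> : e ^+ 2 / 32 / N%:R * (e * N%:R / 4) = e ^+ 3 / 128 by field; rewrite gt_eqF.
by have := exprn_gt0 3 e0; lra.
Qed.

Section ae_normal.
Context {R : realType} (mu : probability (measurableTypeR R) R).
Hypothesis mu01 : mu `[0, 1[%classic = 1%E.

Let D : set (measurableTypeR R) := `[0, 1[%classic.

Let mD : measurable D. Proof. exact: measurable_itv. Qed.

(** The sum of the series is integrable, as integration and summation may be exchanged, hence finite
    almost everywhere. *)
Lemma ae_bounded_series (f : nat -> measurableTypeR R -> R) (C : R) :
  (forall n x, 0 <= f n x) -> (forall n, mu.-integrable D (EFin \o f n)) ->
  (forall N, \sum_(0 <= n < N) Rintegral mu D (f n) <= C) ->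
  {ae mu, forall x, D x -> exists C' : R, forall N, \sum_(0 <= n < N) f n x <= C'}.
Proof.
move=> f0 fi fC.
have mf n : measurable_fun D (EFin \o f n) by apply: measurable_int; exact: fi.
pose g x := (\sum_(0 <= n <oo) (f n x)%:E)%E.
have g0 x : (0 <= g x)%E by apply: nneseries_ge0 => n _ _; rewrite lee_fin.
have gi : mu.-integrable D g.
  apply/integrableP; split.
    have hm := @ge0_emeasurable_sum _ _ R D (fun n x => (f n x)%:E) xpredT.
    by apply: hm => [n x _ _|n _]; [rewrite lee_fin|exact: mf].
  under eq_integral do rewrite gee0_abs//.
  rewrite integral_nneseries//; last by move=> n x _; rewrite lee_fin.
  apply: (@le_lt_trans _ _ C%:E); last by rewrite ltry.
  apply: lime_le.
    by apply: is_cvg_nneseries => n _ _; apply: integral_ge0 => x _; rewrite lee_fin.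
  apply: nearW => N; have := fC N; rewrite -lee_fin -sumEFin.
  under eq_bigr => n _.
    rewrite /Rintegral fineK; last by exact: (integrable_fin_num mD (fi n)).
    over.
  by [].
have := integrable_ae mD gi; apply: filterS => x hx Dx.
exists (fine (g x)) => N; rewrite -lee_fin fineK; last exact: hx.
rewrite -sumEFin /g; apply: nneseries_lim_ge => // n _ _; by rewrite lee_fin.
Qed.

Lemma Rintegral_sum (I : Type) (r : seq I) (f : I -> measurableTypeR R -> R) :
  (forall i, mu.-integrable D (EFin \o f i)) ->
  Rintegral mu D (fun x => \sum_(i <- r) f i x) = \sum_(i <- r) Rintegral mu D (f i).
Proof.
move=> fi; rewrite /Rintegral.
under eq_integral do rewrite -sumEFin.
rewrite integral_sum//.
by rewrite sum_fine// => i _; exact: (integrable_fin_num mD (fi i)).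
Qed.

Variables (b h : nat).
Hypotheses (b1 : (1 < b)%N) (h0 : (0 < h)%N).

Definition wsum (N : nat) (x : R) : R[i] := \sum_(0 <= i < N) cis (h%:R * (b%:R ^+ i * x)).

Let wcos (i j : nat) (x : R) : R := cos (2 * pi * (h%:R * b%:R ^+ i - h%:R * b%:R ^+ j) * x).

Let wsum_sqr N x : normc (wsum N x) ^+ 2 = \sum_(0 <= i < N) \sum_(0 <= j < N) wcos i j x.
Proof.
rewrite normc_sum_cis_sqr; apply: eq_bigr => i _; apply: eq_bigr => j _.
by congr cos; ring.
Qed.

Let wcos_int i j : mu.-integrable D (EFin \o wcos i j).
Proof. exact: integrable_cos. Qed.

Lemma integrable_wsum N : mu.-integrable D (EFin \o (fun x => normc (wsum N x) ^+ 2)).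
Proof.
rewrite (_ : EFin \o _ = fun x => (\sum_(0 <= i < N) \sum_(0 <= j < N) (wcos i j x)%:E)%E).
  by apply: integrable_sum => // i _; apply: integrable_sum => // j _; exact: wcos_int.
apply: funext => x /=; rewrite wsum_sqr; under [RHS]eq_bigr do rewrite sumEFin.
by rewrite sumEFin.
Qed.

Let wcosC i j x : wcos i j x = wcos j i x.
Proof. by rewrite /wcos -cosN; congr cos; ring. Qed.

(* The off-diagonal terms i > j of the square are Fourier coefficients at
   h (b^(i - j) - 1) b^j; [hA] is applied for each fixed i - j. *)
Lemma wsum_moment N (A : R) :
  (forall u M, (0 < u)%N -> (forall i, (i < M)%N -> (u * b ^ i <= h * b ^ N)%N) ->
     \sum_(0 <= i < M) normc (mhat mu (u * b ^ i)%:R) <= A) ->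
  Rintegral mu D (fun x => normc (wsum N x) ^+ 2) <= N%:R * (1 + 2 * A).
Proof.
move=> hA.
have A0 : 0 <= A by have := hA 1%N 0%N isT; rewrite big_nil; apply.
pose I i j := Rintegral mu D (wcos i j).
have -> : Rintegral mu D (fun x => normc (wsum N x) ^+ 2) =
    \sum_(0 <= i < N) \sum_(0 <= j < N) I i j.
  under eq_Rintegral do rewrite wsum_sqr.
  rewrite Rintegral_sum; first by apply: eq_bigr => i _; rewrite Rintegral_sum.
  move=> i; rewrite (_ : EFin \o _ = fun x => (\sum_(0 <= j < N) (wcos i j x)%:E)%E).
    by apply: integrable_sum => // j _; exact: wcos_int.
  by apply: funext => x /=; rewrite -sumEFin.
have IC i j : I i j = I j i by congr Rintegral; apply: funext => x; exact: wcosC.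
have Ile1 i j : I i j <= 1.
  rewrite /I -[leRHS]/(fine 1%E) -mu01 -[leRHS]mul1r -Rintegral_cst//.
  apply: le_Rintegral => //.
  - exact: wcos_int.
  - by apply: (@integrable_bounded _ _ _ _ 1) => // x; rewrite normr1.
have Ihat i j : (j < i)%N -> I i j <= normc (mhat mu (h * (b ^ (i - j)).-1 * b ^ j)%:R).
  move=> ji; rewrite (le_trans _ (Re_le_normc _))// /mhat/= le_eqVlt; apply/orP; left.
  apply/eqP; congr Rintegral; apply: funext => x; rewrite /wcos; congr (cos (_ * _ * _)).
  rewrite -subn1 mulnBr mulnBl muln1 natrB; last by rewrite leq_mul2r leq_pmulr ?orbT// expn_gt0 ltnW.
  rewrite -mulnA -expnD subnK ?(ltnW ji)// !natrM !natrX //.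
have row j : (j < N)%N -> \sum_(j.+1 <= i < N) I i j <= \sum_(1 <= m < N) (if (m + j < N)%N then
    normc (mhat mu (h * (b ^ m).-1 * b ^ j)%:R) else 0).
  move=> jN; rewrite -[X in \sum_(X <= _ < _) I _ _]add1n big_addn -big_mkcond /=.
  rewrite (big_nat_widen _ _ N) ?leq_subr//= [leRHS](eq_bigl (fun m => m < N - j)%N).
    rewrite big_seq_cond [leRHS]big_seq_cond; apply: ler_sum => m.
    rewrite mem_index_iota => /andP[/andP[m1 _] _].
    by rewrite -[X in (b ^ X)%N](addnK j m) Ihat// -[ltnLHS]add0n ltn_add2r.
  by move=> m; rewrite ltn_subRL addnC.
have lower : \sum_(0 <= j < N) \sum_(j.+1 <= i < N) I i j <= N%:R * A.
  apply: (@le_trans _ _ (\sum_(0 <= j < N) \sum_(1 <= m < N) (if (m + j < N)%N then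
      normc (mhat mu (h * (b ^ m).-1 * b ^ j)%:R) else 0))).
    exact: ler_sum_nat_lt.
  rewrite exchange_big /=.
  apply: (@le_trans _ _ (\sum_(1 <= m < N) A)); last first.
    by rewrite sumr_const_nat -[_ *+ _]mulr_natr mulrC ler_wpM2r// ler_nat leq_subr.
  rewrite big_seq [leRHS]big_seq; apply: ler_sum => m; rewrite mem_index_iota => /andP[m1 mN].
  rewrite (big_cat_nat (leq0n _) (leq_subr m N))//= [X in _ + X]big1_seq ?addr0; last first.
    move=> j /=; rewrite mem_index_iota => /andP[]; rewrite leq_subLR => /leq_gtF ->//.
  rewrite (@eq_sum_nat_lt _ _ _ (fun j => normc (mhat mu (h * (b ^ m).-1 * b ^ j)%:R))); last first.
    by move=> j; rewrite ltn_subRL => ->.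
  have bm : (1 < b ^ m)%N by rewrite -(expn0 b) ltn_exp2l.
  apply: hA => [|i]; first by rewrite muln_gt0 h0/= -subn1 subn_gt0.
  rewrite ltn_subRL => imN; rewrite -mulnA leq_pmul2l//.
  rewrite (@leq_trans (b ^ m * b ^ i))//; first by rewrite leq_mul2r leq_pred orbT.
  by rewrite -expnD leq_pexp2l// ltnW.
have split : \sum_(0 <= i < N) \sum_(0 <= j < N) I i j =
  \sum_(0 <= j < N) I j j + (\sum_(0 <= j < N) \sum_(j.+1 <= i < N) I i j) *+ 2.
  rewrite mulr2n exchange_big /= .
  have upper : \sum_(0 <= j < N) \sum_(j.+1 <= i < N) I i j =
      \sum_(0 <= j < N) \sum_(0 <= i < j) I i j.
    rewrite [LHS](eq_bigr (fun j => \sum_(0 <= i < N | (j < i)%N) I i j)); last first.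
      by move=> j _; rewrite (big_nat_widenl j.+1 0).
    rewrite [RHS](@eq_sum_nat_lt _ _ _ (fun j => \sum_(0 <= i < N | (i < j)%N) I i j)); last first.
      by move=> j jN; rewrite (big_nat_widen 0 j N)// ltnW.
    rewrite (exchange_big_dep xpredT)//=; apply: eq_bigr => i _; apply: eq_bigr => j _; exact: IC.
  rewrite [in X in _ = _ + (_ + X)]upper -!big_split /=; apply: eq_sum_nat_lt => j jN.
  rewrite (big_cat_nat (leq0n _) (ltnW jN))//= (@big_ltn _ _ _ j)//.
  by rewrite addrCA; congr (_ + _); rewrite addrC.
rewrite split mulrDr mulr1 lerD//.
  rewrite (le_trans (ler_sum_nat_lt (fun j _ => Ile1 j j)))//.
  by rewrite sumr_const_nat subn0.
by rewrite -[_ *+ 2]mulr_natl mulrCA ler_pM2l.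
Qed.

Variables (Y n : nat -> nat) (k0 : nat).
Hypotheses (Yn : forall k, (2 ^ n k <= Y k)%N) (Yk : forall k, (k <= Y k)%N).
Hypothesis hat : forall k, (k0 <= k)%N -> forall u M, (0 < u)%N ->
  (forall i, (i < M)%N -> (u * b ^ i <= Y k.+1)%N) ->
  \sum_(0 <= i < M) normc (mhat mu (u * b ^ i)%:R) <= (n k)%:R / 2 ^+ k.

Let c : R := (h + b)%:R.

Let c0 : 0 < c. Proof. by rewrite ltr0n addn_gt0 h0. Qed.

(* The stage k of N is the least one with h b^N <= Y (k + 1); as 2^(n k) <= Y k, it
   satisfies n k <= c N unless it is k0. *)
Lemma wsum_moment_stage N K : (0 < N)%N -> (k0 <= K)%N -> (h * b ^ N <= Y K.+1)%N ->
  Rintegral mu D (fun x => normc (wsum N x) ^+ 2) <=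
  N%:R * (1 + 2 * ((n k0)%:R / 2 ^+ k0 +
    \sum_(0 <= k < K.+1) (if (n k)%:R / c <= N%:R then (n k)%:R / 2 ^+ k else 0))).
Proof.
move=> N0 kK hK.
have f0 k : 0 <= (if (n k)%:R / c <= N%:R then (n k)%:R / 2 ^+ k else 0) :> R.
  by case: ifP => // _; rewrite divr_ge0// exprn_ge0.
have ex : exists k, (k0 <= k)%N && (h * b ^ N <= Y k.+1)%N by exists K; rewrite kK.
case: (ex_minnP ex) => k /andP[k0k hk] kmin.
have {}kK : (k <= K)%N by apply: kmin; rewrite kK.
apply: (le_trans (@wsum_moment N ((n k)%:R / 2 ^+ k) _)).
  move=> u M u0 hu; apply: hat => // i iM; exact: leq_trans (hu i iM) hk.
rewrite ler_wpM2l// lerD2l ler_pM2l//.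
move: k0k; rewrite leq_eqVlt => /predU1P[->|k0k]; first by rewrite lerDl sumr_ge0.
rewrite -[leLHS]add0r lerD ?divr_ge0 ?exprn_ge0//.
rewrite (bigD1_seq k) ?iota_uniq ?mem_index_iota//=.
have -> : (n k)%:R / c <= N%:R; last by rewrite lerDl sumr_ge0.
have kp : (k.-1.+1 = k)%N by rewrite prednK// (leq_ltn_trans _ k0k).
have hY : (Y k < h * b ^ N)%N.
  rewrite ltnNge; apply/negP => hY; have := kmin k.-1.
  by rewrite kp hY andbT -ltnS kp k0k => /(_ isT); rewrite -ltnS kp ltnn.
rewrite ler_pdivrMr// -natrM ler_nat.
have : (2 ^ n k < 2 ^ (N * (h + b)))%N.
  rewrite (leq_ltn_trans (Yn k))// (leq_trans hY)// mulnDr expnD leq_mul//.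
    by rewrite (leq_trans (ltnW (ltn_expl h (ltnSn 1))))// leq_pexp2l// leq_pmull.
  by rewrite mulnC expnM leq_exp2r// ltnW// ltn_expl.
by rewrite ltn_exp2l// => /ltnW.
Qed.

(** Stage [k] enters only for [N >= n k / c], where the sum of [1 / N ^ 2] is at most [2 * c / n k];
    this cancels the factor [n k] of the stage and leaves the summable [2 ^ (- k)]. *)
Lemma wsum_summable : exists C : R, forall K,
  \sum_(0 <= N < K) Rintegral mu D (fun x => normc (wsum N.+1 x) ^+ 2 / N.+1%:R ^+ 3) <= C.
Proof.
set E : R := (n k0)%:R / 2 ^+ k0.
have E0 : 0 <= E by rewrite divr_ge0// exprn_ge0.
exists ((1 + 2 * E) * 2 + 2 * (c * 4)) => K.
(* A stage late enough for all [N <= K], because [k <= Y k]. *)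
pose L := maxn k0 (h * b ^ K).
pose g k (N : nat) : R := if (n k)%:R / c <= N.+1%:R then (n k)%:R / 2 ^+ k else 0.
apply: (@le_trans _ _ (\sum_(0 <= N < K) ((1 + 2 * E) / N.+1%:R ^+ 2 +
    2 * \sum_(0 <= k < L.+1) g k N / N.+1%:R ^+ 2))).
  apply: ler_sum_nat_lt => N NK.
  have -> : Rintegral mu D (fun x => normc (wsum N.+1 x) ^+ 2 / N.+1%:R ^+ 3) =
      Rintegral mu D (fun x => normc (wsum N.+1 x) ^+ 2) / N.+1%:R ^+ 3.
    by rewrite RintegralZr//; exact: integrable_wsum.
  rewrite ler_pdivrMr ?exprn_gt0//.
  apply: le_trans (@wsum_moment_stage N.+1 L isT (leq_maxl _ _) _) _.
    rewrite (leq_trans _ (Yk _))// (leq_trans _ (leqnSn _))// (leq_trans _ (leq_maxr _ _))//.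
    by rewrite leq_pmul2l// leq_pexp2l// ltnW.
  rewrite -/E -big_distrl /= -[X in 2 * (_ + X)]/(\sum_(0 <= k < L.+1) g k N) le_eqVlt; apply/orP; left; apply/eqP.
  have : N.+1%:R != 0 :> R by rewrite pnatr_eq0.
  by move: (N.+1%:R) (\sum_(0 <= k < L.+1) g k N) => y S y0; field.
rewrite big_split /= -!big_distrr /= lerD//.
  rewrite ler_wpM2l ?addr_ge0 ?mulr_ge0//.
  apply: le_trans (@sum_invsq_le R 1 K ler01).
  by apply: ler_sum => N _; rewrite ler1n/= mul1r.
rewrite ler_pM2l// exchange_big /=.
apply: (@le_trans _ _ (\sum_(0 <= k < L.+1) c * (2 * 2^-1 ^+ k))).
  apply: ler_sum => k _.
  have -> : \sum_(0 <= N < K) g k N / N.+1%:R ^+ 2 = c / 2 ^+ k *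
      \sum_(0 <= N < K) (if (n k)%:R / c <= N.+1%:R then (n k)%:R / c / N.+1%:R ^+ 2 else 0).
    rewrite big_distrr /=; apply: eq_bigr => N _; rewrite /g; case: ifP => _; last by rewrite mul0r mulr0.
    have cn0 : c != 0 by rewrite gt_eqF.
    by move: cn0 (2 ^+ k)^-1 (N.+1%:R ^+ 2)^-1 (n k)%:R; move: (c) => c' c'0 p y m; field.
  rewrite -exprVn [2 * _]mulrC [leRHS]mulrA ler_pM2l; last by rewrite mulr_gt0// exprn_gt0.
  by apply: sum_invsq_le; rewrite divr_ge0// ltW.
rewrite -big_distrr /= ler_pM2l// -big_distrr /=.
have -> : \sum_(0 <= k < L.+1) 2^-1 ^+ k = 2 * (1 - 2^-1 ^+ L.+1) :> R.
  have := subrX1 (2^-1 : R) L.+1; rewrite big_mkord => e.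
  have -> : 1 - 2^-1 ^+ L.+1 = (1 - 2^-1) * \sum_(i < L.+1) 2^-1 ^+ i :> R.
    by rewrite -(opprK (1 - _)) opprB e; ring.
  by field.
by have : 0 <= 2^-1 ^+ L.+1 :> R; [rewrite exprn_ge0|lra].
Qed.

Lemma ae_wsum_small : {ae mu, forall x, D x -> forall e : R, 0 < e ->
  exists N0 : nat, forall N, (N0 <= N)%N -> normc (wsum N x) <= e * N%:R}.
Proof.
have [C hC] := wsum_summable.
pose f N (x : measurableTypeR R) : R := normc (wsum N.+1 x) ^+ 2 / N.+1%:R ^+ 3.
have := @ae_bounded_series f C _ _ hC; rewrite /f.
have h1 N x : 0 <= normc (wsum N.+1 x) ^+ 2 / N.+1%:R ^+ 3 by rewrite divr_ge0 ?exprn_ge0 ?normc_ge0.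
have h2 N : mu.-integrable D (EFin \o (fun x => normc (wsum N.+1 x) ^+ 2 / N.+1%:R ^+ 3)).
  rewrite (_ : EFin \o _ = fun x => ((normc (wsum N.+1 x) ^+ 2)%:E * (N.+1%:R ^+ 3)^-1%:E)%E).
    by apply: integrableZr => //; exact: integrable_wsum.
  by apply: funext => x.
move=> /(_ h1 h2); apply: filterS => x hx Dx e e0.
have [C' hC'] := hx Dx.
apply: (@small_of_summable _ _ C') => // [N|N]; first exact: normc_ge0.
have -> : wsum N x = wsum N.+1 x - cis (h%:R * (b%:R ^+ N * x)).
  by rewrite /wsum big_nat_recr//= addrK.
by rewrite (le_trans (ler_normcB _ _))// normc_cis.
Qed.

End ae_normal.

Lemma ae_normal (R : realType) (mu : probability (measurableTypeR R) R) (b : nat)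
    (Y n : nat -> nat) (k0 : nat) : mu `[0, 1[%classic = 1%E -> (1 < b)%N ->
  (forall k, (2 ^ n k <= Y k)%N) -> (forall k, (k <= Y k)%N) ->
  (forall k, (k0 <= k)%N -> forall u M, (0 < u)%N ->
    (forall i, (i < M)%N -> (u * b ^ i <= Y k.+1)%N) ->
    \sum_(0 <= i < M) normc (mhat mu (u * b ^ i)%:R) <= (n k)%:R / 2 ^+ k) ->
  {ae mu, forall x : R, x \in `[0, 1[ -> normal b x}.
Proof.
move=> mu01 b1 Yn Yk hat.
have := ae_foralln (fun h => @ae_wsum_small R mu mu01 b h.+1 b1 isT Y n k0 Yn Yk hat).
apply: filterS => x hx x01; have := x01; rewrite in_itv/= => x01'.
by apply: weyl_normal => // -[//|h] _ e e0; exact: hx.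
Qed.

(** * The cascade of stages *)

Lemma natX_powR (R : realType) (q m : nat) (a : R) : (q ^ m)%:R `^ a = (q%:R `^ a) ^+ m.
Proof.
elim: m => [|m IHm]; first by rewrite powR1.
by rewrite expnS natrM powRM// IHm exprS.
Qed.

Lemma powR_le1 (R : realType) (x a : R) : 0 <= a -> 0 <= x <= 1 -> x `^ a <= 1.
Proof.
move=> a0 /andP[x0 x1]; have -> : 1 = 1 `^ a :> R by rewrite powR1.
by rewrite ge0_ler_powR ?nnegrE.
Qed.

(** Up to mass 0, a ball of radius [r] is covered by at most [2 * r * N + 2] cells of length
    [1 / N], and [r * N] is at least 1. *)
Lemma ball_le (R : realType) (mu : probability (measurableTypeR R) R) (N : nat) (B x r : R) :
  mu `[0, 1[%classic = 1%E -> (0 < N)%N -> 0 <= B ->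
  (forall c d, (c <= d <= N)%N ->
    (mu `[(c%:R / N%:R)%R, (d%:R / N%:R)%R[%classic <= ((d - c)%:R * B / N%:R)%R%:E)%E) ->
  N%:R^-1 <= r -> (mu `[(x - r)%R, (x + r)%R]%classic <= (4 * (r * B))%:E)%E.
Proof.
move=> mu01 N0 B0 hmu Nr; have NR : 0 < N%:R :> R by rewrite ltr0n.
have Nr' : 1 <= r * N%:R by rewrite -ler_pdivrMr// mul1r.
pose lo := Num.max 0 ((x - r) * N%:R); pose hi := Num.max 0 ((x + r) * N%:R).
have lo0 : 0 <= lo by rewrite le_max lexx.
have hi0 : 0 <= hi by rewrite le_max lexx.
have lohi : lo <= hi by rewrite ge_max hi0/= le_max ler_pM2r//; apply/orP; right; nra.
have hilo : hi <= lo + 2 * (r * N%:R).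
  rewrite ge_max; apply/andP; split; first by nra.
  have : (x - r) * N%:R <= lo by rewrite le_max lexx orbT.
  by lra.
pose c := minn N (Num.truncn lo); pose d := minn N (Num.truncn hi).+1.
have cd : (c <= d <= N)%N.
  by rewrite geq_minl andbT leq_min geq_minl/= geq_min (leqW (le_truncn lohi)) orbT.
have mI (a b : R) : measurable (`[a, b[%classic : set (measurableTypeR R)) by exact: measurable_itv.
have hsub : (`[(x - r)%R, (x + r)%R]%classic : set (measurableTypeR R)) `<=`
    `[c%:R / N%:R, d%:R / N%:R[%classic `|` ~` `[0, 1[%classic.
  move=> y /=; rewrite in_itv/= => /andP[y1 y2].
  have [/andP[y3 y4]|ny] := boolP (0 <= y < 1); last by right; rewrite in_itv/=; exact/negP.
  left; rewrite in_itv/= ler_pdivrMr// ltr_pdivlMr//; apply/andP; split.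
    rewrite (@le_trans _ _ lo)//.
      by have /andP[h _] := truncn_itv lo0; rewrite (le_trans _ h)// ler_nat geq_minr.
    by rewrite ge_max mulr_ge0 ?(ltW NR)//= ler_pM2r.
  rewrite /d; case: leqP => _; first by rewrite gtr_pMl.
  rewrite (le_lt_trans _ (truncnS_gt hi))// le_max; apply/orP; right.
  by rewrite ler_pM2r.
have mC : measurable (~` `[0, 1[%classic : set (measurableTypeR R)) by apply: measurableC; exact: mI.
have muC : mu (~` `[0, 1[%classic) = 0%E by rewrite probability_setC// mu01 subee.
apply: (le_trans (le_measure mu _ _ hsub)); rewrite ?inE.
- exact: measurable_itv.
- exact: measurableU.
apply: (le_trans (measureU2 mu (mI _ _) mC)); rewrite [X in (_ + X)%E]muC adde0.
apply: (le_trans (hmu c d cd)); rewrite lee_fin ler_pdivrMr//.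
have -> : 4 * (r * B) * N%:R = 4 * (r * N%:R) * B by ring.
rewrite ler_wpM2r// natrB; last by have /andP[] := cd.
have [cN|] := leqP N (Num.truncn lo).
  have -> : c = N by apply/minn_idPl.
  by rewrite (@le_trans _ _ 0)// ?subr_le0 ?ler_nat ?geq_minl// mulr_ge0// (le_trans ler01).
move=> /ltnW/minn_idPr => cE; rewrite [c]cE.
have h1 : d%:R <= hi + 1.
  rewrite (@le_trans _ _ (Num.truncn hi).+1%:R) ?ler_nat ?geq_minr//.
  by have /andP[h _] := truncn_itv hi0; rewrite -natr1 lerD2r.
have h2 : lo < (Num.truncn lo)%:R + 1 by rewrite natr1 truncnS_gt.
by lra.
Qed.

Section cascade.
Context {R : realType} (q n Q : nat -> nat) (D : nat -> R) (rho : nat -> nat -> R) (eps eta : R).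
Hypotheses (q1 : forall k, (1 < q k)%N) (eps0 : 0 < eps) (eps1 : eps < 1).
Hypotheses (Q00 : Q 0%N = 1%N) (D00 : D 0%N = 1) (rho00 : rho 0%N = fun=> 1).
Hypotheses
  (QS : forall k, Q k.+1 = (Q k * (q k ^ n k * q k ^ n k))%N)
  (DS : forall k, D k.+1 = D k * (1 + eps) ^+ n k)
  (rhoS : forall k, rho k.+1 = next (q k) (n k) (Q k) k.+1 eps (rho k)).
(** At frequencies beyond [k.+1 * D k * Q k] the density of stage [k] has decayed to [1 / k.+1]. The
    factor [16 * 2 ^ k] leaves the room in which this stage and the later ones are still
    negligible. *)
Hypothesis n_large : forall k, k.+1%:R * D k * (Q k)%:R * 16 * 2 ^+ k <= (q k ^ n k)%:R.

Let Y k := (q k ^ n k)%N.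

Let Y0 k : (0 < Y k)%N. Proof. by rewrite expn_gt0 ltnW. Qed.

Let YR0 k : 0 < (Y k)%:R :> R. Proof. by rewrite ltr0n. Qed.

Lemma cascade_Q_gt0 k : (0 < Q k)%N.
Proof. by elim: k => [|k IHk]; rewrite ?Q00// QS muln_gt0 IHk muln_gt0 Y0. Qed.

Let Q0 := cascade_Q_gt0.

Let QR0 k : 0 < (Q k)%:R :> R. Proof. by rewrite ltr0n. Qed.

Lemma cascade_D_ge1 k : 1 <= D k.
Proof.
have e0 := eps0; elim: k => [|k IHk]; first by rewrite D00.
by rewrite DS mulr_ege1// exprn_ege1//; lra.
Qed.

Let D1 := cascade_D_ge1.

Lemma cascade_rho_bounds k a : 0 <= rho k a <= D k.
Proof.
elim: k a => [|k IHk] a; first by rewrite rho00 D00 ler01 lexx.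
by rewrite rhoS DS; exact: next_bounds.
Qed.

Let rhoD := cascade_rho_bounds.

Let rho_refine k a : (a < Q k)%N ->
  \sum_(0 <= i < Y k * Y k) rho k.+1 (a * (Y k * Y k) + i)%N = (Y k * Y k)%:R * rho k a.
Proof. by move=> aQ; rewrite rhoS sum_next. Qed.

Lemma cascade_rho_sum k : \sum_(0 <= a < Q k) rho k a = (Q k)%:R.
Proof.
elim: k => [|k IHk]; first by rewrite Q00 rho00 big_nat1.
rewrite {1}QS sum_nat_mulD (eq_sum_nat_lt (fun a => @rho_refine k a)) -big_distrr /= IHk.
by rewrite -natrM QS mulnC.
Qed.

Let rhoQ := cascade_rho_sum.

Let DQ_ge1 k : 1 <= D k * (Q k)%:R.
Proof. by rewrite mulr_ege1// ler1n. Qed.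

Lemma cascade_Q_le k : (16 * 2 ^ k * Q k <= Y k)%N.
Proof.
rewrite -(ler_nat R) (le_trans _ (n_large k))//.
have -> : k.+1%:R * D k * (Q k)%:R * 16 * 2 ^+ k = (k.+1%:R * D k) * (16 * 2 ^ k * Q k)%:R.
  by rewrite !natrM natrX; ring.
by rewrite ler_peMl// mulr_ege1// ler1n.
Qed.

Lemma cascade_double k : (2 * Y k <= Y k.+1)%N.
Proof.
rewrite (leq_trans _ (cascade_Q_le k.+1))// QS.
rewrite [(Q k * _)%N]mulnA [X in (_ <= X)%N]mulnA leq_mul2r; apply/orP; right.
rewrite (@leq_trans (16 * 2 ^ k.+1))//; first by rewrite (@leq_trans 16)// leq_pmulr// expn_gt0.
by rewrite leq_pmulr// muln_gt0 Q0 Y0.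
Qed.

Let Y_double k : 2 * (Y k)%:R <= (Y k.+1)%:R :> R.
Proof. by rewrite -natrM ler_nat cascade_double. Qed.

Lemma cascade_Y_ge k : (k < Y k)%N.
Proof. by elim: k => // k IHk; have := cascade_double k; rewrite /Y in IHk *; lia. Qed.

Lemma cascade_Q_ge k : (k <= Q k)%N.
Proof.
case: k => // k; rewrite QS (leq_trans (cascade_Y_ge k))// mulnA leq_pmull//.
by rewrite muln_gt0 Q0 Y0.
Qed.

Lemma cascade_measure : exists mu : probability (measurableTypeR R) R, forall k a, (a < Q k)%N ->
  mu `[a%:R / (Q k)%:R, a.+1%:R / (Q k)%:R[%classic = (rho k a / (Q k)%:R)%:E.
Proof.
have e0 := eps0; have e1 := eps1.
apply: (@grid_measure R Q (fun k => Y k * Y k)%N rho Q0 QS) => //.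
  by move=> k a; have /andP[] := rhoD k a.
move=> e e'0; pose k := Num.truncn e^-1; exists k.+1 => a _.
have /andP[_ r1] := rhoD k.+1 a.
rewrite (@le_trans _ _ (D k.+1 / (Q k.+1)%:R))//; first by rewrite ler_pM2r ?invr_gt0.
(* Of the two factors [Y k] gained by the refinement, one absorbs the growth [(1 + eps) ^ n k] and
   the other, through [hD], the old bound [D k]. *)
have hY : (1 + eps) ^+ n k <= (Y k)%:R.
  rewrite natrX lerXn2r ?nnegrE ?addr_ge0 ?(ltW e0)//.
  by rewrite (@le_trans _ _ 2)// ?ler_nat//; lra.
have hD : e^-1 * D k <= (Y k)%:R.
  rewrite (le_trans _ (n_large k))//.
  have -> : k.+1%:R * D k * (Q k)%:R * 16 * 2 ^+ k = k.+1%:R * D k * ((Q k)%:R * (16 * 2 ^+ k)) by ring.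
  rewrite (@le_trans _ _ (k.+1%:R * D k))//; last first.
    rewrite ler_peMr ?mulr_ge0 ?(le_trans ler01 (D1 k))//.
    by rewrite mulr_ege1 ?ler1n// mulr_ege1 ?exprn_ege1 ?ler1n.
  by rewrite ler_wpM2r ?(le_trans ler01 (D1 k))// ltW// truncnS_gt.
rewrite DS QS ler_pdivrMr; last by rewrite ltr0n muln_gt0 Q0 muln_gt0 Y0.
rewrite !natrM -/(Y k).
have {}hD : D k <= e * (Y k)%:R by rewrite -ler_pdivrMl.
rewrite (@le_trans _ _ (e * (Y k)%:R * (Y k)%:R))//.
  by rewrite ler_pM ?exprn_ge0 ?(le_trans ler01 (D1 k))// addr_ge0// ltW.
by rewrite [(Q k)%:R * _]mulrC !mulrA ler_peMr ?ler1n// !mulr_ge0// ltW.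
Qed.

(** A stage adds at most [4 * pi * xi / Y k], and [Y] at least doubles; with [8 * pi * xi / Y k]
    added, the transform becomes a quantity that does not increase with the stage. *)
Lemma cascade_nfour_tail k j xi : 0 < xi ->
  nfour (Q (k + j)%N) (rho (k + j)%N) xi <= nfour (Q k) (rho k) xi + 8 * pi * xi / (Y k)%:R.
Proof.
move=> xi0; have hp := pi_gt0 R.
suff : nfour (Q (k + j)%N) (rho (k + j)%N) xi + 8 * pi * xi / (Y (k + j))%:R <=
       nfour (Q k) (rho k) xi + 8 * pi * xi / (Y k)%:R.
  apply: le_trans; rewrite lerDl divr_ge0 ?mulr_ge0// ltW//.
elim: j => [|j IHj]; first by rewrite addn0.
apply: le_trans IHj; rewrite addnS; move: (k + j)%N => {j}k.
have := @nfour_next_low R (q k) (n k) (Q k) k.+1 eps (D k) (rho k) (q1 k) (Q0 k) isT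
  eps0 eps1 (rhoD k) (rhoQ k) xi xi0.
rewrite -QS -rhoS => h.
apply: le_trans (lerD h (lexx _)) _; rewrite -addrA lerD2l.
have -> : 8 * pi * xi / (Y k)%:R = 4 * pi * xi / (Y k)%:R + 4 * pi * xi / (Y k)%:R.
  by field; rewrite gt_eqF.
rewrite lerD2l ler_pdivrMr// [leRHS]mulrAC ler_pdivlMr//.
have -> : 8 * pi * xi * (Y k)%:R = 4 * pi * xi * (2 * (Y k)%:R) by ring.
by rewrite ler_pM2l// !mulr_gt0.
Qed.

Variable mu : probability (measurableTypeR R) R.
Hypothesis muQ : forall k a, (a < Q k)%N ->
  mu `[a%:R / (Q k)%:R, a.+1%:R / (Q k)%:R[%classic = (rho k a / (Q k)%:R)%:E.

Lemma cascade_mhat_le k xi : 0 < xi ->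
  normc (mhat mu xi) <= nfour (Q k) (rho k) xi + 8 * pi * xi / (Y k)%:R.
Proof.
move=> xi0; have hp := pi_gt0 R.
apply: (@mhat_le R mu Q rho k xi _ Q0 rhoQ muQ) => //.
- by move=> A; exists (maxn k A); rewrite ?leq_maxl// (leq_trans (leq_maxr k A))// cascade_Q_ge.
- by rewrite addr_ge0 ?divr_ge0 ?normc_ge0 ?mulr_ge0// ltW.
- by move=> j kj; rewrite -(subnKC kj); exact: cascade_nfour_tail.
Qed.

(** Let [k] be the stage with [k.+1 * A k <= xi <= k.+2 * A k.+1]. The density of stage [k] has
    decayed to [1 / k.+1], passing to the next adds at most [2 / k.+1], and all later changes add at
    most [1 / k.+1]. *)
Lemma cascade_Rajchman : Rajchman mu.
Proof.
move=> e e0; have hp := pi_gt0 R.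
pose K := Num.truncn (4 / e); pose A k := D k * (Q k)%:R.
have K4 : 4 < e * K.+1%:R by rewrite -ltr_pdivrMl// mulrC truncnS_gt.
exists (Num.truncn (K.+1%:R * A K)).+1 => m hm.
rewrite normc_fourier_coef; set xi : R := (`|m|%N)%:R.
have Kxi : K.+1%:R * A K <= xi by rewrite ltW// (lt_le_trans (truncnS_gt _))// ler_nat.
have A1 k : 1 <= A k by exact: DQ_ge1.
have xi0 : 0 < xi by rewrite (lt_le_trans _ Kxi)// mulr_gt0// (lt_le_trans ltr01).
have ex : exists k, (K <= k)%N && (xi <= k.+2%:R * A k.+1).
  exists (maxn K `|m|%N); rewrite leq_maxl/=.
  rewrite (@le_trans _ _ (maxn K `|m|%N).+2%:R)//; last by rewrite ler_peMr.
  by rewrite ler_nat ltnW// ltnW// !ltnS leq_maxr.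
case: (ex_minnP ex) => k /andP[Kk hk] kmin.
have {}Kxi : k.+1%:R * A k <= xi.
  move: Kk; rewrite leq_eqVlt => /predU1P[<-//|Kk].
  have kp : (k.-1.+1 = k)%N by rewrite prednK// (leq_ltn_trans _ Kk).
  rewrite leNgt; apply/negP => hx; have := kmin k.-1.
  by rewrite kp (ltW hx) andbT -ltnS kp Kk => /(_ isT); rewrite -ltnS kp ltnn.
have h1 : nfour (Q k) (rho k) xi <= 1 / k.+1%:R.
  rewrite (le_trans (nfour_decay (Q k) xi0 (rhoD k)))// ler_pdivrMr// mulrAC ler_pdivlMr//.
  by rewrite mul1r mulrC.
have h2 : nfour (Q k.+1) (rho k.+1) xi <= nfour (Q k) (rho k) xi + 2 / k.+1%:R.
  have := @nfour_next_T R (q k) (n k) (Q k) k.+1 eps (D k) (rho k) (q1 k) (Q0 k) isT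
    eps0 eps1 (rhoD k) (rhoQ k) xi xi0.
  by rewrite -QS -rhoS.
have h3 : 8 * pi * xi / (Y k.+1)%:R <= 1 / k.+1%:R.
  have hY : 16 * 2 ^+ k.+1 * xi <= (Y k.+1)%:R.
    rewrite (le_trans _ (n_large k.+1))// -[leRHS]mulrA [leRHS]mulrC ler_pM2l ?mulr_gt0 ?exprn_gt0//.
    by rewrite -mulrA.
  have p4 : pi <= 4 :> R by have := pihalf_lt2 R; lra.
  have k2 : k.+1%:R <= 2 ^+ k :> R by rewrite -natrX ler_nat ltn_expl.
  rewrite ler_pdivrMr// [leRHS]mulrAC ler_pdivlMr// mul1r (le_trans _ hY)//.
  rewrite [leLHS]mulrAC ler_pM2r// exprS.
  apply: (@le_trans _ _ (8 * 4 * 2 ^+ k)); last by rewrite le_eqVlt; apply/orP; left; apply/eqP; ring.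
  by apply: ler_pM => //; [rewrite mulr_ge0// ltW|rewrite ler_pM2l].
apply: (@le_lt_trans _ _ (4 / k.+1%:R)).
  rewrite (le_trans (cascade_mhat_le k.+1 xi0))// (le_trans (lerD h2 h3))//.
  rewrite (le_trans (lerD (lerD h1 (lexx _)) (lexx _)))// -!mulrDl.
  by rewrite ler_pM2r ?invr_gt0//; lra.
rewrite ltr_pdivrMr// (lt_le_trans K4)// ler_pM2l// ler_nat ltnS//.
Qed.

Lemma cascade_prob01 : mu `[0, 1[%classic = 1%E.
Proof. by have := mu_grid01 (Q0 0) (rhoQ 0) (@muQ 0%N). Qed.

Lemma cascade_hat b k0 : (1 < b)%N -> (forall k, (128 * 2 ^ k <= n k)%N) ->
  (forall k, (k0 <= k)%N -> forall u M, (0 < u)%N ->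
     \sum_(0 <= i < M) nfour (Q k.+1) (rho k.+1) (u * b ^ i)%:R <= (n k)%:R / 2 ^+ k.+1) ->
  forall k, (k0 <= k)%N -> forall u M, (0 < u)%N ->
    (forall i, (i < M)%N -> (u * b ^ i <= Y k.+1)%N) ->
  \sum_(0 <= i < M) normc (mhat mu (u * b ^ i)%:R) <= (n k)%:R / 2 ^+ k.
Proof.
move=> b1 n128 hS k k0k u M u0 hM; have hp := pi_gt0 R.
have b0 : (0 < b)%N by exact: ltnW.
have hub i : 0 < (u * b ^ i)%:R :> R by rewrite ltr0n muln_gt0 u0 expn_gt0 b0.
apply: (le_trans (ler_sum_nat_lt (fun i _ => cascade_mhat_le k.+1 (hub i)))).
rewrite big_split /=.
have := hS k k0k u M u0; set S1 := \sum_(0 <= i < M) nfour _ _ _ => h1.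
have hgeo : \sum_(0 <= i < M) (u * b ^ i)%:R <= 2 * (Y k.+1)%:R :> R.
  case: M hM {h1 S1} => [|M] hM; first by rewrite big_nil mulr_ge0.
  rewrite -natr_sum -natrM ler_nat (@leq_trans (2 * (u * b ^ M)))//; last first.
    by rewrite leq_pmul2l// hM.
  elim: M {hM} => [|M IHM]; first by rewrite big_nat1 expn0 muln1 leq_pmull.
  rewrite big_nat_recr//= (leq_trans (leq_add IHM (leqnn _)))// [leqRHS]mul2n -addnn.
  by rewrite leq_add2r mulnCA leq_pmul2l// expnS leq_pmul2r ?expn_gt0 ?b0.
have h2 : \sum_(0 <= i < M) 8 * pi * (u * b ^ i)%:R / (Y k.+1)%:R <= 64 :> R.
  rewrite -big_distrl -big_distrr /= ler_pdivrMr//.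
  have p4 : pi <= 4 :> R by have := pihalf_lt2 R; lra.
  apply: (@le_trans _ _ (8 * 4 * (2 * (Y k.+1)%:R))); last first.
    by rewrite le_eqVlt; apply/orP; left; apply/eqP; ring.
  by apply: ler_pM => //; [rewrite mulr_ge0// ltW|rewrite sumr_ge0|rewrite ler_pM2l].
(* The later stages cost the constant 64, absorbed into half of the bound because [n k] is at least
   [128 * 2 ^ k]. *)
have h3 : 64 <= (n k)%:R / 2 ^+ k.+1 :> R.
  rewrite ler_pdivlMr ?exprn_gt0// exprS mulrA -natrX -!natrM ler_nat.
  exact: n128.
have -> : (n k)%:R / 2 ^+ k = (n k)%:R / 2 ^+ k.+1 + (n k)%:R / 2 ^+ k.+1 :> R.
  have : 2 ^+ k != 0 :> R by rewrite expf_neq0.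
  by rewrite exprS; move: (2 ^+ k) (n k)%:R => p m p0; field.
exact: lerD h1 (le_trans h2 h3).
Qed.

Lemma cascade_cell k l c d : (l <= n k)%N -> (c <= d <= q k ^ (n k + l))%N ->
  (mu `[(c%:R / (q k ^ (n k + l))%:R)%R, (d%:R / (q k ^ (n k + l))%:R)%R[%classic <=
   ((d - c)%:R * (D k * (1 + eps) ^+ l) / (q k ^ (n k + l))%:R)%R%:E)%E.
Proof.
move=> ln /andP[cd dN]; set N := (q k ^ (n k + l))%N in dN *.
pose m := (n k - l)%N; pose w := (q k ^ m * Q k)%N.
have w0 : (0 < w)%N by rewrite muln_gt0 Q0 expn_gt0 ltnW.
have wR : w%:R != 0 :> R by rewrite pnatr_eq0 -lt0n.
have NR : 0 < N%:R :> R by rewrite ltr0n expn_gt0 ltnW.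
have nlm : n k = (l + m)%N by rewrite subnKC.
have QE : Q k.+1 = (N * w)%N.
  by rewrite QS mulnC /N /w [RHS]mulnA -!expnD -addnA -nlm.
have dE (x : nat) : x%:R / N%:R = (x * w)%:R / (Q k.+1)%:R :> R.
  by rewrite QE [(x * w)%:R]natrM [(N * w)%:R]natrM invfM mulrACA divff// mulr1.
rewrite !dE (mu_grid_itv (Q0 k.+1) (@muQ k.+1)); last first.
  by rewrite QE !leq_pmul2r// cd dN.
rewrite lee_fin -big_distrl /= ler_pdivrMr// QE.
rewrite [(N * w)%:R]natrM [_ / _ * _]mulrA divfK ?gt_eqF//.
rewrite -{1}[(c * w)%N]add0n big_addn -mulnBl sum_nat_mulD.
apply: (@le_trans _ _ (\sum_(0 <= a < d - c) (D k * (1 + eps) ^+ l * w%:R))); last first.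
  by rewrite sumr_const_nat subn0 -[_ *+ _]mulr_natl mulrA.
apply: ler_sum => a _; rewrite rhoS.
have := @sum_next_cell R (q k) (n k) (Q k) k.+1 eps (D k) (rho k) (q1 k) (Q0 k) isT eps0 eps1
  (rhoD k) l m (a + c) nlm.
apply: le_trans; rewrite le_eqVlt; apply/orP; left; apply/eqP; apply: eq_bigr => e _.
by rewrite mulnDl addnAC.
Qed.

(** * The ball condition *)

Section ball.
Hypotheses (eta01 : 0 < eta < 1) (eps_eta : 1 + eps <= 2 `^ eta).
Hypothesis D_le : forall k, D k <= ((q k)%:R `^ eta) ^+ n k.

Let theta k : R := (q k)%:R `^ eta.

Let eta0 : 0 <= eta. Proof. by have /andP[/ltW] := eta01. Qed.

Let theta_ge k : 1 + eps <= theta k.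
Proof. by rewrite (le_trans eps_eta)// ge0_ler_powR ?nnegrE// ler_nat. Qed.

Let theta_pow k m : (q k ^ m)%:R `^ eta = theta k ^+ m.
Proof. exact: natX_powR. Qed.

Let le_theta (r : R) k m : 0 <= r -> r * (q k ^ m)%:R <= 1 -> theta k ^+ m * r `^ eta <= 1.
Proof.
by move=> r0 rq; rewrite -theta_pow -powRM// mulrC powR_le1// rq mulr_ge0.
Qed.

(* At stage k, the scale drops by [q k ^ (2 * n k)] and the density grows at most by
   [(1 + eps) ^ n k]; the second half of the window compensates for [D k]. *)
Let scale (r : R) : 0 < r < 1 -> exists k l,
  [/\ (l <= n k)%N, (q k ^ (n k + l))%:R^-1 <= r & D k * (1 + eps) ^+ l * r `^ eta <= 2].
Proof.
move=> /andP[r0 r1]; have e0 := eps0; have e1 := eps1.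
have ge01 m : 0 <= (1 + eps) ^+ m by rewrite exprn_ge0//; lra.
have le_exp k m : (1 + eps) ^+ m <= theta k ^+ m by rewrite lerXn2r ?nnegrE ?powR_ge0//; lra.
have exk : exists k, 1 <= r * (q k ^ (n k + n k))%:R.
  exists (Num.truncn r^-1); set k := Num.truncn _.
  rewrite -ler_pdivrMl// mulr1 (le_trans (ltW (truncnS_gt _)))// ler_nat.
  by rewrite (leq_trans (cascade_Y_ge k))// leq_pexp2l ?leq_addl// ltnW.
(* Minimality of [l], or of [k] when [l] is 0, bounds [r] by the preceding scale, so the matching
   power of [theta] times [r ^ eta] is at most 1. Overshooting by one digit costs [1 + eps <= 2]. *)
case: (ex_minnP exk) => k hk kmin.
have exl : exists l, 1 <= r * (q k ^ (n k + l))%:R by exists (n k).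
case: (ex_minnP exl) => l hl lmin; exists k, l; split; first exact: lmin.
  by rewrite -[leLHS]mul1r ler_pdivrMr// ltr0n expn_gt0 ltnW.
case: l hl lmin => [|l] _ lmin.
  rewrite expr0 mulr1; case: k hk kmin {exl lmin} => [|k] hk kmin.
    by rewrite D00 mul1r (@le_trans _ _ 1)// ?ler1n// powR_le1// (ltW r0) (ltW r1).
  have rk : r * (q k ^ (n k + n k))%:R <= 1.
    by rewrite leNgt; apply/negP => /ltW /kmin; rewrite ltnn.
  rewrite (@le_trans _ _ 1)// ?ler1n// (le_trans _ (le_theta (ltW r0) rk))//.
  rewrite ler_wpM2r ?powR_ge0// DS exprD.
  exact: ler_pM (le_trans ler01 (D1 k)) (ge01 _) (D_le k) (le_exp _ _).
have rl : r * (q k ^ (n k + l))%:R <= 1.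
  by rewrite leNgt; apply/negP => /ltW /lmin; rewrite ltnn.
have h2 : 1 + eps <= 2 by lra.
apply: le_trans h2; rewrite -[leRHS]mulr1 exprS mulrCA -mulrA ler_pM2l; last by lra.
rewrite (le_trans _ (le_theta (ltW r0) rl))// ler_wpM2r ?powR_ge0// exprD.
exact: ler_pM (le_trans ler01 (D1 k)) (ge01 _) (D_le k) (le_exp _ _).
Qed.

Lemma cascade_ball (x r : R) : 0 < r < 1 ->
  (mu `[(x - r)%R, (x + r)%R]%classic <= (8 * r `^ (1 - eta))%:E)%E.
Proof.
move=> r01; have [k [l [ln hr hD]]] := scale r01; have /andP[r0 r1] := r01.
have e0 := eps0.
have : (mu `[(x - r)%R, (x + r)%R]%classic <= (4 * (r * (D k * (1 + eps) ^+ l)))%:E)%E.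
  apply: (@ball_le R mu (q k ^ (n k + l)) _ x r cascade_prob01) => //.
  - by rewrite expn_gt0 ltnW.
  - by rewrite mulr_ge0 ?exprn_ge0//; [exact: le_trans ler01 (D1 k)|lra].
  - by move=> c d cd; exact: cascade_cell.
move=> /le_trans; apply.
have p0 : 0 < r `^ eta by rewrite powR_gt0.
have -> : r `^ (1 - eta) = r / r `^ eta.
  by rewrite powRD ?powRr1 ?powRN ?(ltW r0)//; apply/implyP => _; rewrite gt_eqF.
rewrite lee_fin [leRHS]mulrA ler_pdivlMr// -!mulrA.
have -> : 4 * (r * (D k * ((1 + eps) ^+ l * r `^ eta))) = 4 * r * (D k * (1 + eps) ^+ l * r `^ eta) by ring.
have -> : 8 * r = 4 * r * 2 by ring.
by rewrite ler_pM2l// mulr_gt0.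
Qed.

Lemma cascade_ball_sup : (ball_sup mu (1 - eta)%R < +oo)%E.
Proof.
apply: (@le_lt_trans _ _ 8%:E); last by rewrite ltry.
apply: ge_ereal_sup => _ [x [r [r0 ->]]].
have mb : measurable (`[(x - r)%R, (x + r)%R]%classic : set (measurableTypeR R)).
  exact: measurable_itv.
have p0 : 0 < r `^ (1 - eta) by rewrite powR_gt0.
rewrite muleC -lee_pdivlMl//; last by rewrite invr_gt0.
rewrite invrK -EFinM mulrC; have [r1|r1] := ltP r 1; first by apply: cascade_ball; rewrite r0.
rewrite (le_trans (probability_le1 _ mb))// lee_fin (@le_trans _ _ 8)// ?ler1n//.
rewrite ler_peMr// -[leLHS](powRr0 r) ler_powR// subr_ge0.
by have /andP[_ /ltW] := eta01.
Qed.

End ball.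

(** * Almost sure bias of the digits *)

Section hits.
Hypothesis hits_ok : forall k, 16 * (q k)%:R ^+ 2 <= eps ^+ 2 * (n k)%:R.
Variable b : nat.
Hypothesis blocks : forall N0 : nat, exists A B, [/\ (N0 <= A <= B)%N,
  forall k, (A <= k < B)%N -> q k = b & 1 / 4 <= \sum_(A <= k < B) (2 * k.+1%:R)^-1 :> R].

Let hitb k a := (q k == b) && hit (q k) (n k) (Q k) eps a.

(** The index is divided down through the ancestors of the cell, so that survival up to stage [k] is
    decided by the cell of level [k]. *)
Fixpoint nohit (k0 k a : nat) : bool :=
  if k is k'.+1 then nohit k0 k' (a %/ (Y k' * Y k')) && ~~ ((k0 <= k')%N && hitb k' a)
  else true.

Let loss k0 k : R := if (k0 <= k)%N && (q k == b) then (2 * k.+1%:R)^-1 else 0.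

Let loss_bounds k0 k : 0 <= loss k0 k <= 1.
Proof.
rewrite /loss; case: ifP => _; last by rewrite lexx ler01.
by rewrite invr_ge0 mulr_ge0//= invf_le1 ?mulr_gt0// mulr_ege1 ?ler1n.
Qed.

Let mass k0 k : R := \sum_(0 <= a < Q k | nohit k0 k a) rho k a / (Q k)%:R.

Let mass_ge0 k0 k : 0 <= mass k0 k.
Proof. by apply: sumr_ge0 => a _; rewrite divr_ge0//; have /andP[] := rhoD k a. Qed.

(** By [sum_next_hit], the hits of a stage with base [b] take at least the share [loss] of the mass
    of each surviving cell. *)
Let mass_step k0 k : mass k0 k.+1 <= mass k0 k * (1 - loss k0 k).
Proof.
rewrite /mass -!big_distrl /= ler_pdivrMr//; set S := (X in _ <= X / _ * _ * _).
have -> : S / (Q k)%:R * (1 - loss k0 k) * (Q k.+1)%:R = S * ((Y k * Y k)%:R * (1 - loss k0 k)).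
  by rewrite QS natrM -/(Y k); move: (_ * _)%:R (1 - _) => y z; field; rewrite gt_eqF.
rewrite {}/S big_mkcond /= {1}QS sum_nat_mulD big_distrl [leRHS]big_mkcond /=.
apply: ler_sum_nat_lt => a aQ.
have YY0 : (0 < Y k * Y k)%N by rewrite muln_gt0 Y0.
have dE i : (i < Y k * Y k)%N -> ((a * (Y k * Y k) + i) %/ (Y k * Y k))%N = a.
  by move=> iY; rewrite divnMDl// divn_small// addn0.
have [na|na] := boolP (nohit k0 k a); last first.
  by rewrite big1_seq// => i /=; rewrite mem_index_iota => /dE ->; rewrite (negbTE na).
have r0 j i : 0 <= rho j i by have /andP[] := rhoD j i.
have full := rho_refine aQ.
rewrite /loss; case: (boolP ((k0 <= k)%N && (q k == b))) => [/andP[k0k qk]|_]; last first.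
  rewrite subr0 mulr1 mulrC -full; apply: ler_sum => i _; case: ifP => // _; exact: r0.
have hits := @sum_next_hit R (q k) (n k) (Q k) k.+1 eps (D k) (rho k) (q1 k) (Q0 k) isT eps0 eps1
  (rhoD k) a aQ _ (hits_ok k).
have Q8 : (8 * Q k <= q k ^ n k)%N.
  rewrite (leq_trans _ (cascade_Q_le k))// leq_mul2r; apply/orP; right.
  by rewrite (@leq_trans 16)// leq_pmulr// expn_gt0.
have {hits} := hits Q8; rewrite -rhoS -/(Y k) => hits.
have -> : rho k a * ((Y k * Y k)%:R * (1 - (2 * k.+1%:R)^-1)) =
    (Y k * Y k)%:R * rho k a - rho k a * (Y k * Y k)%:R / (2 * k.+1%:R) by ring.
rewrite -full lerBrDr; apply: le_trans (lerD (lexx _) hits) _.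
rewrite [X in _ + X <= _]big_mkcond -big_split /=; apply: ler_sum_nat_lt => i iY.
by rewrite (dE i iY) na k0k /hitb qk /=; case: hit; rewrite /= ?addr0 ?add0r.
Qed.

(* (1 - x) (1 + S + x) <= 1 + S. *)
Let mass_le k0 k : mass k0 k * (1 + \sum_(0 <= j < k) loss k0 j) <= 1.
Proof.
elim: k => [|k IHk].
  rewrite big_nil addr0 mulr1 /mass Q00 rho00 big_mkcond /= big_nat1.
  by rewrite divr1.
apply: le_trans IHk; rewrite big_nat_recr//=; set S := \sum_(0 <= j < k) _.
have S0 : 0 <= S by apply: sumr_ge0 => j _; have /andP[] := loss_bounds k0 j.
have /andP[l0 l1] := loss_bounds k0 k.
apply: (@le_trans _ _ (mass k0 k * (1 - loss k0 k) * (1 + (S + loss k0 k)))).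
  by rewrite ler_wpM2r ?mass_step// !addr_ge0.
rewrite -mulrA ler_wpM2l//; nra.
Qed.

Let loss_unbounded k0 (C : R) : exists k, C < \sum_(0 <= j < k) loss k0 j.
Proof.
apply/not_existsP => hC.
have l0 j : 0 <= loss k0 j by have /andP[] := loss_bounds k0 j.
have hC' k : \sum_(0 <= j < k) loss k0 j <= C by rewrite leNgt; apply/negP; exact: hC.
have e8 : 0 < 1 / 8 :> R by lra.
have [N0 hN0] := bounded_series_tail l0 hC' e8.
have [A [B [/andP[NA AB] hq hs]]] := blocks (maxn N0 k0).
have := hN0 A B; rewrite AB andbT (leq_trans (leq_maxl _ _) NA) => /(_ isT).
have -> : \sum_(A <= j < B) loss k0 j = \sum_(A <= k < B) (2 * k.+1%:R)^-1.
  rewrite big_seq [RHS]big_seq; apply: eq_bigr => k; rewrite mem_index_iota => kAB.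
  rewrite /loss hq// eqxx andbT; case: ifP => // /negP[].
  by have /andP[Ak _] := kAB; rewrite (leq_trans _ Ak)// (leq_trans (leq_maxr _ _) NA).
by lra.
Qed.

Let nohit_sub k0 k (x : R) : 0 <= x ->
  (forall j, (k0 <= j)%N -> ~~ hitb j (Num.truncn (x * (Q j.+1)%:R))) ->
  nohit k0 k (Num.truncn (x * (Q k)%:R)).
Proof.
move=> x0 hx; elim: k => //= k IHk.
have YY0 : (0 < Y k * Y k)%N by rewrite muln_gt0 Y0.
rewrite -truncn_div ?mulr_ge0// -mulrA QS natrM mulfK ?IHk//=; last first.
  by rewrite pnatr_eq0 -lt0n.
by rewrite -natrM -QS negb_and; case: leqP => //= /hx.
Qed.

(** The exceptional points lie in every [E k], and the masses of these sets tend to 0 because the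
    losses have a divergent sum. *)
Lemma cascade_ae_hit k0 : {ae mu, forall x : R, 0 <= x < 1 ->
  exists2 k, (k0 <= k)%N & hitb k (Num.truncn (x * (Q k.+1)%:R))}.
Proof.
pose E k : set (measurableTypeR R) := [set x | (0 <= x < 1) && nohit k0 k (Num.truncn (x * (Q k)%:R))].
have mE k : measurable (E k) by exact: measurable_grid.
have muE k : mu (E k) = (mass k0 k)%:E by rewrite (mu_grid (Q0 k) (@muQ k)).
have mI : measurable (\bigcap_k E k) by apply: bigcap_measurable => //; exists 0%N.
have mu01 := cascade_prob01.
have mC : measurable (~` `[0, 1[%classic : set (measurableTypeR R)).
  by apply: measurableC; exact: measurable_itv.
exists (\bigcap_k E k); split => //.
  apply/eqP; rewrite -measure_le0; apply/lee_addgt0Pr => e e0; rewrite add0e.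
  have [k hk] := loss_unbounded k0 e^-1.
  apply: (@le_trans _ _ (mu (E k))).
    by apply: le_measure; rewrite ?inE//; apply: bigcap_inf.
  rewrite muE lee_fin; have h := mass_le k0 k.
  have : mass k0 k * e^-1 <= 1.
    apply: le_trans h; rewrite ler_wpM2l// (le_trans (ltW hk))// lerDr ler01//.
  by rewrite ler_pdivrMr// mul1r.
move=> x /= /not_implyP[x01 hx] k _; rewrite /E/= x01/=.
apply: nohit_sub => [|j kj]; first by have /andP[] := x01.
by apply/negP => hj; apply: hx; exists j.
Qed.

Lemma cascade_not_normal : (forall k, (k < n k)%N) -> (1 < b)%N ->
  {ae mu, forall x : R, 0 <= x < 1 -> ~ normal b x}.
Proof.
move=> nk b1; have := ae_foralln cascade_ae_hit; apply: filterS => x hx x01.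
apply: (@not_normal_zeros R b x eps) => // N0; have [k N0k] := hx N0 x01.
move=> /andP[/eqP qk]; rewrite /hit qk => hk; exists (n k); first exact: leq_ltn_trans (nk k).
(* As [Q k.+1] is [Q k * b ^ (2 * n k)], dividing by [Q k] leaves the integer formed by the first
   [2 * n k] base-[b] digits of [x]. *)
move: hk; have -> : (Num.truncn (x * (Q k.+1)%:R) %/ Q k = Num.truncn (b%:R ^+ (n k + n k) * x))%N.
  rewrite -truncn_div// ?mulr_ge0//; last by have /andP[] := x01.
  congr Num.truncn; rewrite QS qk -expnD natrM natrX.
  by field; rewrite gt_eqF.
by [].
Qed.

End hits.

End cascade.

(** * Choice of the parameters *)

Lemma expr_large (R : realType) (x A : R) : 1 < x ->
  exists n0 : nat, forall n, (n0 <= n)%N -> A <= x ^+ n.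
Proof.
move=> x1; have x0 : 0 < x by exact: lt_trans x1.
have A0 : 0 < Num.max A 1 by rewrite lt_max ltr01 orbT.
have xi : 0 <= x^-1 < 1 by rewrite invr_ge0 (ltW x0) invf_lt1.
have Ai : 0 < (Num.max A 1)^-1 by rewrite invr_gt0.
have [n0 hn0] := expr_lt_small xi Ai.
exists n0 => n n0n; rewrite exprVn ltf_pV2 ?posrE ?exprn_gt0// in hn0.
apply: (@le_trans _ _ (x ^+ n0)); first by rewrite (le_trans _ (ltW hn0))// le_max lexx.
by rewrite ler_eXn2l.
Qed.

Lemma eventually_forall_ltn (P : nat -> nat -> Prop) (K : nat) :
  (forall b, exists n0 : nat, forall n, (n0 <= n)%N -> P b n) ->
  exists n0 : nat, forall n, (n0 <= n)%N -> forall b, (b < K)%N -> P b n.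
Proof.
move=> hP; elim: K => [|K [n0 hn0]]; first by exists 0%N.
have [n1 hn1] := hP K; exists (maxn n0 n1) => n; rewrite geq_max => /andP[n0n n1n] b.
by rewrite ltnS leq_eqVlt => /predU1P[->|]; [exact: hn1|exact: hn0].
Qed.

Section good_stage.
Context {R : realType} (q : nat -> nat) (eps eta : R).
Hypotheses (q1 : forall k, (1 < q k)%N) (eps0 : 0 < eps) (eps1 : eps < 1).
Hypotheses (eta0 : 0 < eta) (eps_eta : 1 + eps <= 2 `^ eta).

(** Demands on the window length, all satisfied by large [n]. They involve the past only through [Q]
    and [D], and [good_sum] is uniform in the density. Only bases [b <= k] occur, finitely many per
    stage; every base is reached eventually. *)
Record good_stage (k Q : nat) (D : R) (n : nat) : Prop := GoodStage {
  good_density : D <= ((q k)%:R `^ eta) ^+ n;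
  good_scale : k.+1%:R * D * Q%:R * 16 * 2 ^+ k <= (q k ^ n)%:R;
  good_length : (128 * 2 ^ k <= n)%N;
  good_hits : 16 * (q k)%:R ^+ 2 <= eps ^+ 2 * n%:R;
  good_sum : forall b, (b <= k)%N -> (1 < b)%N -> ~ mult_dep b (q k) ->
    forall rho : nat -> R, (forall a, 0 <= rho a <= D) -> \sum_(0 <= a < Q) rho a = Q%:R ->
    forall u N, (0 < u)%N ->
    \sum_(0 <= i < N) nfour (Q * (q k ^ n * q k ^ n)) (next (q k) n Q k.+1 eps rho) (u * b ^ i)%:R
      <= n%:R / 2 ^+ k.+1 }.

Lemma good_stage_ex k Q D : (0 < Q)%N -> exists n, good_stage k Q D n.
Proof.
move=> Q0; have e0 := eps0.
have qR : 1 < (q k)%:R :> R by rewrite ltr1n.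
have th : 1 < (q k)%:R `^ eta :> R.
  apply: (@lt_le_trans _ _ (2 `^ eta)); first by apply: lt_le_trans eps_eta; lra.
  by rewrite ge0_ler_powR ?nnegrE ?(ltW eta0)// ler_nat.
have [n1 h1] := expr_large D th.
have [n2 h2] := expr_large (k.+1%:R * D * Q%:R * 16 * 2 ^+ k) qR.
have [a /(_ a (leqnn a)) ha] := expr_large (D * Q%:R) (ltr1n R 2 : 1 < 2 :> R).
have [|n3 h3] := @eventually_forall_ltn (fun b n => (1 < b)%N -> ~ mult_dep b (q k) ->
    forall rho : nat -> R, (forall a, 0 <= rho a <= D) -> \sum_(0 <= a < Q) rho a = Q%:R ->
    forall u N, (0 < u)%N ->
    \sum_(0 <= i < N) nfour (Q * (q k ^ n * q k ^ n)) (next (q k) n Q k.+1 eps rho) (u * b ^ i)%:R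
      <= n%:R / 2 ^+ k.+1) k.+1.
  move=> b; have [b1|b1] := ltnP 1 b; last by exists 0%N.
  have [bq|bq] := pselect (mult_dep b (q k)); first by exists 0%N.
  have e'0 : 0 < (2 ^+ k.+1)^-1 :> R by rewrite invr_gt0 exprn_gt0.
  have [n0 hn0] := @stage_sum R (q k) b a eps (2 ^+ k.+1)^-1 (q1 k) eps0 eps1 b1 bq e'0.
  exists n0 => n n0n _ _ rho rhoD rhoQ u N u0; rewrite mulrC.
  exact: (hn0 n n0n Q k.+1 D).
pose n4 := (Num.truncn (16 * (q k)%:R ^+ 2 / eps ^+ 2)).+1.
exists (n1 + n2 + n3 + n4 + 128 * 2 ^ k)%N; set n := (_ + _)%N.
have [l1 l2 l3 l4 l5] : [/\ (n1 <= n)%N, (n2 <= n)%N, (n3 <= n)%N, (n4 <= n)%N & (128 * 2 ^ k <= n)%N].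
  have aux a1 a2 a3 a4 a5 : let m := (a1 + a2 + a3 + a4 + a5)%N in
      [/\ (a1 <= m)%N, (a2 <= m)%N, (a3 <= m)%N, (a4 <= m)%N & (a5 <= m)%N] by split; lia.
  exact: aux.
split => //.
- exact: h1.
- by rewrite natrX; exact: h2.
- rewrite [leRHS]mulrC -ler_pdivrMr ?exprn_gt0//; apply/ltW/(lt_le_trans (truncnS_gt _)).
  by rewrite ler_nat.
- by move=> b bk; exact: h3.
Qed.

Fixpoint stages (pick : nat -> nat -> R -> nat) (k : nat) : nat * R * (nat -> R) :=
  if k is k'.+1 then
    let s := stages pick k' in let n := pick k' s.1.1 s.1.2 in
    ((s.1.1 * (q k' ^ n * q k' ^ n))%N, s.1.2 * (1 + eps) ^+ n, next (q k') n s.1.1 k'.+1 eps s.2)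
  else (1%N, 1, fun=> 1).

Lemma stages_ex : exists (n Q : nat -> nat) (D : nat -> R) (rho : nat -> nat -> R),
  [/\ [/\ Q 0%N = 1%N, D 0%N = 1 & rho 0%N = fun=> 1],
      forall k, Q k.+1 = (Q k * (q k ^ n k * q k ^ n k))%N,
      forall k, D k.+1 = D k * (1 + eps) ^+ n k,
      forall k, rho k.+1 = next (q k) (n k) (Q k) k.+1 eps (rho k) &
      forall k, good_stage k (Q k) (D k) (n k)].
Proof.
pose pick k Q D := xget 0%N [set n | good_stage k Q D n].
exists (fun k => pick k (stages pick k).1.1 (stages pick k).1.2).
exists (fun k => (stages pick k).1.1), (fun k => (stages pick k).1.2), (fun k => (stages pick k).2).
split => // k; apply: xgetPex; apply: good_stage_ex.
by elim: k => // k IHk; rewrite /= muln_gt0 IHk muln_gt0 !expn_gt0 ltnW.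
Qed.

End good_stage.

Lemma mult_dep_trans (r s t : nat) : mult_dep r s -> mult_dep s t -> mult_dep r t.
Proof.
move=> [m [n [m0 n0 e]]] [m' [n' [m'0 n'0 e']]].
exists (m * m')%N, (n' * n)%N; split; rewrite ?muln_gt0 ?m0 ?n'0//.
by rewrite expnM e expnAC e' -expnM.
Qed.

(* Every base of [C] occupies infinitely many dyadic blocks [2^s <= k + 1 < 2^s.+1],
   hence a set of stages k along which the sum of 1 / (k + 1) diverges. *)
Lemma block_enumeration (R : realType) (C : set nat) : C !=set0 -> exists q : nat -> nat,
  (forall k, C (q k)) /\ (forall b, C b -> forall N0 : nat, exists A B,
    [/\ (N0 <= A <= B)%N, forall k, (A <= k < B)%N -> q k = b &
        1 / 4 <= \sum_(A <= k < B) (2 * k.+1%:R)^-1 :> R]).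
Proof.
move=> [c0 Cc0]; pose e i := if `[< C i >] then i else c0.
(* The base is constant on dyadic blocks. Block [s] gets the 2-adic valuation of [s + 1], so each
   value recurs for infinitely many [s]; values outside [C] are replaced by [c0]. *)
exists (fun k => e (logn 2 (trunc_log 2 k.+1).+1)); split => [k|b Cb N0].
  by rewrite /e; case: asboolP.
(* The odd factor makes the valuation of [s + 1] equal to [b], and its size makes [s] at least
   [N0]. *)
pose s := (2 ^ b * (2 * N0).+1).-1.
have sE : s.+1 = (2 ^ b * (2 * N0).+1)%N by rewrite prednK// muln_gt0 expn_gt0.
have sN : (N0 <= s)%N.
  rewrite -ltnS sE (@leq_trans (2 * N0).+1)//; last by rewrite leq_pmull// expn_gt0.
  by rewrite ltnS leq_pmull.
have s2 : (0 < 2 ^ s)%N by rewrite expn_gt0.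
exists (2 ^ s).-1, (2 ^ s.+1).-1; split.
- rewrite -ltnS prednK// (leq_ltn_trans sN (ltn_expl _ _))//=.
  by rewrite -!subn1 leq_sub2r// leq_exp2l.
- move=> k /andP[k1 k2].
  have kE : trunc_log 2 k.+1 = s.
    apply: trunc_log_eq => //; rewrite -[X in (X <= _)%N]prednK// ltnS k1/=.
    by rewrite -[X in (_ < X)%N]prednK ?expn_gt0.
  rewrite kE sE lognM ?expn_gt0// pfactorK// (_ : logn 2 _ = 0%N) ?addn0.
    by rewrite /e; case: asboolP.
  by rewrite lognE/= dvdn2/= oddM.
apply: (@le_trans _ _ (\sum_((2 ^ s).-1 <= k < (2 ^ s.+1).-1) (2 * 2 ^+ s.+1)^-1)); last first.
  rewrite big_seq [leRHS]big_seq; apply: ler_sum => k; rewrite mem_index_iota => /andP[_ k2].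
  rewrite lef_pV2 ?posrE ?mulr_gt0 ?exprn_gt0// ler_pM2l// -natrX ler_nat.
  exact: leq_trans k2 (leq_pred _).
rewrite sumr_const_nat; have -> : ((2 ^ s.+1).-1 - (2 ^ s).-1 = 2 ^ s)%N.
  by rewrite expnS mul2n -addnn -!subn1 -addnBA// addnK.
rewrite -[leRHS]mulr_natr natrX exprS.
have : 2 ^+ s != 0 :> R by rewrite expf_neq0.
by move: (2 ^+ s) => p p0; rewrite le_eqVlt; apply/orP; left; apply/eqP; field.
Qed.

Lemma normality_measure (R : realType) (C : set nat) (eta : R) :
  C !=set0 -> C `<=` bases -> 0 < eta < 1 ->
  exists mu : probability (measurableTypeR R) R,
  [/\ mu `[0, 1[%classic = 1%E,
      {ae mu, forall x : R, forall b, C b -> ~ normal b x},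
      {ae mu, forall x : R, forall b, bases b -> (forall c, C c -> ~ mult_dep b c) -> normal b x},
      (ball_sup mu (1 - eta)%R < +oo)%E & Rajchman mu].
Proof.
move=> C0 Cb /andP[eta0 eta1].
have [q [qC blocks]] := block_enumeration R C0.
have q1 k : (1 < q k)%N by exact/Cb/qC.
have th : 1 < 2 `^ eta :> R by rewrite /powR pnatr_eq0/= expR_gt1 mulr_gt0// ln_nat_gt0.
(* As [1 + eps <= 2 ^ eta <= q ^ eta] for every base [q], a single [eps] serves all stages. *)
pose eps : R := Num.min (1 / 2) (2 `^ eta - 1).
have eps0 : 0 < eps by rewrite lt_min subr_gt0 th andbT; lra.
have eps1 : eps < 1 by rewrite gt_min; apply/orP; left; lra.
have eps_eta : 1 + eps <= 2 `^ eta by rewrite -lerBrDl ge_min lexx orbT.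
have [n [Q [D [rho [[Q00 D00 rho00] QS DS rhoS good]]]]] := stages_ex q1 eps0 eps1 eta0 eps_eta.
have nl k := good_scale (good k).
have [mu muQ] := cascade_measure q1 eps0 eps1 Q00 D00 rho00 QS DS rhoS nl.
have mu01 := cascade_prob01 q1 eps0 eps1 Q00 rho00 QS rhoS muQ.
have ae01 : {ae mu, forall x : R, 0 <= x < 1}.
  exists (~` `[0, 1[%classic); split.
  - by apply: measurableC; exact: measurable_itv.
  - by rewrite probability_setC ?mu01 ?subee//; exact: measurable_itv.
  - by move=> x /= hx; rewrite in_itv.
exists mu; split => //.
- apply: ae_foralln => b; have [Cb'|nC] := pselect (C b); last by apply: aeW.
  have nk k : (k < n k)%N.
    rewrite (leq_trans _ (good_length (good k)))// (leq_trans (ltn_expl k (ltnSn 1)))//.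
    by rewrite leq_pmull.
  have hb := cascade_not_normal q1 eps0 eps1 Q00 D00 rho00 QS DS rhoS nl muQ
    (fun k => good_hits (good k)) (blocks b Cb') nk (Cb b Cb').
  by move: ae01 hb; apply: (@filterS2 (measurableTypeR R)) => x x01 + _; apply.
- apply: ae_foralln => b; have [hb|nhb] := pselect (bases b /\ forall c, C c -> ~ mult_dep b c);
    last by apply: aeW => x bb hb; exfalso; exact: nhb.
  have [b1 bC] := hb.
  have n0 k : (0 < n k)%N by rewrite (leq_trans _ (good_length (good k)))// muln_gt0 expn_gt0.
  have Yn k : (2 ^ n k <= q k ^ n k)%N by rewrite leq_exp2r.
  have Yk k : (k <= q k ^ n k)%N.
    exact: ltnW (cascade_Y_ge q1 eps0 Q00 D00 QS DS nl k).
  have rhoD := cascade_rho_bounds eps0 eps1 D00 rho00 DS rhoS.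
  have rhoQ := cascade_rho_sum q1 eps0 eps1 Q00 rho00 QS rhoS.
  have hS k : (b <= k)%N -> forall u M, (0 < u)%N ->
      \sum_(0 <= i < M) nfour (Q k.+1) (rho k.+1) (u * b ^ i)%:R <= (n k)%:R / 2 ^+ k.+1.
    move=> bk u M u0; rewrite QS rhoS.
    exact: (good_sum (good k) bk b1 (bC _ (qC k)) (rhoD k) (rhoQ k) M u0).
  have hat := cascade_hat q1 eps0 eps1 Q00 D00 rho00 QS DS rhoS nl muQ b1
    (fun k => good_length (good k)) hS.
  move: ae01 (ae_normal mu01 b1 Yn Yk hat).
  by apply: (@filterS2 (measurableTypeR R)) => x x01 hx _ _; apply: hx; rewrite in_itv.
- apply: (cascade_ball_sup q1 eps0 eps1 Q00 D00 rho00 QS DS rhoS nl muQ _ eps_eta) => [|k].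
    by rewrite eta0.
  exact: good_density (good k).
- exact: (cascade_Rajchman q1 eps0 eps1 Q00 D00 rho00 QS DS rhoS nl muQ).
Qed.

Theorem theorem1p4 (R : realType) (B' : set nat) :
  B' !=set0 -> B' `<=` bases ->
  exists M Mstar : set (probability (measurableTypeR R) R),
    [/\ M `<=` Mstar,
        Mstar `<=` @prob01 R,
        forall mu, Mstar mu ->
          {ae mu, forall x : R, forall b, B' b -> ~ normal b x},
        largest_compatible (bases `\` base_closure B') B' /\
        (forall mu, M mu ->
          {ae mu, forall x : R, @normal_set R (bases `\` base_closure B') B' x})
      & forall eta : R, 0 < eta < 1 ->
          exists mu, [/\ M mu, (ball_sup mu (1 - eta)%R < +oo)%E
                       & Rajchman mu]].
Proof.
move=> [b0 B'b0] B'b; pose C := base_closure B'.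
have refl b : mult_dep b b by exists 1%N, 1%N.
have B'C : B' `<=` C by move=> b hb; split; [exact: B'b|exists b].
(* One collection serves as both: all measures with properties (a) and (b). The content then lies in
   the existence claim (c). *)
pose M := [set mu : probability (measurableTypeR R) R | [/\ prob01 mu,
  {ae mu, forall x : R, forall b, B' b -> ~ normal b x} &
  {ae mu, forall x : R, @normal_set R (bases `\` C) B' x}]].
exists M, M; split => //.
- by move=> mu [].
- by move=> mu [].
- split; last by move=> mu [].
  split; first by move=> b [].
    by move=> b b' [bb nb] hb' d; apply: nb; split => //; exists b'.
  move=> C' C'b comp b C'b'; split; first exact: C'b.
  by move=> [_ [b1 B'b1 d]]; exact: comp d.
move=> eta eta01.
have [|||mu [mu01 nn nl ball raj]] := @normality_measure R C eta.
- by exists b0; exact: B'C.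
- by move=> b [].
- exact: eta01.
exists mu; split => //; split => //.
  by move: nn; apply: (@filterS (measurableTypeR R)) => x hx b /B'C; exact: hx.
move: nn nl; apply: (@filterS2 (measurableTypeR R)) => x hn hl.
(* If no base lies outside [C], the points must be non-normal in every base; this is why the measure
   was built for [C] and not only for [B']. *)
rewrite /normal_set/=; case: asboolP => [/seteqP[hC _] b bb|_].
  apply: hn; apply: contrapT => nC; exact: (hC b).
split=> [b [bb nC]|b /B'C]; last exact: hn.
apply: hl => // c [cb [b1 B'b1 d]] bc; apply: nC; split => //; exists b1 => //.
exact: mult_dep_trans d.
Qed.
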